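(* Let $l\ge 1$, let $(\mathbb{V},\omega)$ be a complex symplectic vector space of dimension $2l$, let $\mathfrak{g}=\mathfrak{sp}(\mathbb{V},\omega)\simeq\mathfrak{sp}(2l,\mathbb{C})$, and let $\mathbb{S}=L(-\tfrac12\varpi_l)$ be the basic symplectic spinor module. Then the following isomorphisms of $\mathfrak{g}$-modules hold (with $i\ge 0$ an integer). (1) For $2i+1\le l-1$, $$\bigwedge^{2i+1}\mathbb{V}^*\otimes\mathbb{S}\;\simeq\;\bigwedge^{2l-2i-1}\mathbb{V}^*\otimes\mathbb{S}\;\simeq\;\bigoplus_{k=0}^{i}L\bigl(\varpi_{2k+1}-\tfrac12\varpi_l\bigr)\;\oplus\;\bigoplus_{k=0}^{i}L\bigl(\varpi_{2k}+\varpi_{l-1}-\tfrac32\varpi_l\bigr).$$ (2) For $2i\le l-1$, $$\bigwedge^{2i}\mathbb{V}^*\otimes\mathbb{S}\;\simeq\;\bigwedge^{2l-2i}\mathbb{V}^*\otimes\mathbb{S}\;\simeq\;\bigoplus_{k=0}^{i}L\bigl(\varpi_{2k}-\tfrac12\varpi_l\bigr)\;\oplus\;\bigoplus_{k=1}^{i}L\bigl(\varpi_{2k-1}+\varpi_{l-1}-\tfrac32\varpi_l\bigr).$$ (3) For $l$ even, $$\bigwedge^{l}\mathbb{V}^*\otimes\mathbb{S}\;\simeq\;\bigoplus_{k=0}^{(l-2)/2}L\bigl(\varpi_{2k}-\tfrac12\varpi_l\bigr)\;\oplus\;L\bigl(\tfrac12\varpi_l\bigr)\;\oplus\;\bigoplus_{k=1}^{(l-2)/2}L\bigl(\varpi_{2k-1}+\varpi_{l-1}-\tfrac32\varpi_l\bigr)\;\oplus\;L\bigl(2\varpi_{l-1}-\tfrac32\varpi_l\bigr).$$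 (4) For $l$ odd, $$\bigwedge^{l}\mathbb{V}^*\otimes\mathbb{S}\;\simeq\;\bigoplus_{k=0}^{(l-3)/2}L\bigl(\varpi_{2k+1}-\tfrac12\varpi_l\bigr)\;\oplus\;L\bigl(\tfrac12\varpi_l\bigr)\;\oplus\;\bigoplus_{k=0}^{(l-3)/2}L\bigl(\varpi_{2k}+\varpi_{l-1}-\tfrac32\varpi_l\bigr)\;\oplus\;L\bigl(2\varpi_{l-1}-\tfrac32\varpi_l\bigr).$$
   Context: Fix a Cartan subalgebra $\mathfrak{h}$ of $\mathfrak{g}=\mathfrak{sp}(\mathbb{V},\omega)$ and a choice of positive roots $\Phi^+$; $\varpi_1,\ldots,\varpi_l$ are the corresponding fundamental weights, numbered in the standard way, so that there is an orthogonal basis $\epsilon_1,\ldots,\epsilon_l$ of $\mathfrak{h}^*$ (with respect to the Killing form) with $\varpi_i=\sum_{j=1}^{i}\epsilon_j$ and with the weights of the defining representation $\mathbb{V}$ being $\pm\epsilon_1,\ldots,\pm\epsilon_l$. By convention $\varpi_0:=0$. For $\lambda\in\mathfrak{h}^*$ (not necessarily integral or dominant), $L(\lambda)$ denotes the irreducible highest weight $\mathfrak{g}$-module with highest weight $\lambda$ (in general infinite dimensional). The basic symplectic spinor module is $\mathbb{S}=\mathbb{S}_+:=L(-\tfrac12\varpi_l)$. Empty direct sums are zero. Tensor products are algebraic tensor products of $\mathfrak{g}$-modules over $\mathbb{C}$. *)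

(* Defs.v *)
From HB Require Import structures.
From mathcomp Require Import all_boot all_order all_algebra.
From mathcomp Require Import sesquilinear boolp reals.
From mathcomp Require Import finmap complex monalg.

Set Implicit Arguments.
Unset Strict Implicit.
Unset Printing Implicit Defensive.

Import GRing.Theory.
Local Open Scope ring_scope.

Reserved Notation "M ≃ N" (at level 70, no associativity).
Reserved Notation "M ⊕ N" (at level 50, left associativity).
Reserved Notation "M ⊗ N" (at level 40, left associativity).
Reserved Notation "\bigoplus_ ( m <= k < n ) F"
  (at level 41, F at level 41, k, m, n at level 50,
   format "'[' \bigoplus_ ( m  <=  k  <  n ) '/  '  F ']'").

HB.mixin Record isLieAlgebra (K : fieldType) G of Vector K G := {
  lie : G -> G -> G;
  lie_linearl : forall y, linear (lie ^~ y);
  lie_linearr : forall x, linear (lie x);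
  liexx : forall x, lie x x = 0;
  lie_jacobi : forall x y z,
    lie x (lie y z) + lie y (lie z x) + lie z (lie x y) = 0 }.

#[short(type="lieAlgType")]
HB.structure Definition LieAlgebra (K : fieldType) :=
  { G of isLieAlgebra K G & Vector K G }.

HB.mixin Record isLieModule (K : fieldType) (g : lieAlgType K) M
    of GRing.Lmodule K M := {
  lact : g -> M -> M;
  lact_linearl : forall m, linear (lact ^~ m);
  lact_linearr : forall x, linear (lact x);
  lact_lie : forall x y m,
    lact (lie x y) m = lact x (lact y m) - lact y (lact x m) }.

#[short(type="lieModType")]
HB.structure Definition LieModule (K : fieldType) (g : lieAlgType K) :=
  { M of isLieModule K g M & GRing.Lmodule K M }.

Definition lie_iso (K : fieldType) (g : lieAlgType K) (M N : lieModType g) :=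
  exists f : M -> N, [/\ linear f, bijective f
    & forall (x : g) m, f (lact x m) = lact x (f m)].
Notation "M ≃ N" := (lie_iso M N) : type_scope.

Section PlainLinear.
Variables (K : fieldType) (U W : lmodType K) (f : U -> W) (fL : linear f).
Lemma lin_D u v : f (u + v) = f u + f v.
Proof. by rewrite -[u]scale1r fL !scale1r. Qed.
Lemma lin_B u v : f (u - v) = f u - f v.
Proof. by rewrite addrC -scaleN1r fL scaleN1r addrC. Qed.
Lemma lin_0 : f 0 = 0.
Proof. by rewrite -(subrr 0) lin_B subrr. Qed.
Lemma lin_Z a u : f (a *: u) = a *: f u.
Proof. by rewrite -[a *: u]addr0 fL lin_0 addr0. Qed.
Lemma lin_sum I (r : seq I) (P : pred I) (F : I -> U) :
  f (\sum_(i <- r | P i) F i) = \sum_(i <- r | P i) f (F i).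
Proof. by apply: (big_morph f lin_D lin_0). Qed.
End PlainLinear.

Section GeneratedSubmodule.
Variables (K : fieldType) (M : lmodType K) (T : Type) (op : T -> M -> M).

Definition op_submod (S : M -> Prop) :=
  [/\ S 0, forall a u v, S u -> S v -> S (a *: u + v)
    & forall t u, S u -> S (op t u)].

(* the smallest linear subspace containing A and stable under all op t *)
Definition gen_submod (A : M -> Prop) : {pred M} := fun m =>
  `[< forall S, op_submod S -> (forall u, A u -> S u) -> S m >].

Variable A : M -> Prop.

Lemma gen_submod_closed : submod_closed (gen_submod A).
Proof.
split=> [|a u v /asboolP uA /asboolP vA]; apply/asboolP => S SS AS.
  by case: SS.
by have [_ SD _] := SS; apply: SD; [apply: uA | apply: vA].
Qed.
HB.instance Definition _ :=
  GRing.isSubmodClosed.Build K M (gen_submod A) gen_submod_closed.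

Lemma gen_submod_op t u : u \in gen_submod A -> op t u \in gen_submod A.
Proof.
move=> /asboolP uA; apply/asboolP => S SS AS.
by have [_ _ SO] := SS; apply: SO; apply: uA.
Qed.

Lemma mem_gen_submod u : A u -> u \in gen_submod A.
Proof. by move=> Au; apply/asboolP => S _; apply. Qed.

Lemma gen_submod_ind (S : M -> Prop) : op_submod S ->
  (forall u, A u -> S u) -> forall u, u \in gen_submod A -> S u.
Proof. by move=> SS AS u /asboolP; apply. Qed.

End GeneratedSubmodule.

Definition span_submod (K : fieldType) (M : lmodType K) (A : M -> Prop) :=
  gen_submod (fun v : void => of_void _ v) A.

Section QuotientModule.
Variables (K : fieldType) (M : lmodType K) (S : submodClosed M).

Definition submod_zmod : {pred M} := S.
Fact submod_zmod_closed : zmod_closed submod_zmod.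
Proof. exact: GRing.submod_closedB (submodClosedP S). Qed.
HB.instance Definition _ :=
  GRing.isZmodClosed.Build M submod_zmod submod_zmod_closed.

Definition quotmod : Type := {ideal_quot submod_zmod}.
HB.instance Definition _ := GRing.Zmodule.on quotmod.

Definition quot_pi (m : M) : quotmod := \pi_{ideal_quot submod_zmod}%qT m.
Definition quot_repr (q : quotmod) : M := repr (q : {ideal_quot submod_zmod}).

Lemma quot_reprK q : quot_pi (quot_repr q) = q. Proof. exact: reprK. Qed.

Lemma quot_piP m n : quot_pi m = quot_pi n <-> m - n \in S.
Proof.
rewrite /quot_pi; split=> [/eqP|mn]; first by rewrite -Quotient.idealrBE.
by apply/eqP; rewrite -Quotient.idealrBE.
Qed.

Lemma quot_piD m n : quot_pi (m + n) = quot_pi m + quot_pi n.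
Proof. exact: Quotient.pi_add. Qed.

Definition quot_map (f : M -> M) (q : quotmod) := quot_pi (f (quot_repr q)).

Lemma quot_mapE (f : M -> M) : linear f -> {homo f : m / m \in S} ->
  forall m, quot_map f (quot_pi m) = quot_pi (f m).
Proof.
move=> fL fS m; apply/quot_piP.
have := fL (-1) m (quot_repr (quot_pi m)).
rewrite !scaleN1r ![- _ + _]addrC => <-; apply: fS.
by apply/quot_piP; rewrite quot_reprK.
Qed.

Definition quot_scale a := quot_map ( *:%R a).

Lemma quot_scaleE a m : quot_scale a (quot_pi m) = quot_pi (a *: m).
Proof.
apply: quot_mapE => [b u v|u uS]; last exact: rpredZ.
by rewrite scalerDr !scalerA mulrC.
Qed.

Fact quot_scaleA a b q : quot_scale a (quot_scale b q) = quot_scale (a * b) q.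
Proof. by rewrite -[q]quot_reprK !quot_scaleE scalerA. Qed.
Fact quot_scale1 : left_id 1 quot_scale.
Proof. by move=> q; rewrite -[q]quot_reprK quot_scaleE scale1r. Qed.
Fact quot_scaleDr : right_distributive quot_scale +%R.
Proof.
move=> a p q; rewrite -[p]quot_reprK -[q]quot_reprK.
by rewrite -quot_piD !quot_scaleE -quot_piD scalerDr.
Qed.
Fact quot_scaleDl q : {morph quot_scale^~ q : a b / a + b}.
Proof.
by move=> a b; rewrite -[q]quot_reprK !quot_scaleE -quot_piD scalerDl.
Qed.
HB.instance Definition _ := GRing.Zmodule_isLmodule.Build K quotmod
  quot_scaleA quot_scale1 quot_scaleDr quot_scaleDl.

Lemma quot_pi_linear : linear quot_pi.
Proof. by move=> a u v; rewrite quot_piD -quot_scaleE. Qed.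
Lemma quot_pi_eq0 m : quot_pi m = 0 <-> m \in S.
Proof. by rewrite -(lin_0 quot_pi_linear) quot_piP subr0. Qed.

End QuotientModule.

(* A g-module given as a quotient F / S of vector spaces, on which the action
   of g is induced by linear maps of F that satisfy the axioms modulo S. *)
Record lieQuotData (K : fieldType) (g : lieAlgType K) := LieQuotData {
  lq_mod : lmodType K;
  lq_sub : submodClosed lq_mod;
  lq_act : g -> lq_mod -> lq_mod;
  lq_linearr : forall x, linear (lq_act x);
  lq_stable : forall x, {homo lq_act x : m / m \in lq_sub};
  lq_linearl : forall a x y m,
    lq_act (a *: x + y) m - (a *: lq_act x m + lq_act y m) \in lq_sub;
  lq_lie : forall x y m, lq_act (lie x y) m
    - (lq_act x (lq_act y m) - lq_act y (lq_act x m)) \in lq_sub }.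

Section LieQuotient.
Variables (K : fieldType) (g : lieAlgType K) (D : lieQuotData g).

Definition lieQuot := quotmod (lq_sub D).
HB.instance Definition _ := GRing.Lmodule.on lieQuot.

Definition lieQuot_act (x : g) (q : lieQuot) : lieQuot :=
  quot_map (@lq_act _ _ D x) q.

Lemma lieQuot_actE x m :
  lieQuot_act x (quot_pi _ m) = quot_pi _ (lq_act x m).
Proof. exact: (quot_mapE (@lq_linearr _ _ D x) (@lq_stable _ _ D x)). Qed.

Fact lieQuot_act_linearl q : linear (lieQuot_act ^~ q).
Proof.
move=> a x y; rewrite -[q]quot_reprK !lieQuot_actE.
by rewrite -quot_pi_linear; apply/quot_piP/lq_linearl.
Qed.
Fact lieQuot_act_linearr x : linear (lieQuot_act x).
Proof.
move=> a p q; rewrite -[p]quot_reprK -[q]quot_reprK.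
rewrite -[_ *: _ + _]quot_pi_linear !lieQuot_actE.
by rewrite -[RHS]quot_pi_linear lq_linearr.
Qed.
Fact lieQuot_act_lie x y q : lieQuot_act (lie x y) q
  = lieQuot_act x (lieQuot_act y q) - lieQuot_act y (lieQuot_act x q).
Proof.
rewrite -[q]quot_reprK !lieQuot_actE.
rewrite addrC -scaleN1r -[RHS]quot_pi_linear scaleN1r addrC.
exact/quot_piP/lq_lie.
Qed.
HB.instance Definition _ := isLieModule.Build K g lieQuot
  lieQuot_act_linearl lieQuot_act_linearr lieQuot_act_lie.

End LieQuotient.

Definition free_mod (K : fieldType) (X : choiceType) : lmodType K :=
  {malg K[X]}.
(* free_gen and mlift are locked: otherwise failing unification problems unfold
   the finitely supported functions underlying malg *)
HB.lock Definition free_gen (K : fieldType) (X : choiceType) (x : X) :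
  free_mod K X := << x >>.

(* the linear extension of f to the free vector space on X *)
HB.lock Definition mlift (K : fieldType) (X : choiceType) (W : lmodType K)
  (f : X -> W) (p : free_mod K X) : W := \sum_(k <- msupp p) p@_k *: f k.

Section FreeModule.
Variables (K : fieldType) (X : choiceType) (W : lmodType K) (f : X -> W).
Local Notation mlift := (mlift f).

Lemma mlift_linear : linear mlift.
Proof.
have mliftEw p (d : {fset X}) : (msupp p `<=` d)%fset ->
    mlift p = \sum_(k <- d) p@_k *: f k.
  move=> pd; rewrite mlift.unlock (big_fset_incl _ pd) // => k _ kp.
  by rewrite mcoeff_outdom ?scale0r.
move=> a p q; set d := (msupp (a *: p + q) `|` msupp p `|` msupp q)%fset.
rewrite !(@mliftEw _ d) ?fsubsetUr //; last 2 first.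
- by rewrite /d fsetUAC fsubsetUr.
- by rewrite /d -fsetUA fsubsetUl.
rewrite scaler_sumr -big_split; apply: eq_bigr => k _ /=.
by rewrite mcoeffD mcoeffZ scalerDl scalerA.
Qed.
Lemma mliftU x : mlift (free_gen K x) = f x.
Proof.
by rewrite mlift.unlock free_gen.unlock msuppU oner_eq0 big_seq_fset1 mcoeffUU scale1r.
Qed.

End FreeModule.

Section FreeModuleTheory.
Variables (K : fieldType) (X : choiceType).
Local Notation F := (free_mod K X).

Lemma malg_eq (W : lmodType K) (f1 f2 : F -> W) : linear f1 -> linear f2 ->
  (forall x, f1 (free_gen K x) = f2 (free_gen K x)) -> f1 =1 f2.
Proof.
move=> f1L f2L; rewrite free_gen.unlock => f12 p; rewrite [p]monalgE !(lin_sum f1L, lin_sum f2L).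
apply: eq_bigr => x _; rewrite (_ : << _ *g x >> = p@_x *: (<< x >> : free_mod K X)); last first.
  by apply/malgP => k; rewrite mcoeffZ !mcoeffU mulrnAr mulr1.
by rewrite (lin_Z f1L) (lin_Z f2L) f12.
Qed.

Variables (g : lieAlgType K) (S : submodClosed F) (act : g -> F -> F).
Hypothesis actL : forall x, linear (act x).
Local Notation pi := (quot_pi S).
Let piL := quot_pi_linear S.

Lemma free_linearl :
  (forall a x y k, pi (act (a *: x + y) (free_gen K k))
    = a *: pi (act x (free_gen K k)) + pi (act y (free_gen K k))) ->
  forall a x y m, act (a *: x + y) m - (a *: act x m + act y m) \in S.
Proof.
move=> H a x y m; apply/quot_piP; rewrite piL.
apply: (malg_eq (f1 := fun m => pi (act _ m))
  (f2 := fun m => a *: pi (act x m) + pi (act y m))) m => [b u v|b u v|k].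
- by rewrite actL piL.
- by rewrite !actL !piL !scalerDr !scalerA [a * b]mulrC addrACA.
- exact: H.
Qed.

Lemma free_lie :
  (forall x y k, pi (act (lie x y) (free_gen K k))
    = pi (act x (act y (free_gen K k))) - pi (act y (act x (free_gen K k)))) ->
  forall x y m, act (lie x y) m - (act x (act y m) - act y (act x m)) \in S.
Proof.
move=> H x y m; apply/quot_piP; rewrite (lin_B piL).
apply: (malg_eq (f1 := fun m => pi (act _ m))
  (f2 := fun m => pi (act x (act y m)) - pi (act y (act x m)))) m
  => [b u v|b u v|k].
- by rewrite actL piL.
- by rewrite !actL !piL scalerBr opprD addrACA.
- exact: H.
Qed.

Lemma free_stable (A : F -> Prop) x : S = span_submod A ->
  (forall p, A p -> pi (act x p) = 0) -> {homo act x : m / m \in S}.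
Proof.
move=> SA H u; rewrite {1}SA; move: u.
apply: (gen_submod_ind (S := fun u => act x u \in S)) => [|p /H]; first split.
- by rewrite (lin_0 (actL x)) rpred0.
- by move=> a u v uS vS; rewrite actL rpredD ?rpredZ.
- by case.
by move/quot_pi_eq0.
Qed.

End FreeModuleTheory.

Section Tensor.
Variables (K : fieldType) (g : lieAlgType K) (M N : lieModType g).
Local Notation F := (free_mod K (M * N)%type).

Definition pure (m : M) (n : N) : F := free_gen K (m, n).

Definition tensor_rel (p : F) :=
  (exists a m m' n,
    p = pure (a *: m + m') n - (a *: pure m n + pure m' n)) \/
  (exists a m n n',
    p = pure m (a *: n + n') - (a *: pure m n + pure m n')).

Definition tensor_act (x : g) : F -> F :=
  mlift (fun mn => pure (lact x mn.1) mn.2 + pure mn.1 (lact x mn.2)).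

Local Notation S := (span_submod tensor_rel).

Fact tensor_linearr x : linear (tensor_act x).
Proof. exact: mlift_linear. Qed.

Lemma tensor_actU x m n :
  tensor_act x (pure m n) = pure (lact x m) n + pure m (lact x n).
Proof. exact: mliftU. Qed.

Let piL := quot_pi_linear S.
Let t m n : quotmod S := quot_pi S (pure m n).

Let tDl a m m' n : t (a *: m + m') n = a *: t m n + t m' n.
Proof.
rewrite -piL; apply/quot_piP/mem_gen_submod.
by left; exists a, m, m', n.
Qed.

Let tDr a m n n' : t m (a *: n + n') = a *: t m n + t m n'.
Proof.
rewrite -piL; apply/quot_piP/mem_gen_submod.
by right; exists a, m, n, n'.
Qed.

Let tBl m m' n : t (m - m') n = t m n - t m' n.
Proof. by rewrite addrC -scaleN1r tDl scaleN1r addrC. Qed.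

Let tBr m n n' : t m (n - n') = t m n - t m n'.
Proof. by rewrite addrC -scaleN1r tDr scaleN1r addrC. Qed.

Let t_act x m n : quot_pi S (tensor_act x (pure m n))
  = t (lact x m) n + t m (lact x n).
Proof. by rewrite tensor_actU quot_piD. Qed.

Fact tensor_stable x : {homo tensor_act x : m / m \in S}.
Proof.
apply: (free_stable tensor_linearr (A := tensor_rel)) => // p.
case=> [[a [m [m' [n ->]]]]|[a [m [n [n' ->]]]]].
  rewrite (lin_B (tensor_linearr x)) (lin_B piL) tensor_linearr piL.
  rewrite 3!t_act lact_linearr 2!tDl scalerDr.
  by apply/eqP; rewrite subr_eq0 addrACA.
rewrite (lin_B (tensor_linearr x)) (lin_B piL) tensor_linearr piL.
rewrite 3!t_act lact_linearr 2!tDr scalerDr.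
by apply/eqP; rewrite subr_eq0 addrACA.
Qed.

Fact tensor_linearl a x y m :
  tensor_act (a *: x + y) m - (a *: tensor_act x m + tensor_act y m) \in S.
Proof.
apply: (free_linearl tensor_linearr) => {}a {}x {}y [u v].
by rewrite 3!t_act 2!lact_linearl tDl tDr scalerDr addrACA.
Qed.

Fact tensor_lie x y m : tensor_act (lie x y) m
  - (tensor_act x (tensor_act y m) - tensor_act y (tensor_act x m)) \in S.
Proof.
apply: (free_lie tensor_linearr) => {}x {}y [u v].
rewrite t_act 2!tensor_actU 2!(lin_D (tensor_linearr _)) 2!quot_piD 4!t_act.
rewrite 2!lact_lie tBl tBr.
have addACBA (W : zmodType) (a b c d p q : W) :
    (a - b) + (c - d) = (a + p + (q + c)) - (b + q + (p + d)).
  rewrite [a + p + _]addrACA [b + q]addrC opprD [RHS]addrACA.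
  by rewrite [p + c]addrC !addrKA.
exact: addACBA.
Qed.

Definition tensor : lieModType g := lieQuot
  (LieQuotData tensor_linearr tensor_stable tensor_linearl tensor_lie).

End Tensor.
Notation "M ⊗ N" := (tensor M N).

Section Exterior.
Variables (K : fieldType) (g : lieAlgType K) (r : nat) (M : lieModType g).
Local Notation F := (free_mod K {ffun 'I_r -> M}).

Definition wedge (f : {ffun 'I_r -> M}) : F := free_gen K f.

Definition ffun_upd (f : {ffun 'I_r -> M}) i u : {ffun 'I_r -> M} :=
  [ffun j => if j == i then u else f j].

Definition exterior_rel (p : F) :=
  (exists f i a u v, p = wedge (ffun_upd f i (a *: u + v))
    - (a *: wedge (ffun_upd f i u) + wedge (ffun_upd f i v))) \/
  (exists (f : {ffun 'I_r -> M}) i j, [/\ i != j, f i = f j & p = wedge f]).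

Definition exterior_act (x : g) : F -> F :=
  mlift (fun f => \sum_(i < r) wedge (ffun_upd f i (lact x (f i)))).

Local Notation S := (span_submod exterior_rel).

Fact exterior_linearr x : linear (exterior_act x).
Proof. exact: mlift_linear. Qed.

Lemma exterior_actU x f :
  exterior_act x (wedge f) = \sum_(i < r) wedge (ffun_upd f i (lact x (f i))).
Proof. exact: mliftU. Qed.

Let piL := quot_pi_linear S.
Let e f : quotmod S := quot_pi S (wedge f).

Let updC f i j u v : i != j ->
  ffun_upd (ffun_upd f i u) j v = ffun_upd (ffun_upd f j v) i u.
Proof.
move=> ij; apply/ffunP => k; rewrite !ffunE.
by case: eqVneq => // ->; rewrite eq_sym (negPf ij).
Qed.

Let updK f i u v : ffun_upd (ffun_upd f i u) i v = ffun_upd f i v.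
Proof. by apply/ffunP => k; rewrite !ffunE; case: eqP. Qed.

Let upd_id f i : ffun_upd f i (f i) = f.
Proof. by apply/ffunP => k; rewrite !ffunE; case: eqP => // ->. Qed.

Let eL f i a u v : e (ffun_upd f i (a *: u + v))
  = a *: e (ffun_upd f i u) + e (ffun_upd f i v).
Proof.
rewrite -piL; apply/quot_piP/mem_gen_submod.
by left; exists f, i, a, u, v.
Qed.

Let eD f i u v : e (ffun_upd f i (u + v))
  = e (ffun_upd f i u) + e (ffun_upd f i v).
Proof. by rewrite -[u]scale1r eL !scale1r. Qed.

Let eB f i u v : e (ffun_upd f i (u - v))
  = e (ffun_upd f i u) - e (ffun_upd f i v).
Proof. by rewrite addrC -scaleN1r eL scaleN1r addrC. Qed.

Let e0 (f : {ffun 'I_r -> M}) i j : i != j -> f i = f j -> e f = 0.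
Proof.
move=> ij fij; apply/quot_pi_eq0/mem_gen_submod.
by right; exists f, i, j.
Qed.

Let e_skew (f : {ffun 'I_r -> M}) i j w : i != j -> f i = f j ->
  e (ffun_upd f i w) + e (ffun_upd f j w) = 0.
Proof.
move=> ij fij; pose G a b := ffun_upd (ffun_upd f i a) j b.
have G0 a : e (G a a) = 0.
  by apply: (e0 ij); rewrite !ffunE eqxx (negPf ij) eqxx.
have eGD a b c d : e (G (a + b) (c + d))
    = e (G a c) + e (G b c) + (e (G a d) + e (G b d)).
  by rewrite /G eD ![ffun_upd (ffun_upd f i _) j _]updC // !eD.
have -> : ffun_upd f i w = G w (f i).
  apply/ffunP => k; rewrite !ffunE; case: (eqVneq k j) => // ->.
  by rewrite eq_sym (negPf ij) fij.
have -> : ffun_upd f j w = G (f i) w by rewrite /G upd_id.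
by have := eGD (f i) w (f i) w; rewrite !G0 add0r addr0.
Qed.

Let e_act x f : quot_pi S (exterior_act x (wedge f))
  = \sum_(i < r) e (ffun_upd f i (lact x (f i))).
Proof. by rewrite exterior_actU (lin_sum piL). Qed.

Let e_act_upd x f i u : quot_pi S (exterior_act x (wedge (ffun_upd f i u)))
  = e (ffun_upd f i (lact x u))
    + \sum_(j < r | j != i) e (ffun_upd (ffun_upd f j (lact x (f j))) i u).
Proof.
rewrite e_act (bigD1 i) //= updK ffunE eqxx; congr (_ + _).
by apply: eq_bigr => j ji; rewrite ffunE (negPf ji) updC // eq_sym.
Qed.

Fact exterior_stable x : {homo exterior_act x : m / m \in S}.
Proof.
apply: (free_stable exterior_linearr (A := exterior_rel)) => // p.
case=> [[f [i [a [u [v ->]]]]]|[f [i [j [ij fij ->]]]]].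
  rewrite (lin_B (exterior_linearr x)) (lin_B piL) exterior_linearr piL.
  rewrite 3!e_act_upd lact_linearr eL scalerDr; apply/eqP; rewrite subr_eq0.
  rewrite addrACA scaler_sumr -big_split; apply/eqP; congr (_ + _).
  by apply: eq_bigr => k _ /=; exact: eL.
rewrite e_act (bigD1 i) // (bigD1 j) 1?eq_sym //=.
rewrite big1 ?addr0 -?fij ?e_skew // => k /andP[ki kj].
by apply: (e0 ij); rewrite !ffunE eq_sym (negPf ki) eq_sym (negPf kj).
Qed.

Fact exterior_linearl a x y m :
  exterior_act (a *: x + y) m - (a *: exterior_act x m + exterior_act y m)
    \in S.
Proof.
apply: (free_linearl exterior_linearr) => {}a {}x {}y f.
rewrite 3!e_act scaler_sumr -big_split; apply: eq_bigr => i _ /=.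
by rewrite lact_linearl eL.
Qed.

Fact exterior_lie x y m : exterior_act (lie x y) m
  - (exterior_act x (exterior_act y m) - exterior_act y (exterior_act x m))
    \in S.
Proof.
apply: (free_lie exterior_linearr) => {}x {}y f.
have e_act2 z w : quot_pi S (exterior_act z (exterior_act w (wedge f)))
    = \sum_(i < r) e (ffun_upd f i (lact z (lact w (f i))))
      + \sum_(i < r) \sum_(j < r | j != i)
          e (ffun_upd (ffun_upd f j (lact z (f j))) i (lact w (f i))).
  rewrite exterior_actU (lin_sum (exterior_linearr _)) (lin_sum piL).
  by rewrite -big_split; apply: eq_bigr => i _ /=; exact: e_act_upd.
rewrite 2!e_act2 e_act opprD addrACA.
under eq_bigr do rewrite lact_lie eB.
rewrite sumrB -[LHS]addr0; congr (_ + _); apply/esym/eqP; rewrite subr_eq0.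
apply/eqP; rewrite (exchange_big_dep predT) //=; apply: eq_bigr => i _.
by apply: eq_big => [j|j ji]; rewrite 1?eq_sym // updC // eq_sym.
Qed.

Definition exterior : lieModType g := lieQuot
  (LieQuotData exterior_linearr exterior_stable exterior_linearl exterior_lie).

End Exterior.
Notation "'Λ^' r M" := (exterior r M)
  (at level 30, r at level 2, M at level 30).

Section DirectSum.
Variables (K : fieldType) (g : lieAlgType K).

Section Binary.
Variables (M N : lieModType g).
Definition dsum2 : Type := M * N.
HB.instance Definition _ := GRing.Lmodule.on dsum2.
Definition dsum2_act (x : g) (p : dsum2) : dsum2 := (lact x p.1, lact x p.2).
Fact dsum2_linearl p : linear (dsum2_act ^~ p).
Proof. by move=> a x y; congr pair; rewrite /= lact_linearl. Qed.
Fact dsum2_linearr x : linear (dsum2_act x).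
Proof. by move=> a p q; congr pair; rewrite /= lact_linearr. Qed.
Fact dsum2_lie x y p : dsum2_act (lie x y) p
  = dsum2_act x (dsum2_act y p) - dsum2_act y (dsum2_act x p).
Proof. by congr pair; rewrite /= lact_lie. Qed.
HB.instance Definition _ := isLieModule.Build K g dsum2
  dsum2_linearl dsum2_linearr dsum2_lie.
End Binary.

Definition dsum0 : Type := 'rV[K]_0.
HB.instance Definition _ := GRing.Lmodule.on dsum0.
Definition dsum0_act (x : g) (p : dsum0) : dsum0 := 0.
Fact dsum0_linearl p : linear (dsum0_act ^~ p).
Proof. by move=> a x y; rewrite scaler0 addr0. Qed.
Fact dsum0_linearr x : linear (dsum0_act x).
Proof. by move=> a p q; rewrite scaler0 addr0. Qed.
Fact dsum0_lie x y p : dsum0_act (lie x y) p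
  = dsum0_act x (dsum0_act y p) - dsum0_act y (dsum0_act x p).
Proof. by rewrite subr0. Qed.
HB.instance Definition _ := isLieModule.Build K g dsum0
  dsum0_linearl dsum0_linearr dsum0_lie.

Definition lie_dsum (M N : lieModType g) : lieModType g := dsum2 M N.
Definition lie_dsum0 : lieModType g := dsum0.

End DirectSum.
Arguments lie_dsum0 {K g}.
Notation "M ⊕ N" := (lie_dsum M N).
Notation "\bigoplus_ ( m <= k < n ) F" :=
  (\big[@lie_dsum _ _ / lie_dsum0]_(m <= k < n) F).


Section Adjoint.
Variables (K : fieldType) (g : lieAlgType K).

Definition adjoint : Type := g.
HB.instance Definition _ := GRing.Lmodule.on adjoint.
Definition ad (x : g) (y : adjoint) : adjoint := lie x (y : g).

Lemma lieC (x y : g) : lie x y = - lie y x.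
Proof.
apply/eqP; rewrite -addr_eq0; have := liexx (x + y).
have lieDl (u v w : g) : lie (u + v) w = lie u w + lie v w.
  by have := lie_linearl w 1 u v; rewrite !scale1r.
have lieDr (u v w : g) : lie w (u + v) = lie w u + lie w v.
  by have := lie_linearr w 1 u v; rewrite !scale1r.
by rewrite lieDl !lieDr !liexx add0r addr0 => ->.
Qed.

Fact ad_lie x y z : ad (lie x y) z = ad x (ad y z) - ad y (ad x z).
Proof.
rewrite /ad [LHS]lieC; apply/esym/eqP; rewrite -subr_eq0 opprK.
rewrite [lie x (z : g)]lieC -[- lie z x]scaleN1r.
have -> : lie y (-1 *: lie z x) = - lie y (lie z x).
  have := lie_linearr y (-1) (lie z x) 0; rewrite addr0 => ->.
  have := lie_linearr y (-1) (0 : g) 0.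
  by rewrite scaler0 addr0 scaleN1r addNr => ->; rewrite addr0 scaleN1r.
by rewrite opprK lie_jacobi.
Qed.
HB.instance Definition _ := isLieModule.Build K g adjoint
  (fun y => lie_linearl (y : g)) (fun x => lie_linearr x) ad_lie.

End Adjoint.

Section Weights.
Variables (K : fieldType) (g : lieAlgType K).

Definition lie_subalgebra (h : {vspace g}) :=
  forall x y, x \in h -> y \in h -> lie x y \in h.

(* some term of the lower central series, spanned by the brackets
   [x1, [x2, ..., [xn, y]]], vanishes *)
Definition lie_nilpotent (h : {vspace g}) := exists n, forall (s : seq g) y,
  size s = n -> {subset s <= h} -> y \in h -> foldr lie y s = 0.

Definition cartan_subalgebra (h : {vspace g}) :=
  [/\ lie_subalgebra h, lie_nilpotent h
    & forall x, (forall y, y \in h -> lie x y \in h) -> x \in h].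

(* the trace of ad x \o ad y *)
Definition killing (x y : g) : K := let e := vbasis {: g} in
  \sum_(i < \dim {: g}) coord e i (lie x (lie y e`_i)).

Variable h : {vspace g}.

Definition hdual := 'Hom(subvs_of h, K^o).

Definition weight_vector (M : lieModType g) (lambda : hdual) (v : M) :=
  forall t : subvs_of h, lact (vsval t) v = (lambda t : K) *: v.

Definition is_weight (M : lieModType g) (lambda : hdual) :=
  exists2 v : M, v != 0 & weight_vector lambda v.

Definition is_root (alpha : hdual) :=
  alpha != 0 /\ is_weight (adjoint g) alpha.

Definition positive_system (P : hdual -> Prop) :=
  [/\ forall alpha, P alpha -> is_root alpha,
      forall alpha, is_root alpha -> (P alpha <-> ~ P (- alpha))
    & forall alpha beta, P alpha -> P beta -> is_root (alpha + beta) ->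
        P (alpha + beta)].

Definition simple_root (P : hdual -> Prop) (alpha : hdual) :=
  P alpha /\ ~ exists beta gamma, [/\ P beta, P gamma & alpha = beta + gamma].

(* the element of [g_alpha, g_(- alpha)] on which alpha takes the value 2 *)
Definition coroot (alpha : hdual) (t : subvs_of h) := alpha t = 2%:R /\
  exists x y : adjoint g, [/\ weight_vector alpha x,
    weight_vector (- alpha) y & vsval t = lie (x : g) (y : g)].

(* w is the basis dual to the simple coroots for some enumeration alpha of the
   simple roots; the choice of w fixes that enumeration *)
Definition fundamental_weights (P : hdual -> Prop) n (w : 'I_n -> hdual) :=
  exists (alpha : 'I_n -> hdual) (c : 'I_n -> subvs_of h),
    [/\ injective alpha,
        forall beta, simple_root P beta <-> exists i, beta = alpha i,
        forall i, coroot (alpha i) (c i)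
      & forall i j, w i (c j) = (i == j)%:R].

(* orthogonality for the form that the Killing form induces on the dual of h:
   t and u are the elements of h representing lambda and mu *)
Definition killing_orthogonal (lambda mu : hdual) :=
  exists t u : subvs_of h,
    [/\ forall s : subvs_of h, killing (vsval t) (vsval s) = lambda s,
        forall s : subvs_of h, killing (vsval u) (vsval s) = mu s
      & killing (vsval t) (vsval u) = 0].

End Weights.

Section QuotientBySubmodule.
Variables (K : fieldType) (g : lieAlgType K) (M : lieModType g).

Definition lie_submodule (S : M -> Prop) := op_submod (@lact K g M) S.

Variable A : M -> Prop.
Let S : submodClosed M := gen_submod (@lact K g M) A.

Fact quot_gen_linearl a (x y : g) (m : M) :
  lact (a *: x + y) m - (a *: lact x m + lact y m) \in S.
Proof. by rewrite lact_linearl subrr rpred0. Qed.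
Fact quot_gen_lie (x y : g) (m : M) :
  lact (lie x y) m - (lact x (lact y m) - lact y (lact x m)) \in S.
Proof. by rewrite lact_lie subrr rpred0. Qed.

(* the quotient of M by the g-submodule generated by A *)
Definition quot_gen : lieModType g := lieQuot (LieQuotData
  (@lact_linearr K g M) (@gen_submod_op _ _ _ (@lact K g M) A)
  quot_gen_linearl quot_gen_lie).

End QuotientBySubmodule.

Section Enveloping.
Variables (K : fieldType) (g : lieAlgType K).
Local Notation F := (free_mod K (seq g)).

Definition word (s : seq g) : F := free_gen K s.

(* The free associative algebra on the set g has the words as a basis; these
   are the multiples, by words on both sides, of the relations expressing that
   a letter depends linearly on its value and that xy - yx = [x, y]. *)
Definition env_rel (p : F) :=
  (exists u v a x y, p = word (u ++ (a *: x + y) :: v)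
    - (a *: word (u ++ x :: v) + word (u ++ y :: v))) \/
  (exists u v x y, p = word (u ++ lie x y :: v)
    - (word (u ++ x :: y :: v) - word (u ++ y :: x :: v))).

Definition env_act (x : g) : F -> F := mlift (fun s => word (x :: s)).

Local Notation S := (span_submod env_rel).
Let piL := quot_pi_linear S.

Lemma env_actU x s : env_act x (word s) = word (x :: s).
Proof. exact: mliftU. Qed.

Fact env_linearr x : linear (env_act x).
Proof. exact: mlift_linear. Qed.

Fact env_stable x : {homo env_act x : m / m \in S}.
Proof.
apply: (free_stable env_linearr (A := env_rel)) => // p.
case=> [[u [v [a [y [z ->]]]]]|[u [v [y [z ->]]]]]; apply/quot_pi_eq0.
  rewrite (lin_B (env_linearr x)) env_linearr 3!env_actU.
  by apply: mem_gen_submod; left; exists (x :: u), v, a, y, z.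
rewrite 2!(lin_B (env_linearr x)) 3!env_actU.
by apply: mem_gen_submod; right; exists (x :: u), v, y, z.
Qed.

Fact env_linearl a x y m :
  env_act (a *: x + y) m - (a *: env_act x m + env_act y m) \in S.
Proof.
apply: (free_linearl env_linearr) => {}a {}x {}y s.
rewrite 3!env_actU -piL; apply/quot_piP/mem_gen_submod.
by left; exists [::], s, a, x, y.
Qed.

Fact env_lie x y m : env_act (lie x y) m
  - (env_act x (env_act y m) - env_act y (env_act x m)) \in S.
Proof.
apply: (free_lie env_linearr) => {}x {}y s.
rewrite 5!env_actU -(lin_B piL); apply/quot_piP/mem_gen_submod.
by right; exists [::], s, x, y.
Qed.

(* the universal enveloping algebra, as a left module over itself *)
Definition enveloping : lieModType g :=
  lieQuot (LieQuotData env_linearr env_stable env_linearl env_lie).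
Definition env_one : enveloping := quot_pi S (word [::]).

End Enveloping.

Section HighestWeight.
Variables (K : fieldType) (g : lieAlgType K) (h : {vspace g}).
Variables (P : hdual h -> Prop) (lambda : hdual h).

Definition verma_rel (u : enveloping g) :=
  (exists (alpha : hdual h) (x : adjoint g), [/\ P alpha,
    weight_vector alpha x & u = lact (x : g) (env_one g)]) \/
  (exists t : subvs_of h,
    u = lact (vsval t) (env_one g) - (lambda t : K) *: env_one g).

Definition verma : lieModType g := quot_gen verma_rel.

Definition in_proper_submodule (m : verma) := exists S : verma -> Prop,
  [/\ lie_submodule S, ~ (forall n, S n) & S m].

(* the quotient of the Verma module by the sum of its proper submodules *)
Definition L : lieModType g := quot_gen in_proper_submodule.

End HighestWeight.

Section Symplectic.
Variables (K : fieldType) (V : vectType K) (w : {skew_symmetric V}).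

Let wL v : linear (fun u => w u v : K^o).
Proof. by move=> a u u'; rewrite linearPl. Qed.

Let wR u : linear (fun v => w u v : K^o).
Proof. by move=> a v v'; rewrite linearPr. Qed.

(* sp_space is cut out on a basis; see mem_sp_space *)
Definition sp_form u v (f : 'End(V)) : K^o := w (f u) v + w u (f v).

Definition sp_space : {vspace 'End(V)} := let e := vbasis {: V} in
  (\bigcap_(i < \dim {: V}) \bigcap_(j < \dim {: V})
     lker (linfun (sp_form e`_i e`_j)))%VS.

Fact sp_form_linear u v : linear (sp_form u v).
Proof.
move=> a f1 f2; rewrite /sp_form !lfunE /= !lfunE /=.
rewrite linearPl linearPr /= scalerDr addrACA.
done.
Qed.

HB.instance Definition _ u v := GRing.isLinear.Build K 'End(V) K^o *:%R
  (sp_form u v) (sp_form_linear u v).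

Lemma mem_sp_space f :
  f \in sp_space <-> forall u v, w (f u) v + w u (f v) = 0.
Proof.
split=> [fS|f0]; last first.
  by rewrite memvE; apply/subv_bigcapP => i _; apply/subv_bigcapP => j _;
    rewrite -memvE memv_ker lfunE /= /sp_form f0.
have fe (i j : 'I_(\dim {: V})) :
    w (f (vbasis {: V})`_i) (vbasis {: V})`_j
      + w (vbasis {: V})`_i (f (vbasis {: V})`_j) = 0.
  move: fS; rewrite memvE => /subv_bigcapP/(_ i isT)/subv_bigcapP/(_ j isT).
  by rewrite -memvE memv_ker lfunE => /eqP.
move=> u v; rewrite (coord_vbasis (memvf u)) (coord_vbasis (memvf v)).
have BL v' : linear (fun u' => w (f u') v' + w u' (f v') : K^o).
  by move=> a u1 u2; rewrite [f _]linearP !(wL _ a) scalerDr addrACA.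
have BR u' : linear (fun v' => w (f u') v' + w u' (f v') : K^o).
  by move=> a u1 u2; rewrite [f (_ + _)]linearP !(wR _ a) scalerDr addrACA.
rewrite (lin_sum (BL _)) big1 // => i _; rewrite (lin_Z (BL _)).
rewrite (lin_sum (BR _)) big1 ?scaler0 // => j _.
by rewrite (lin_Z (BR _)) fe scaler0.
Qed.

Definition sp : Type := subvs_of sp_space.
HB.instance Definition _ := Vector.on sp.

Definition sp_val (x : sp) : 'End(V) := vsval x.
Definition sp_lie (x y : sp) : sp :=
  vsproj sp_space ((sp_val x \o sp_val y) - (sp_val y \o sp_val x))%VF.

Lemma sp_valP (x : sp) u v : w (sp_val x u) v = - w u (sp_val x v).
Proof.
apply/eqP; rewrite -addr_eq0; apply/eqP; move: u v.
exact/mem_sp_space/subvsP.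
Qed.

Lemma sp_lieE x y :
  sp_val (sp_lie x y) = ((sp_val x \o sp_val y) - (sp_val y \o sp_val x))%VF.
Proof.
apply: vsprojK; apply/mem_sp_space => u v.
rewrite !lfun_simp.
have wBl a b c : w (a - b) c = w a c - w b c := lin_B (wL c) a b.
have wBr a b c : w c (a - b) = w c a - w c b := lin_B (wR c) a b.
by rewrite wBl wBr !sp_valP !opprK subrKA subrr.
Qed.

Fact sp_lie_linearl y : linear (sp_lie ^~ y).
Proof.
move=> a x x'; apply: subvs_inj; rewrite linearP /= -!/(sp_val _) !sp_lieE.
have -> : sp_val (a *: x + x') = a *: sp_val x + sp_val x' by exact: linearP.
rewrite comp_lfunDl comp_lfunDr -comp_lfunZl -comp_lfunZr scalerBr opprD.
by rewrite addrACA.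
Qed.
Fact sp_lie_linearr x : linear (sp_lie x).
Proof.
move=> a y y'; apply: subvs_inj; rewrite linearP /= -!/(sp_val _) !sp_lieE.
have -> : sp_val (a *: y + y') = a *: sp_val y + sp_val y' by exact: linearP.
rewrite comp_lfunDl comp_lfunDr -comp_lfunZl -comp_lfunZr scalerBr opprD.
by rewrite addrACA.
Qed.
Fact sp_liexx x : sp_lie x x = 0.
Proof. by apply: subvs_inj; rewrite -/(sp_val _) sp_lieE subrr linear0. Qed.
Fact sp_jacobi x y z :
  sp_lie x (sp_lie y z) + sp_lie y (sp_lie z x) + sp_lie z (sp_lie x y) = 0.
Proof.
apply: subvs_inj; rewrite !linearD linear0 /= -!/(sp_val _) !sp_lieE.
rewrite !(comp_lfunDl, comp_lfunDr, comp_lfunNl, comp_lfunNr) !comp_lfunA.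
apply/lfunP => v; rewrite !(opprD, opprK, lfun_simp).
have add12 (a b c d e f : V) : a - b + (- c + d) + (c - e + (- f + b))
    + (f - d + (- a + e)) = 0.
  rewrite !addrA [LHS](ACl ((1*11)*(2*8)*(3*5)*(4*10)*(6*12)*(7*9)))/=.
  by rewrite !(subrr, addNr, addr0).
rewrite [RHS](_ : _ = 0) //; exact: add12.
Qed.
HB.instance Definition _ := isLieAlgebra.Build K sp
  sp_lie_linearl sp_lie_linearr sp_liexx sp_jacobi.

(* the phantom argument lets w be inferred from the carrier *)
Definition natural (w' : {skew_symmetric V}) : Type := V.
HB.instance Definition _ w' := Vector.on (natural w').
Definition natural_act (x : sp) (v : natural w) : natural w := sp_val x v.
Fact natural_linearl v : linear (natural_act ^~ v).
Proof.
by move=> a x y; rewrite /natural_act /sp_val linearP /= !lfun_simp.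
Qed.
Fact natural_linearr x : linear (natural_act x).
Proof. exact: linearP. Qed.
Fact natural_lie x y v : natural_act (lie x y) v
  = natural_act x (natural_act y v) - natural_act y (natural_act x v).
Proof.
by rewrite /natural_act sp_lieE !lfun_simp.
Qed.
HB.instance Definition _ := isLieModule.Build K sp (natural w)
  natural_linearl natural_linearr natural_lie.

Definition dual_natural (w' : {skew_symmetric V}) : Type := 'Hom(V, K^o).
HB.instance Definition _ w' := Vector.on (dual_natural w').
Definition dual_act (x : sp) (f : dual_natural w) : dual_natural w :=
  - (f \o sp_val x)%VF.
Fact dual_linearl f : linear (dual_act ^~ f).
Proof.
move=> a x y; rewrite /dual_act /sp_val linearP /= comp_lfunDr -comp_lfunZr.
by rewrite opprD scalerN.
Qed.
Fact dual_linearr x : linear (dual_act x).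
Proof.
move=> a f1 f2; rewrite /dual_act comp_lfunDl -comp_lfunZl.
by rewrite opprD scalerN.
Qed.
Fact dual_lie x y f : dual_act (lie x y) f
  = dual_act x (dual_act y f) - dual_act y (dual_act x f).
Proof.
rewrite /dual_act sp_lieE comp_lfunDr comp_lfunNr !comp_lfunNl !opprK.
by rewrite !comp_lfunA opprB.
Qed.
HB.instance Definition _ := isLieModule.Build K sp (dual_natural w)
  dual_linearl dual_linearr dual_lie.

End Symplectic.

(* Main.v *)
Require Import Defs.
From HB Require Import structures.
From mathcomp Require Import all_boot all_order all_algebra.
From mathcomp Require Import fingroup perm sesquilinear boolp reals complex.
From mathcomp Require Import finmap monalg ring zify.

Set Implicit Arguments.
Unset Strict Implicit.
Unset Printing Implicit Defensive.

Import GRing.Theory.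
Local Open Scope ring_scope.

(* Let M be the tensor product of the exterior algebra of V with the polynomial
   ring in x_1, ..., x_l; the even and the odd polynomials are the two spinor
   modules. sp acts on M by expressions quadratic in the fermionic operators
   ext u, ctr u and in the Weyl operators weyl u. With b a symplectic basis and
   b^t the dual one, X = sum_t ext (b_t) weyl (b^t) and
   Y = sum_t ctr (b_t) weyl (b^t) commute with sp, and X Y + Y X = l - d in
   exterior degree d. For r <= l the part of exterior degree r and even
   polynomial degree is the direct sum of X^(r - j) N_j over j <= r, where N_j is
   generated by the singular vector e_1 ... e_j, multiplied by x_l when r - j is
   odd: an explicit lowering identity shows that these submodules span, and the
   eigenvalues of Y X separate them. N_j is irreducible because M carries a
   nondegenerate contravariant form. Multiplication identifies the tensor product
   of the r-th exterior power of V* and the spinor module with the even part of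
   exterior degree r when the forms act by ext on the empty state, and with that
   of exterior degree 2l - r when they act by ctr on the full state. *)

(** * The Fock space *)

(** X and Y are the odd generators of a copy of osp(1|2) commuting with sp. X shifts both the
    exterior degree and the polynomial parity by one, so X^(r - j) N_j is even exactly when N_j has
    the parity of r - j; hence the factor x_l, the singular vector of the odd spinor module. On X^k
    N_j the operator Y X is the scalar l - j - k/2 for k even and -(k + 1)/2 for k odd. It is
    nonzero for j + k < l, so X stays injective up to degree l, and for fixed r = j + k it
    determines j. Generation is used twice. A submodule of N_j orthogonal to the singular vector is
    orthogonal to N_j, and also to the image of X, since Y is adjoint to X and kills N_j; as these
    two span the graded part, the submodule vanishes, although nothing is known beforehand about the
    form on N_j. The simple roots are not given either: they are recovered from the values of the
    epsilon_i on the coroots. *)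

(* The free vector space on X, sealed behind its universal property: failing
   unification problems would otherwise unfold its lmodType structure. *)
Record free_space_spec (K : fieldType) (X : choiceType) := FreeSpace {
  fs_mod :> lmodType K;
  fs_gen : X -> fs_mod;
  fs_lift : forall W : lmodType K, (X -> W) -> fs_mod -> W;
  fs_lift_linear : forall (W : lmodType K) (f : X -> W), linear (fs_lift f);
  fs_liftE : forall (W : lmodType K) (f : X -> W) x, fs_lift f (fs_gen x) = f x;
  fs_ext : forall (W : lmodType K) (f1 f2 : fs_mod -> W), linear f1 ->
    linear f2 -> (forall x, f1 (fs_gen x) = f2 (fs_gen x)) -> f1 =1 f2;
  fs_ind : forall P : fs_mod -> Prop, P 0 ->
    (forall k u v, P u -> P v -> P (k *: u + v)) -> (forall x, P (fs_gen x)) ->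
    forall m, P m;
  fs_eq0 : forall m,
    (forall x, fs_lift (fun y => (y == x)%:R : K^o) m = 0) -> m = 0 }.

Lemma free_mod_ind (K : fieldType) (X : choiceType)
  (P : free_mod K X -> Prop) : P 0 ->
  (forall k u v, P u -> P v -> P (k *: u + v)) ->
  (forall x, P (free_gen K x)) -> forall m, P m.
Proof.
move=> P0 PD PK m.
have -> : m = mlift (free_gen K (X := X)) m.
  move: m; apply: (malg_eq (f1 := id)) => // [k u v|x]; first exact: mlift_linear.
  by rewrite mliftU.
rewrite mlift.unlock; apply: (big_ind P) => // [u v Pu Pv|x _].
  by rewrite -[u]scale1r; apply: PD.
by rewrite -[_ *: _]addr0; apply: PD.
Qed.

Lemma free_mod_eq0 (K : fieldType) (X : choiceType) (m : free_mod K X) :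
  (forall x, mlift (fun y => (y == x)%:R : K^o) m = 0) -> m = 0.
Proof.
move=> m0; apply/malgP => x; have := m0 x.
rewrite mlift.unlock mcoeff0 => <-; have [xm|xm] := boolP (x \in msupp m).
  rewrite (big_fsetD1 x) //= eqxx [_ *: 1]mulr1 big_seq big1 ?addr0 // => y.
  by rewrite in_fsetD1 => /andP[/negPf-> _]; rewrite scaler0.
rewrite mcoeff_outdom // big_seq big1 // => y ym.
by case: eqP => [yx|_]; rewrite ?scaler0 //; case/negP: xm; rewrite -yx.
Qed.

HB.lock Definition free_space (K : fieldType) (X : choiceType) :
  free_space_spec K X :=
  FreeSpace (fun W f => @mlift_linear K X W f) (fun W f => @mliftU K X W f)
    (fun W f1 f2 => @malg_eq K X W f1 f2) (@free_mod_ind K X)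
    (@free_mod_eq0 K X).

Section Fock.
Variables (K : fieldType) (l : nat).

Definition mode : finType := (bool * 'I_l)%type.
Definition occ : choiceType := {ffun 'I_l -> nat}.
Definition state : choiceType := ({set mode} * occ)%type.
Definition fock : lmodType K := free_space K state.
Definition ket (A : {set mode}) (a : occ) : fock :=
  fs_gen (free_space K state) (A, a).
Definition ket_lift (W : lmodType K) (f : state -> W) : fock -> W :=
  @fs_lift K state (free_space K state) W f.

Implicit Types (t : mode) (A : {set mode}) (a : occ) (m : fock).

Lemma ket_lift_linear (W : lmodType K) (f : state -> W) : linear (ket_lift f).
Proof. exact: fs_lift_linear. Qed.
HB.instance Definition _ (W : lmodType K) (f : state -> W) :=
  GRing.isLinear.Build K fock W *:%R (ket_lift f) (ket_lift_linear f).
Lemma ket_liftE (W : lmodType K) (f : state -> W) A a :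
  ket_lift f (ket A a) = f (A, a).
Proof. exact: fs_liftE. Qed.

Lemma ket_ext (W : lmodType K) (f1 f2 : fock -> W) : linear f1 -> linear f2 ->
  (forall A a, f1 (ket A a) = f2 (ket A a)) -> f1 =1 f2.
Proof. by move=> f1L f2L H; apply: fs_ext => // -[A a]; exact: H. Qed.

Lemma ket_ind (P : fock -> Prop) : P 0 ->
  (forall k u v, P u -> P v -> P (k *: u + v)) -> (forall A a, P (ket A a)) ->
  forall m, P m.
Proof. by move=> P0 PD PK; apply: fs_ind => // -[A a]; exact: PK. Qed.

Definition kcoef (s : state) : fock -> K^o := ket_lift (fun s' : state => (s' == s)%:R : K^o).
HB.instance Definition _ s := GRing.isLinear.Build K fock K^o *:%R (kcoef s)
  (ket_lift_linear _).

Lemma kcoefE s A a : kcoef s (ket A a) = ((A, a) == s)%:R.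
Proof. exact: ket_liftE. Qed.

Lemma kcoef_eq0 m : (forall s, kcoef s m = 0) -> m = 0.
Proof. exact: fs_eq0. Qed.

(** The parity of this count is the Jordan-Wigner sign: it makes creation operators of distinct
    modes anticommute although kets are indexed by unordered sets. *)
Definition below t A : nat := #|[set u in A | (enum_rank u < enum_rank t)%N]|.
Definition fsign t A : K := (-1) ^+ below t A.

Lemma below_add t u A : u \notin A ->
  below t (u |: A) = ((enum_rank u < enum_rank t)%N + below t A)%N.
Proof.
move=> uA; rewrite /below; case: (boolP (enum_rank u < enum_rank t)%N) => ut.
  rewrite (_ : [set v in u |: A | (enum_rank v < enum_rank t)%N]
      = u |: [set v in A | (enum_rank v < enum_rank t)%N]).
    by rewrite cardsU1 !inE (negPf uA).
  by apply/setP => v; rewrite !inE; case: eqVneq => // ->; rewrite ut.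
apply: eq_card => v; rewrite !inE; case: eqVneq => // ->.
by rewrite (negPf ut) !andbF.
Qed.

Lemma below_rem t u A : u \in A ->
  below t A = ((enum_rank u < enum_rank t)%N + below t (A :\ u))%N.
Proof. by move=> uA; rewrite -{1}(setD1K uA) below_add // !inE eqxx. Qed.

Lemma below_self t A : below t (A :\ t) = below t A.
Proof.
apply: eq_card => v; rewrite !inE; case: eqVneq => //= ->.
by rewrite ltnn andbF.
Qed.

Lemma fsign_add t u A : u \notin A ->
  fsign t (u |: A) = (-1) ^+ (enum_rank u < enum_rank t)%N * fsign t A.
Proof. by move=> uA; rewrite /fsign below_add // exprD. Qed.

Lemma fsign_rem t u A : u \in A ->
  fsign t (A :\ u) = (-1) ^+ (enum_rank u < enum_rank t)%N * fsign t A.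
Proof.
by move=> uA; rewrite /fsign (below_rem t uA) exprD mulrA -exprD addnn -muln2
  exprM sqrr_sign mul1r.
Qed.

Lemma fsign_sqr t A : fsign t A * fsign t A = 1.
Proof. by rewrite -expr2 /fsign sqrr_sign. Qed.

Lemma fsign_neq0 t A : fsign t A != 0.
Proof. by rewrite signr_eq0. Qed.

(** Of two distinct modes exactly one precedes the other. This sign is what makes operators at
    distinct modes anticommute. *)
Lemma enum_rank_lt_neg t u : t != u ->
  (-1) ^+ (enum_rank u < enum_rank t)%N =
  - (-1) ^+ (enum_rank t < enum_rank u)%N :> K.
Proof.
move=> tu; have : enum_rank t != enum_rank u :> nat.
  by apply: contraNneq tu => /val_inj/enum_rank_inj ->.
by case: ltngtP => //= _ _; rewrite ?expr0 ?expr1 ?opprK.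
Qed.

Definition cre t : fock -> fock := ket_lift (fun s : state =>
  if t \in s.1 then 0 else fsign t s.1 *: ket (t |: s.1) s.2).
Definition ann t : fock -> fock := ket_lift (fun s : state =>
  if t \in s.1 then fsign t s.1 *: ket (s.1 :\ t) s.2 else 0).
Definition incr (i : 'I_l) a : occ := [ffun j => (a j + (j == i))%N].
Definition decr (i : 'I_l) a : occ := [ffun j => (a j - (j == i))%N].
Definition mulx i : fock -> fock := ket_lift (fun s : state => ket s.1 (incr i s.2)).
(** When [a i] is zero the truncated [decr i] leaves the occupation unchanged, but then the
    coefficient vanishes. *)
Definition der i : fock -> fock := ket_lift (fun s : state =>
  (s.2 i)%:R *: ket s.1 (decr i s.2)).

HB.instance Definition _ t :=
  GRing.isLinear.Build K fock fock *:%R (cre t) (ket_lift_linear _).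
HB.instance Definition _ t :=
  GRing.isLinear.Build K fock fock *:%R (ann t) (ket_lift_linear _).
HB.instance Definition _ i :=
  GRing.isLinear.Build K fock fock *:%R (mulx i) (ket_lift_linear _).
HB.instance Definition _ i :=
  GRing.isLinear.Build K fock fock *:%R (der i) (ket_lift_linear _).

Lemma creU t A a :
  cre t (ket A a) = if t \in A then 0 else fsign t A *: ket (t |: A) a.
Proof. exact: ket_liftE. Qed.
Lemma annU t A a :
  ann t (ket A a) = if t \in A then fsign t A *: ket (A :\ t) a else 0.
Proof. exact: ket_liftE. Qed.
Lemma mulxU i A a : mulx i (ket A a) = ket A (incr i a).
Proof. exact: ket_liftE. Qed.
Lemma derU i A a : der i (ket A a) = (a i)%:R *: ket A (decr i a).
Proof. exact: ket_liftE. Qed.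

Lemma cre_sqr t m : cre t (cre t m) = 0.
Proof.
elim/ket_ind: m => [|k u v uP vP|A a]; rewrite ?linear0 // ?linearP ?uP ?vP //=.
  by rewrite uP vP scaler0 addr0.
rewrite creU; case: ifPn => tA; rewrite ?linear0 // linearZ /= creU.
by rewrite setU11 scaler0.
Qed.

Lemma cre_anti t u m : cre t (cre u m) + cre u (cre t m) = 0.
Proof.
have [<-|tu] := eqVneq t u; first by rewrite cre_sqr addr0.
move: m; apply: (@ket_ext _ _ (fun=> 0)) => [k m n|k m n|A a].
- by rewrite !linearP /= scalerDr addrACA.
- by rewrite scaler0 addr0.
rewrite !creU; case uA: (u \in A); case tA: (t \in A);
  rewrite ?linear0 ?addr0 ?add0r ?linearZ //= !creU ?inE ?uA ?tA ?orbT ?scaler0 //.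
rewrite [u == t]eq_sym (negPf tu) /=.
rewrite !scalerA setUCA -scalerDl !fsign_add ?uA ?tA // (enum_rank_lt_neg tu).
rewrite (_ : _ + _ = 0) ?scale0r //.
by move: ((-1) ^+ _) (fsign t A) (fsign u A) => x y z; ring.
Qed.

Lemma ann_sqr t m : ann t (ann t m) = 0.
Proof.
elim/ket_ind: m => [|k u v uP vP|A a]; rewrite ?linear0 // ?linearP ?uP ?vP //=.
  by rewrite uP vP scaler0 addr0.
rewrite annU; case: ifPn => tA; rewrite ?linear0 // linearZ /= annU.
by rewrite setD11 scaler0.
Qed.

Lemma ann_anti t u m : ann t (ann u m) + ann u (ann t m) = 0.
Proof.
have [<-|tu] := eqVneq t u; first by rewrite ann_sqr addr0.
move: m; apply: (@ket_ext _ _ (fun=> 0)) => [k m n|k m n|A a].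
- by rewrite !linearP /= scalerDr addrACA.
- by rewrite scaler0 addr0.
rewrite !annU; case uA: (u \in A); case tA: (t \in A);
  rewrite ?linear0 ?addr0 ?add0r ?linearZ //= !annU ?inE ?uA ?tA ?andbF ?scaler0 //.
rewrite [u == t]eq_sym (negPf tu) /=.
rewrite !scalerA setDDl [[set u; t]]setUC -setDDl -scalerDl !fsign_rem //.
rewrite (enum_rank_lt_neg tu).
rewrite (_ : _ + _ = 0) ?scale0r //.
by move: ((-1) ^+ _) (fsign t A) (fsign u A) => x y z; ring.
Qed.

Lemma ann_cre t u m : ann t (cre u m) + cre u (ann t m) = (t == u)%:R *: m.
Proof.
move: m; apply: ket_ext => [k m n|k m n|A a].
- by rewrite !linearP /= scalerDr addrACA.
- by rewrite scalerDr !scalerA mulrC.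
rewrite creU annU; have [<-|tu] := eqVneq t u.
  rewrite scale1r; case: ifPn => tA;
    rewrite ?linear0 ?linearZ /= ?addr0 ?add0r ?creU ?annU !inE ?eqxx /=.
    by rewrite scalerA setD1K // {2}/fsign below_self fsign_sqr scale1r.
  by rewrite scalerA setU1K // {2}/fsign -below_self setU1K // fsign_sqr scale1r.
rewrite scale0r; case uA: (u \in A); case tA: (t \in A);
  rewrite ?linear0 ?linearZ /= ?addr0 ?add0r ?creU ?annU ?inE ?uA ?tA //=
    ?[u == t]eq_sym ?(negPf tu) ?andbF ?scaler0 ?addr0 //=.
rewrite !scalerA (_ : u |: A :\ t = (u |: A) :\ t); last first.
  by apply/setP => v; rewrite !inE; case: (eqVneq v u) => // ->; rewrite eq_sym tu.
rewrite -scalerDl fsign_add ?uA // fsign_rem // (enum_rank_lt_neg tu).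
rewrite (_ : _ + _ = 0) ?scale0r //.
by move: ((-1) ^+ _) (fsign t A) (fsign u A) => x y z; ring.
Qed.

Lemma der_mulx i j m : der i (mulx j m) - mulx j (der i m) = (i == j)%:R *: m.
Proof.
move: m; apply: ket_ext => [k m n|k m n|A a].
- by rewrite !linearP /= scalerDr addrACA.
- by rewrite scalerDr !scalerA mulrC.
rewrite mulxU !derU linearZ /= mulxU ffunE.
have -> : decr i (incr j a) = [ffun k => (a k + (k == j) - (k == i))%N].
  by apply/ffunP => k; rewrite !ffunE.
have -> : incr j (decr i a) = [ffun k => (a k - (k == i) + (k == j))%N].
  by apply/ffunP => k; rewrite !ffunE.
have [<-|ij] := eqVneq i j.
  have -> : [ffun k => (a k + (k == i) - (k == i))%N] = a.
    by apply/ffunP => k; rewrite ffunE addnK.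
  rewrite addn1; case: (posnP (a i)) => ai; first by rewrite ai scale0r subr0.
  have -> : [ffun k => (a k - (k == i) + (k == i))%N] = a.
    by apply/ffunP => k; rewrite ffunE subnK //; case: eqP => // ->.
  by rewrite -scalerBl -natrB // subSnn.
rewrite addn0 scale0r; apply/eqP; rewrite subr_eq0; apply/eqP; congr (_ *: ket _ _).
apply/ffunP => k; rewrite !ffunE; case: (eqVneq k j) => kj; case: (eqVneq k i) => ki;
  rewrite ?addn0 ?subn0 //.
by move: ij; rewrite -ki -kj eqxx.
Qed.

Lemma mulxC i j m : mulx i (mulx j m) = mulx j (mulx i m).
Proof.
move: m; apply: ket_ext => [k m n|k m n|A a]; try by rewrite !linearP.
by rewrite !mulxU; congr ket; apply/ffunP => k; rewrite !ffunE addnAC.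
Qed.

Lemma derC i j m : der i (der j m) = der j (der i m).
Proof.
have [->//|ij] := eqVneq i j.
move: m; apply: ket_ext => [k m n|k m n|A a]; try by rewrite !linearP.
rewrite !derU !linearZ /= !derU !scalerA !ffunE [j == i]eq_sym (negPf ij) !subn0 mulrC.
by congr (_ *: ket _ _); apply/ffunP => k; rewrite !ffunE subnAC.
Qed.

(** The modes (true, i), which will carry the weights epsilon_i, differentiate; thus the constant
    polynomial is annihilated by all of them and becomes the highest weight vector of the spinor
    module. *)
Definition bos t := if t.1 then der t.2 else mulx t.2.

HB.instance Definition _ t := GRing.isLinear.Build K fock fock *:%R (bos t)
  (match t.1 as c return linear (if c then der t.2 else mulx t.2) with
   | true => ket_lift_linear _ | false => ket_lift_linear _ end).

(* the value of the symplectic form on two vectors of a symplectic basis indexed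
   by modes, (true, i) and (false, i) being the indices of a conjugate pair *)
Definition sympl (s t : mode) : K :=
  if s.2 == t.2 then (s.1 : nat)%:R - (t.1 : nat)%:R else 0.

Lemma bos_comm s t m : bos s (bos t m) - bos t (bos s m) = sympl s t *: m.
Proof.
case: s t => [[] i] [[] j]; rewrite /bos /sympl /=.
- by rewrite derC !subrr; case: eqP; rewrite scale0r.
- by rewrite der_mulx subr0; case: eqP.
- rewrite -opprB der_mulx eq_sym sub0r; case: eqP => _; last by rewrite scale0r oppr0.
  by rewrite scale1r scaleN1r.
- by rewrite mulxC !subrr; case: eqP; rewrite scale0r.
Qed.

Lemma cre_bos s t m : cre s (bos t m) = bos t (cre s m).
Proof.
move: m; apply: ket_ext => [k m n|k m n|A a]; try by rewrite !linearP.
rewrite /bos creU; case: t.1.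
  by rewrite derU !linearZ /= !creU; case: ifP => _; rewrite ?linear0 ?scaler0 //
    scalerA linearZ /= derU scalerA mulrC.
by rewrite mulxU creU; case: ifP => _; rewrite ?linear0 // linearZ /= mulxU.
Qed.

Lemma ann_bos s t m : ann s (bos t m) = bos t (ann s m).
Proof.
move: m; apply: ket_ext => [k m n|k m n|A a]; try by rewrite !linearP.
rewrite /bos annU; case: t.1.
  by rewrite derU !linearZ /= !annU; case: ifP => _; rewrite ?linear0 ?scaler0 //
    scalerA linearZ /= derU scalerA mulrC.
by rewrite mulxU annU; case: ifP => _; rewrite ?linear0 // linearZ /= mulxU.
Qed.

End Fock.

Lemma lin_N (K : fieldType) (U W : lmodType K) (f : U -> W) (fL : linear f) u :
  f (- u) = - f u.
Proof. by rewrite -scaleN1r (lin_Z fL) scaleN1r. Qed.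

(** * Fermionic and Weyl operators attached to vectors of V *)

Section SymplecticBasis.
Variables (K : fieldType) (l : nat) (V : vectType K) (w : {skew_symmetric V}).

(** Spanning is recorded through the coordinates that the form itself supplies, so every expansion
    in the basis is explicit. *)
Record symp_basis := SympBasis {
  sb :> mode l -> V;
  sb_form : forall s t, w (sb s) (sb t) = sympl K s t;
  sb_span : forall u, u = \sum_(t : mode l) ((-1) ^+ t.1 * w (sb (~~ t.1, t.2)) u) *: sb t }.

Lemma form_skew u v : w u v = - w v u.
Proof. by rewrite hermC /= expr1 mulN1r. Qed.

Lemma form_linl v : linear (w ^~ v : V -> K^o).
Proof. by move=> a u u'; rewrite linearPl. Qed.
Lemma form_linr u : linear (w u : V -> K^o).
Proof. by move=> a u' v; rewrite linearPr. Qed.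

Lemma formPl a u u' v : w (a *: u + u') v = a * w u v + w u' v.
Proof. exact: form_linl. Qed.
Lemma formPr a u v v' : w u (a *: v + v') = a * w u v + w u v'.
Proof. exact: form_linr. Qed.

Variable b : symp_basis.

Definition conj_mode (t : mode l) : mode l := (~~ t.1, t.2).
Definition dualb (t : mode l) : V := (-1) ^+ t.1 *: b (conj_mode t).

Lemma conj_modeK : involutive conj_mode.
Proof. by case=> c i; rewrite /conj_mode /= negbK. Qed.

Lemma mode_eqE (s t : mode l) : (s == t) = (s.1 == t.1) && (s.2 == t.2).
Proof. by case: s t => ? ? [? ?]. Qed.

Lemma dualb_form s t : w (dualb s) (b t) = (s == t)%:R.
Proof.
rewrite /dualb (lin_Z (form_linl _)) sb_form /sympl.
rewrite mode_eqE; case: s t => [[] i] [[] j] /=; case: eqP => _ //=;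
  by rewrite ?subrr ?scaler0 // ?sub0r ?subr0 ?scaleN1r ?opprK ?scale1r.
Qed.

Lemma dualb_expand u : u = \sum_t w (dualb t) u *: b t.
Proof.
rewrite {1}[u](sb_span b); apply: eq_bigr => t _.
by rewrite /dualb (lin_Z (form_linl _)).
Qed.

Lemma basis_expand u : u = \sum_t w u (b t) *: dualb t.
Proof.
rewrite {1}[u]dualb_expand (reindex_inj (can_inj conj_modeK)) /=.
apply: eq_bigr => t _; rewrite /dualb conj_modeK (lin_Z (form_linl _)) /=.
rewrite [w (b t) u]form_skew.
by case: t.1; rewrite /= ?expr1 ?expr0 ?scale1r ?scaleN1r ?opprK // scalerN scaleNr.
Qed.

Lemma basis_ext (W : lmodType K) (f1 f2 : V -> W) : linear f1 -> linear f2 ->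
  (forall t, f1 (b t) = f2 (b t)) -> f1 =1 f2.
Proof.
move=> f1L f2L H u; rewrite [u]dualb_expand (lin_sum f1L) (lin_sum f2L).
by apply: eq_bigr => t _; rewrite (lin_Z f1L) (lin_Z f2L) H.
Qed.

Lemma dualb_ext (W : lmodType K) (f1 f2 : V -> W) : linear f1 -> linear f2 ->
  (forall t, f1 (dualb t) = f2 (dualb t)) -> f1 =1 f2.
Proof.
move=> f1L f2L H u; rewrite [u]basis_expand (lin_sum f1L) (lin_sum f2L).
by apply: eq_bigr => t _; rewrite (lin_Z f1L) (lin_Z f2L) H.
Qed.

(** Invariance of the canonical tensor of b^t and b_t under sp: expand x b^t in the dual basis, move
    x across the form, and recollect x b_t. *)
Lemma sp_contract (W : lmodType K) (F : V -> V -> W) (x : sp w) :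
  (forall u, linear (F u)) -> (forall u, linear (F ^~ u)) ->
  \sum_t F (sp_val x (dualb t)) (b t) = - \sum_t F (dualb t) (sp_val x (b t)).
Proof.
move=> Fr Fl.
under eq_bigr => t _ do rewrite {1}[sp_val x _]basis_expand (lin_sum (Fl _)).
rewrite exchange_big -sumrN /=; apply: eq_bigr => s _.
rewrite [sp_val x _]dualb_expand (lin_sum (Fr _)) -sumrN; apply: eq_bigr => t _.
by rewrite (lin_Z (Fl _)) (lin_Z (Fr _)) sp_valP scaleNr.
Qed.

(** The canonical tensor is skew like the form: conjugating the mode exchanges b_t and b^t, with
    opposite signs. *)
Lemma dual_swap (W : lmodType K) (F : V -> V -> W) :
  (forall u, linear (F u)) -> (forall u, linear (F ^~ u)) ->
  \sum_t F (b t) (dualb t) = - \sum_t F (dualb t) (b t).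
Proof.
move=> Fr Fl; rewrite (reindex_inj (can_inj conj_modeK)) /= -sumrN.
apply: eq_bigr => t _; rewrite /dualb conj_modeK /= (lin_Z (Fl _)) (lin_Z (Fr _)).
by case: t.1; rewrite ?expr1 ?expr0 ?scale1r ?scaleN1r ?opprK.
Qed.

Local Notation M := (fock K l).
Implicit Types (u v z : V) (m : M) (x y : sp w).

Definition ext u m : M := \sum_t w (dualb t) u *: cre t m.
(** This is contraction with the linear form [w u], so the coefficients are the coordinates of u in
    the dual basis. *)
Definition ctr u m : M := \sum_t w u (b t) *: ann t m.
Definition weyl u m : M := \sum_t w (dualb t) u *: bos t m.

Fact sum_scale_linear (c : mode l -> K) (f : mode l -> M -> M) :
  (forall t, linear (f t)) -> linear (fun m => \sum_t c t *: f t m).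
Proof.
move=> fL a m n; rewrite scaler_sumr -big_split; apply: eq_bigr => t _ /=.
by rewrite fL scalerDr !scalerA [c t * a]mulrC.
Qed.
HB.instance Definition _ u := GRing.isLinear.Build K M M *:%R (ext u)
  (sum_scale_linear _ (fun t => @linearP K M M _ (cre t))).
HB.instance Definition _ u := GRing.isLinear.Build K M M *:%R (ctr u)
  (sum_scale_linear _ (fun t => @linearP K M M _ (ann t))).
HB.instance Definition _ u := GRing.isLinear.Build K M M *:%R (weyl u)
  (sum_scale_linear _ (fun t => @linearP K M M _ (bos t))).

Lemma ext_linl m : linear (ext ^~ m).
Proof.
move=> a u v; rewrite scaler_sumr -big_split; apply: eq_bigr => t _ /=.
by rewrite formPr scalerDl scalerA.
Qed.
Lemma weyl_linl m : linear (weyl ^~ m).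
Proof.
move=> a u v; rewrite scaler_sumr -big_split; apply: eq_bigr => t _ /=.
by rewrite formPr scalerDl scalerA.
Qed.
Lemma ctr_linl m : linear (ctr ^~ m).
Proof.
move=> a u v; rewrite scaler_sumr -big_split; apply: eq_bigr => t _ /=.
by rewrite formPl scalerDl scalerA.
Qed.

Lemma sum_delta (t : mode l) (f : mode l -> M) (c : mode l -> K) :
  (forall s, c s = (s == t)%:R) -> \sum_s c s *: f s = f t.
Proof.
move=> H; rewrite (bigD1 t) //= H eqxx scale1r big1 ?addr0 // => s st.
by rewrite H (negPf st) scale0r.
Qed.

Lemma extE t m : ext (b t) m = cre t m.
Proof. by rewrite /ext (sum_delta (t := t)) // => s; rewrite dualb_form. Qed.
Lemma weylE t m : weyl (b t) m = bos t m.
Proof. by rewrite /weyl (sum_delta (t := t)) // => s; rewrite dualb_form. Qed.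
Lemma ctrE t m : ctr (dualb t) m = ann t m.
Proof. by rewrite /ctr (sum_delta (t := t)) // => s; rewrite dualb_form eq_sym. Qed.

(** As in the relations that follow, bilinearity reduces the claim to basis vectors; contractions
    are tested on the dual basis, where [ctr] becomes [ann]. *)
Lemma ext_anti u v m : ext u (ext v m) = - ext v (ext u m).
Proof.
move: u; apply: basis_ext => [a u u'|a u u'|s].
- exact: ext_linl.
- by rewrite ext_linl !linearP.
move: v; apply: basis_ext => [a u u'|a u u'|t].
- by rewrite ext_linl !linearP.
- by rewrite ext_linl !linearP.
by rewrite !extE; apply/eqP; rewrite -addr_eq0 cre_anti.
Qed.

Lemma ctr_anti u v m : ctr u (ctr v m) = - ctr v (ctr u m).
Proof.
move: u; apply: dualb_ext => [a u u'|a u u'|s].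
- exact: ctr_linl.
- by rewrite ctr_linl !linearP.
move: v; apply: dualb_ext => [a u u'|a u u'|t].
- by rewrite ctr_linl !linearP.
- by rewrite ctr_linl !linearP.
by rewrite !ctrE; apply/eqP; rewrite -addr_eq0 ann_anti.
Qed.

Lemma ctr_ext u v m : ctr u (ext v m) = w u v *: m - ext v (ctr u m).
Proof.
move: u; apply: dualb_ext => [a u u'|a u u'|s].
- exact: ctr_linl.
- by rewrite formPl ctr_linl [ext v _]linearP scalerDl -scalerA scalerBr opprD addrACA.
move: v; apply: basis_ext => [a u u'|a u u'|t].
- by rewrite ext_linl [ctr _ _]linearP.
- by rewrite formPr ext_linl scalerDl -scalerA scalerBr opprD addrACA.
rewrite !ctrE !extE dualb_form; apply/eqP; rewrite eq_sym subr_eq eq_sym.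
by rewrite ann_cre.
Qed.

Lemma weyl_comm u v m : weyl u (weyl v m) = w u v *: m + weyl v (weyl u m).
Proof.
move: u; apply: basis_ext => [a u u'|a u u'|s].
- exact: weyl_linl.
- by rewrite formPl weyl_linl [weyl v _]linearP scalerDl -scalerA scalerDr addrACA.
move: v; apply: basis_ext => [a u u'|a u u'|t].
- by rewrite weyl_linl [weyl _ _]linearP.
- by rewrite formPr weyl_linl scalerDl -scalerA scalerDr addrACA.
by rewrite !weylE sb_form -bos_comm subrK.
Qed.

Lemma ext_weyl u v m : ext u (weyl v m) = weyl v (ext u m).
Proof.
move: u; apply: basis_ext => [a u u'|a u u'|s].
- exact: ext_linl.
- by rewrite ext_linl !linearP.
move: v; apply: basis_ext => [a u u'|a u u'|t].
- by rewrite weyl_linl !linearP.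
- by rewrite weyl_linl.
by rewrite !weylE !extE cre_bos.
Qed.

Lemma ctr_weyl u v m : ctr u (weyl v m) = weyl v (ctr u m).
Proof.
move: u; apply: dualb_ext => [a u u'|a u u'|s].
- exact: ctr_linl.
- by rewrite ctr_linl !linearP.
move: v; apply: basis_ext => [a u u'|a u u'|t].
- by rewrite weyl_linl !linearP.
- by rewrite weyl_linl.
by rewrite !weylE !ctrE ann_bos.
Qed.

End SymplecticBasis.

(** * The action of sp by quadratic operators *)

Section SpAction.
Variables (K : fieldType) (l : nat) (V : vectType K) (w : {skew_symmetric V}).
Hypothesis two_neq0 : 2%:R != 0 :> K.
Variable b : symp_basis l w.
Local Notation M := (fock K l).
Local Notation ext := (ext b).
Local Notation ctr := (ctr b).
Local Notation weyl := (weyl b).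
Implicit Types (u v z : V) (m : M) (x y : sp w).

Fact scale_regroup (a c : K) (p p' q q' : M) :
  a *: p + p' + c *: (a *: q + q') = a *: (p + c *: q) + (p' + c *: q').
Proof. by rewrite !scalerDr !scalerA [c * a]mulrC addrACA. Qed.

(** The operator of the element u v of Sym^2 V, which is sp. The Weyl part is symmetrised and halved
    so that the commutators with [ext z], [ctr z] and [weyl z] all involve the same vector
    [sp_quad u v z]. *)
Definition quad u v m : M := ext u (ctr v m) + ext v (ctr u m)
  + 2%:R^-1 *: (weyl u (weyl v m) + weyl v (weyl u m)).

Fact quad_linear u v : linear (quad u v).
Proof.
move=> a m n; rewrite /quad [ctr v _]linearP [ctr u _]linearP.
rewrite [ext u _]linearP [ext v _]linearP [weyl v (_ + _)]linearP.
rewrite [weyl u (_ + _)]linearP [weyl u _]linearP [weyl v (_ + _)]linearP.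
set p := ext u _; set q := ext v _; set r := weyl u _; set s := weyl v _.
set p' := ext u _; set q' := ext v _; set r' := weyl u _; set s' := weyl v _.
rewrite [a *: p + p' + _]addrACA -scalerDr [a *: r + r' + _]addrACA -scalerDr.
exact: scale_regroup.
Qed.
HB.instance Definition _ u v := GRing.isLinear.Build K M M *:%R (quad u v)
  (quad_linear u v).

Lemma quadC u v m : quad u v m = quad v u m.
Proof. by rewrite /quad [ext u _ + _]addrC [weyl u _ + _]addrC. Qed.

Lemma quad_linl v m : linear (fun u => quad u v m).
Proof.
move=> a u z; rewrite /quad ext_linl ctr_linl [ext v _]linearP !weyl_linl.
rewrite [weyl v (_ + _)]linearP.
set p := ext u _; set q := ext v _; set r := weyl u _; set s := weyl v _.
set p' := ext z _; set q' := ext v _; set r' := weyl z _; set s' := weyl v _.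
rewrite [a *: p + p' + _]addrACA -scalerDr [a *: r + r' + _]addrACA -scalerDr.
exact: scale_regroup.
Qed.
Lemma quad_linr u m : linear (fun v => quad u v m).
Proof. by move=> a v z; rewrite !(quadC u) quad_linl. Qed.

Definition sp_quad u v z : V := w u z *: v + w v z *: u.

Lemma quad_ext u v z m :
  quad u v (ext z m) = ext (sp_quad u v z) m + ext z (quad u v m).
Proof.
have H p q : ext p (ctr q (ext z m)) = w q z *: ext p m + ext z (ext p (ctr q m)).
  by rewrite ctr_ext linearB linearZ /= [ext p (ext z _)]ext_anti opprK.
have G p q : weyl p (weyl q (ext z m)) = ext z (weyl p (weyl q m)).
  by rewrite -!ext_weyl.
rewrite /quad !H !G /sp_quad ext_linl [ext (w v z *: u) m](lin_Z (ext_linl b m)).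
rewrite 2!(linearD (ext z)) /= [ext z (_ *: _)]linearZ /= (linearD (ext z)) /=.
by rewrite addrACA [w v z *: ext u m + _]addrC !addrA.
Qed.

Lemma quad_ctr u v z m :
  quad u v (ctr z m) = ctr (sp_quad u v z) m + ctr z (quad u v m).
Proof.
have H p q : ext p (ctr q (ctr z m)) = w p z *: ctr q m + ctr z (ext p (ctr q m)).
  rewrite [ctr z (ext _ _)]ctr_ext ctr_anti linearN /=.
  by rewrite [w z p]form_skew scaleNr addrA subrr sub0r.
have G p q : weyl p (weyl q (ctr z m)) = ctr z (weyl p (weyl q m)).
  by rewrite -!ctr_weyl.
rewrite /quad !H !G /sp_quad ctr_linl [ctr (w v z *: u) m](lin_Z (ctr_linl b m)).
rewrite 2!(linearD (ctr z)) /= [ctr z (_ *: _)]linearZ /= (linearD (ctr z)) /=.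
by rewrite addrACA !addrA.
Qed.

Lemma quad_weyl u v z m :
  quad u v (weyl z m) = weyl (sp_quad u v z) m + weyl z (quad u v m).
Proof.
have H p q : weyl p (weyl q (weyl z m)) =
    w q z *: weyl p m + (w p z *: weyl q m + weyl z (weyl p (weyl q m))).
  by rewrite [weyl q (weyl z m)]weyl_comm linearD linearZ /= [weyl p (weyl z _)]weyl_comm.
rewrite /quad !H /sp_quad weyl_linl [weyl (w v z *: u) m](lin_Z (weyl_linl b m)).
rewrite 2!(linearD (weyl z)) /= [weyl z (_ *: _)]linearZ /= (linearD (weyl z)) /=.
rewrite !ctr_weyl !ext_weyl.
set p := w v z *: _; set q := w u z *: _.
have -> : p + (q + weyl z (weyl u (weyl v m))) + (q + (p + weyl z (weyl v (weyl u m))))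
   = (p + q) *+ 2 + (weyl z (weyl u (weyl v m)) + weyl z (weyl v (weyl u m))).
  by rewrite !addrA [LHS](AC 6 ((1*2)*(5*4)*(3*6)))/= mulr2n !addrA.
rewrite scalerDr -scaler_nat scalerA mulVf // scale1r [p + q]addrC.
by rewrite addrCA.
Qed.

(** Summing [sp_quad] of b^t and x b_t over t gives x twice, once from each of its two terms; this
    is the origin of the factor 1/2, see [sp_quad_sum]. *)
Definition sp_act x m : M := 2%:R^-1 *: \sum_t quad (dualb b t) (sp_val x (b t)) m.

Fact sp_act_linear x : linear (sp_act x).
Proof.
move=> a m n; rewrite /sp_act scalerA mulrC -scalerA -scalerDr; congr (_ *: _).
rewrite scaler_sumr -big_split; apply: eq_bigr => t _; exact: linearP.
Qed.
HB.instance Definition _ x := GRing.isLinear.Build K M M *:%R (sp_act x)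
  (sp_act_linear x).

Lemma sp_valL a x y u : sp_val (a *: x + y) u = a *: sp_val x u + sp_val y u.
Proof. by rewrite /sp_val linearP /= !lfun_simp. Qed.

Lemma sp_act_linl m : linear (sp_act ^~ m).
Proof.
move=> a x y; rewrite /sp_act scalerA mulrC -scalerA -scalerDr; congr (_ *: _).
rewrite scaler_sumr -big_split; apply: eq_bigr => t _ /=.
by rewrite sp_valL quad_linr.
Qed.

Lemma sp_quad_sum x u :
  2%:R^-1 *: \sum_t sp_quad (dualb b t) (sp_val x (b t)) u = sp_val x u.
Proof.
rewrite /sp_quad big_split /=.
have -> : \sum_t w (dualb b t) u *: sp_val x (b t) = sp_val x u.
  rewrite [in RHS](dualb_expand b u) linear_sum /=.
  by apply: eq_bigr => t _; rewrite linearZ.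
have -> : \sum_t w (sp_val x (b t)) u *: dualb b t = sp_val x u.
  rewrite [in RHS](basis_expand b (sp_val x u)); apply: eq_bigr => t _.
  by rewrite sp_valP form_skew opprK.
by rewrite -mulr2n -scaler_nat scalerA mulVf // scale1r.
Qed.

Lemma sp_act_comm (Z : V -> M -> M) : (forall u, linear (Z u)) ->
  (forall m, linear (Z ^~ m)) ->
  (forall u v z m, quad u v (Z z m) = Z (sp_quad u v z) m + Z z (quad u v m)) ->
  forall x z m, sp_act x (Z z m) = Z (sp_val x z) m + Z z (sp_act x m).
Proof.
move=> Zr Zl H x z m; rewrite /sp_act (lin_Z (Zr _)) (lin_sum (Zr _)).
rewrite -[in RHS](sp_quad_sum x) (lin_Z (Zl _)) (lin_sum (Zl _)) -scalerDr.
by rewrite -big_split; congr (_ *: _); apply: eq_bigr => t _; rewrite H.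
Qed.

Lemma sp_act_ext x z m :
  sp_act x (ext z m) = ext (sp_val x z) m + ext z (sp_act x m).
Proof.
apply: (sp_act_comm _ _ quad_ext) => [u a m1 m2|]; [exact: linearP | exact: ext_linl].
Qed.
Lemma sp_act_ctr x z m :
  sp_act x (ctr z m) = ctr (sp_val x z) m + ctr z (sp_act x m).
Proof.
apply: (sp_act_comm _ _ quad_ctr) => [u a m1 m2|]; [exact: linearP | exact: ctr_linl].
Qed.
Lemma sp_act_weyl x z m :
  sp_act x (weyl z m) = weyl (sp_val x z) m + weyl z (sp_act x m).
Proof.
apply: (sp_act_comm _ _ quad_weyl) => [u a m1 m2|]; [exact: linearP | exact: weyl_linl].
Qed.

Lemma sp_act_quad x u v m : sp_act x (quad u v m) =
  quad (sp_val x u) v m + quad u (sp_val x v) m + quad u v (sp_act x m).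
Proof.
rewrite /quad 2!(linearD (sp_act x)) /= [sp_act x (_ *: _)]linearZ /=.
rewrite (linearD (sp_act x)) /= !sp_act_ext !sp_act_ctr !sp_act_weyl.
rewrite !(linearD (ext _)) /= !(linearD (weyl _)) /=.
set a1 := ext (sp_val x u) _; set a2 := ext u (ctr (sp_val x v) m); set a3 := ext u _.
set a4 := ext (sp_val x v) _; set a5 := ext v (ctr (sp_val x u) m); set a6 := ext v _.
set c1 := weyl (sp_val x u) _; set c2 := weyl u _; set c3 := weyl u _.
set c4 := weyl (sp_val x v) _; set c5 := weyl v _; set c6 := weyl v _.
have -> : c1 + (c2 + c3) + (c4 + (c5 + c6)) = (c1 + c5) + (c2 + c4) + (c3 + c6).
  by rewrite !addrA [LHS](AC 6 (1*5*2*4*3*6))/=.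
rewrite !scalerDr !addrA.
set d1 := _ *: c1; set d2 := _ *: c2; set d3 := _ *: c3.
set d4 := _ *: c4; set d5 := _ *: c5; set d6 := _ *: c6.
by rewrite [LHS](AC 12 (1*5*7*8*2*4*9*10*3*6*11*12))/=.
Qed.

(** Acting by x on the quadratic expression of y differentiates both factors. Invariance of the
    canonical tensor moves the x on b^t to the other factor with a minus sign, which leaves the
    commutator there. *)
Lemma sp_act_lie x y m :
  sp_act (lie x y) m = sp_act x (sp_act y m) - sp_act y (sp_act x m).
Proof.
apply/eqP; rewrite eq_sym subr_eq; apply/eqP.
rewrite [sp_act y m]/sp_act linearZ /= linear_sum /=.
under eq_bigr => t _ do rewrite sp_act_quad.
rewrite 2!big_split /=.
rewrite scalerDr; congr (_ + _); rewrite /sp_act; congr (_ *: _).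
have := @sp_contract _ _ _ _ b _ (fun u v => quad u (sp_val y v) m) x.
move=> /= ->; last 2 first.
- by move=> u a v z; rewrite linearP quad_linr.
- by move=> u; exact: quad_linl.
rewrite -sumrN -big_split; apply: eq_bigr => t _ /=.
rewrite sp_lieE !lfun_simp (lin_B (quad_linr _ _)).
by rewrite addrC.
Qed.

End SpAction.

(** * Highest weight modules *)

Section Lifting.
Variables (K : fieldType) (g : lieAlgType K) (M : lmodType K).
Variable act : g -> M -> M.

Lemma quot_lift (N : lmodType K) (S : submodClosed N) (f : N -> M) :
  linear f -> (forall u, u \in S -> f u = 0) ->
  exists f' : quotmod S -> M, linear f' /\ forall u, f' (quot_pi S u) = f u.
Proof.
move=> fL fS; exists (fun q => f (quot_repr q)).
have E u : f (quot_repr (quot_pi S u)) = f u.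
  apply/eqP; rewrite -subr_eq0 -(lin_B fL) fS //.
  by apply/quot_piP; rewrite quot_reprK.
split=> // a p q; rewrite -[p in LHS]quot_reprK -[q in LHS]quot_reprK.
by rewrite -quot_pi_linear E fL.
Qed.

Lemma lieQuot_lift (D : lieQuotData g) (f : lq_mod D -> M) : linear f ->
  (forall u, u \in lq_sub D -> f u = 0) ->
  (forall x u, f (@lq_act _ _ D x u) = act x (f u)) ->
  exists f' : lieQuot D -> M, [/\ linear f',
    forall x q, f' (lact x q) = act x (f' q) &
    forall u, f' (quot_pi (lq_sub D) u) = f u].
Proof.
move=> fL fS fact; have [f' [f'L E]] := quot_lift fL fS.
exists f'; split=> // x q; rewrite -[q]quot_reprK.
by rewrite [lact _ _](lieQuot_actE x) !E fact.
Qed.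

Lemma quot_gen_lift (N : lieModType g) (A : N -> Prop) (f : N -> M) :
  linear f -> (forall x u, f (lact x u) = act x (f u)) ->
  (forall u, A u -> f u = 0) -> op_submod act (fun m => m = 0) ->
  exists f' : quot_gen A -> M, [/\ linear f',
    forall x q, f' (lact x q) = act x (f' q) &
    forall u, f' (quot_pi _ u) = f u].
Proof.
move=> fL fact fA [_ _ act0]; apply: lieQuot_lift => //= u.
apply: (gen_submod_ind (S := fun u => f u = 0)) => //; split.
- exact: lin_0.
- by move=> a p q p0 q0; rewrite fL p0 q0 scaler0 addr0.
- by move=> x p p0; rewrite fact act0.
Qed.

End Lifting.

Section HighestWeightModules.
Variables (K : fieldType) (g : lieAlgType K) (h : {vspace g}).
Variables (P : hdual h -> Prop) (lambda : hdual h).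

Lemma enveloping_ind (S : enveloping g -> Prop) :
  op_submod (@lact K g (enveloping g)) S -> S (env_one g) -> forall u, S u.
Proof.
move=> [S0 SD SA] S1 q; rewrite -[q]quot_reprK.
move: (quot_repr q); apply: free_mod_ind => [|k u v Su Sv|s].
- by rewrite (lin_0 (quot_pi_linear _)).
- by rewrite quot_pi_linear; apply: SD.
elim: s => [|x s IHs]; first exact: S1.
have -> : quot_pi (span_submod (@env_rel K g)) (free_gen K (x :: s)) =
    lact x (quot_pi (span_submod (@env_rel K g)) (word s) : enveloping g).
  by rewrite [lact _ _](lieQuot_actE x) /= env_actU.
exact: SA.
Qed.

Definition verma_one : verma P lambda := quot_pi _ (env_one g).

Lemma quot_genE (N : lieModType g) (A : N -> Prop) x u :
  lact x (quot_pi _ u : quot_gen A) = quot_pi _ (lact x u).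
Proof. exact: (lieQuot_actE x). Qed.

Lemma verma_ind (S : verma P lambda -> Prop) :
  op_submod (@lact K g (verma P lambda)) S -> S verma_one -> forall z, S z.
Proof.
move=> [S0 SD SA] S1 q; rewrite -[q]quot_reprK; move: (quot_repr q).
apply: (enveloping_ind (S := fun u => S (quot_pi _ u))) => //; split.
- by rewrite (lin_0 (quot_pi_linear _)).
- by move=> a u v Su Sv; rewrite quot_pi_linear; apply: SD.
- by move=> x u Su; rewrite -quot_genE; apply: SA.
Qed.

Lemma verma_one_pos (alpha : hdual h) (x : adjoint g) :
  P alpha -> weight_vector alpha x -> lact (x : g) verma_one = 0.
Proof.
move=> Pa xa; rewrite quot_genE; apply/quot_pi_eq0/mem_gen_submod.
by left; exists alpha, x.
Qed.

Lemma verma_one_h (t : subvs_of h) :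
  lact (vsval t) verma_one = (lambda t : K) *: verma_one.
Proof.
rewrite quot_genE -(lin_Z (quot_pi_linear _)); apply/quot_piP/mem_gen_submod.
by right; exists t.
Qed.

End HighestWeightModules.

(* A cyclic module generated by a singular vector is graded by the opposite of
   the height; only the multiples of the generator have degree 0. *)
Section GradedCyclicModule.
Variables (K : fieldType) (g : lieAlgType K) (h : {vspace g}).
Variables (P : hdual h -> Prop) (lambda : hdual h).
Variables (N : lieModType g) (one : N).
Hypothesis one_pos : forall (alpha : hdual h) (x : adjoint g),
  P alpha -> weight_vector alpha x -> lact (x : g) one = 0.
Hypothesis one_h : weight_vector lambda one.
Hypothesis cyclic : forall S : N -> Prop, op_submod (@lact K g N) S ->
  S one -> forall z, S z.

Variable (neg : g -> nat -> Prop) (t0 : subvs_of h).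
Hypothesis char0 : forall n, n.+1%:R != 0 :> K.
Hypothesis neg_gt0 : forall y m, neg y m -> (0 < m)%N.
Hypothesis neg_height : forall y m, neg y m -> lie (vsval t0) y = - m%:R *: y.
Hypothesis triangular : forall Q : g -> Prop,
  (forall a x y, Q x -> Q y -> Q (a *: x + y)) ->
  (forall y m, neg y m -> Q y) -> (forall t : subvs_of h, Q (vsval t)) ->
  (forall alpha (x : adjoint g), P alpha -> weight_vector alpha x -> Q x) ->
  forall x, Q x.

(** Degree k lies in the eigenspace of t0 for lambda(t0) - k, see [graded_t0]. Defining it by
    generation instead of as that eigenspace makes degree 0 transparent, because every lowering
    element has positive degree. *)
Inductive graded : nat -> N -> Prop :=
| graded_one : graded 0 one
| graded_zero k : graded k 0
| graded_lin k a z z' : graded k z -> graded k z' -> graded k (a *: z + z')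
| graded_act y m k z : neg y m -> graded k z -> graded (m + k) (lact y z).

Lemma graded_scale k a z : graded k z -> graded k (a *: z).
Proof.
by move=> kz; rewrite -[_ *: _]addr0; apply: graded_lin => //; exact: graded_zero.
Qed.

Lemma graded0 z : graded 0 z -> exists c, z = c *: one.
Proof.
move Ek: {1}0%N => k kz; elim: kz Ek => {k z} [|k|k a z z' _ IH _ IH'|y m k z /neg_gt0 m0 _ _].
- by exists 1; rewrite scale1r.
- by exists 0; rewrite scale0r.
- by move=> /[dup] /IH[c ->] /IH'[c' ->]; exists (a * c + c'); rewrite scalerDl scalerA.
- by move/esym/eqP; rewrite addn_eq0 -[m == 0]negbK -lt0n m0.
Qed.

Lemma lact_comm (W : lieModType g) (x y : g) (z : W) :
  lact x (lact y z) = lact (lie x y) z + lact y (lact x z).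
Proof. by rewrite lact_lie subrK. Qed.

Lemma graded_t0 k z : graded k z ->
  lact (vsval t0) z = ((lambda t0 : K) - k%:R) *: z.
Proof.
elim=> {k z} [|k|k a z z' _ IH _ IH'|y m k z ym _ IH].
- by rewrite subr0 one_h.
- by rewrite scaler0 (lin_0 (lact_linearr _)).
- by rewrite lact_linearr IH IH' scalerDr !scalerA mulrC.
rewrite lact_comm (neg_height ym) (lin_Z (lact_linearl _)) IH.
rewrite (lin_Z (lact_linearr _)) -scalerDl natrD; congr (_ *: _).
by rewrite addrC opprD [- _ - _]addrC addrA.
Qed.

Definition graded_span : {pred N} := span_submod (fun z => exists k, graded k z).

(** A weak substitute for the Poincare-Birkhoff-Witt theorem: x (y u) = [x, y] u + y (x u), and the
    induction hypothesis on u, quantified over all Lie algebra elements, covers both terms. *)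
Lemma graded_spanT z : z \in graded_span.
Proof.
have spanD a u v : u \in graded_span -> v \in graded_span ->
    a *: u + v \in graded_span by move=> uS vS; rewrite rpredD ?rpredZ.
have negS y m u : neg y m -> u \in graded_span -> lact y u \in graded_span.
  move=> ym; apply: (gen_submod_ind (S := fun u => lact y u \in graded_span)).
    split=> [|a p q pS qS|[]//]; first by rewrite (lin_0 (lact_linearr _)) rpred0.
    by rewrite lact_linearr spanD.
  move=> {}u [k ku]; apply: mem_gen_submod; exists (m + k)%N.
  exact: graded_act.
have gradS k u : graded k u -> forall x, lact x u \in graded_span.
  elim=> {k u} [|k|k a u u' _ IH _ IH'|y m k u ym ku IH] x.
  - move: x; apply: triangular => [a x y xS yS|y m ym|t|alpha x Pa xa].
    + by rewrite lact_linearl spanD.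
    + by apply: (negS _ m) => //; apply: mem_gen_submod; exists 0%N; exact: graded_one.
    + rewrite one_h rpredZ //; apply: mem_gen_submod.
      by exists 0%N; exact: graded_one.
    + by rewrite (one_pos Pa xa) rpred0.
  - by rewrite (lin_0 (lact_linearr _)) rpred0.
  - by rewrite lact_linearr spanD.
  - by rewrite lact_comm rpredD //; apply: (negS _ m).
move: z; apply: cyclic; last first.
  by apply: mem_gen_submod; exists 0%N; exact: graded_one.
split=> [|a u v|x u]; [exact: rpred0 | exact: spanD |].
apply: (gen_submod_ind (S := fun u => lact x u \in graded_span)).
  split=> [|a p q pS qS|[]//]; first by rewrite (lin_0 (lact_linearr _)) rpred0.
  by rewrite lact_linearr spanD.
by move=> {}u [k ku]; exact: gradS ku x.
Qed.

Lemma graded_decomp z : exists n (F : nat -> N),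
  (forall k, graded k (F k)) /\ z = \sum_(0 <= k < n.+1) F k.
Proof.
(* Vanishing beyond n is carried along so that two decompositions can be padded to a common length
   and added. *)
suff [n [F [FG zE _]]] : exists n (F : nat -> N), [/\ forall k, graded k (F k),
    z = \sum_(0 <= k < n.+1) F k & forall k, (n < k)%N -> F k = 0].
  by exists n, F.
have := graded_spanT z.
apply: (gen_submod_ind (S := fun z => exists n (F : nat -> N), [/\ forall k, graded k (F k),
    z = \sum_(0 <= k < n.+1) F k & forall k, (n < k)%N -> F k = 0])) => [|{}z [k kz]]; last first.
  exists k, (fun j => if j == k then z else 0); split=> [j||j].
  - by case: eqP => [->|_] //; exact: graded_zero.
  - by rewrite big_nat_recr //= eqxx big_nat big1 ?add0r // => j /andP[_]; case: ltngtP.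
  - by case: ltngtP.
split=> [|a u v [n [F [FG -> F0]]] [n' [F' [FG' -> F0']]]|[]//].
  exists 0%N, (fun=> 0); split=> // [k|]; first exact: graded_zero.
  by rewrite big_nat1.
have widen (G : nat -> N) (p q : nat) : (p <= q)%N -> (forall k, (p < k)%N -> G k = 0) ->
    \sum_(0 <= k < p.+1) G k = \sum_(0 <= k < q.+1) G k.
  move=> pq G0; rewrite [RHS](big_cat_nat (n := p.+1)) //= [X in _ + X]big_nat.
  by rewrite [X in _ + X]big1 ?addr0 // => k /andP[/G0].
exists (maxn n n'), (fun k => a *: F k + F' k); split=> [k||k].
- exact: graded_lin.
- rewrite (widen F _ (maxn n n')) ?leq_maxl // (widen F' _ (maxn n n')) ?leq_maxr //.
  by rewrite scaler_sumr -big_split.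
- by rewrite gtn_max => /andP[/F0-> /F0'->]; rewrite scaler0 addr0.
Qed.

(** Applying t0 - (lambda(t0) - (n + 1)) kills the top component n + 1 and multiplies component k by
    n + 1 - k. Repeating this leaves a nonzero multiple of component 0. *)
Lemma submod_graded0 (S : N -> Prop) : op_submod (@lact K g N) S ->
  forall n (F : nat -> N), (forall k, graded k (F k)) ->
  S (\sum_(0 <= k < n.+1) F k) -> S (F 0%N).
Proof.
move=> [S0 SD SA]; elim=> [|n IHn] F FG; first by rewrite big_nat1.
move=> SF; have := IHn (fun k => (n.+1 - k)%:R *: F k) (fun k => graded_scale _ (FG k)).
rewrite subn0 => H; suff /H/(SD n.+1%:R^-1 _ 0)/(_ S0) :
    S (\sum_(0 <= k < n.+1) (n.+1 - k)%:R *: F k).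
  by rewrite scalerA mulVf // scale1r addr0.
rewrite (_ : \sum_(0 <= k < _) _ = - ((lambda t0 : K) - n.+1%:R) *:
   \sum_(0 <= k < n.+2) F k + lact (vsval t0) (\sum_(0 <= k < n.+2) F k)).
  by apply: SD => //; apply: SA.
rewrite (lin_sum (lact_linearr _)) scaler_sumr -big_split [RHS]big_nat_recr //=.
rewrite (graded_t0 (FG n.+1)) -scalerDl addNr scale0r addr0 !big_nat.
apply: eq_bigr => k /andP[_ kn]; rewrite (graded_t0 (FG k)) -scalerDl.
congr (_ *: _); rewrite natrB 1?ltnW //.
by move: (lambda t0 : K) n.+1%:R k%:R => c p q; ring.
Qed.

End GradedCyclicModule.

(** * Embeddings of irreducible highest weight modules *)

Section Embeddings.
Variables (K : fieldType) (g : lieAlgType K) (M : lmodType K).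
Variable act : g -> M -> M.

(** The image is kept as a predicate on M: isomorphisms are obtained by comparing two embeddings
    with the same image, see [embeds_iso]. *)
Definition embeds (N : lieModType g) (I : M -> Prop) :=
  exists f : N -> M, [/\ linear f, injective f,
    forall x n, f (lact x n) = act x (f n) & forall m, I m <-> exists n, f n = m].

Definition cyclic_sub (v : M) : {pred M} := gen_submod act (fun u => u = v).

End Embeddings.

Section IrreducibleEmbedding.
Variables (K : fieldType) (g : lieAlgType K) (h : {vspace g}).
Variables (P : hdual h -> Prop) (lambda : hdual h).
Variables (M : lmodType K) (act : g -> M -> M).
Hypothesis act_linr : forall x, linear (act x).
Hypothesis act_linl : forall m, linear (act ^~ m).
Hypothesis act_lie : forall x y m,
  act (lie x y) m = act x (act y m) - act y (act x m).

Variables (neg : g -> nat -> Prop) (t0 : subvs_of h).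
Hypothesis char0 : forall n, n.+1%:R != 0 :> K.
Hypothesis neg_gt0 : forall y m, neg y m -> (0 < m)%N.
Hypothesis neg_height : forall y m, neg y m -> lie (vsval t0) y = - m%:R *: y.
Hypothesis triangular : forall Q : g -> Prop,
  (forall a x y, Q x -> Q y -> Q (a *: x + y)) ->
  (forall y m, neg y m -> Q y) -> (forall t : subvs_of h, Q (vsval t)) ->
  (forall alpha (x : adjoint g), P alpha -> weight_vector alpha x -> Q x) ->
  forall x, Q x.

Variables (v : M) (phi : M -> K^o).
Hypothesis v_pos : forall alpha (x : adjoint g),
  P alpha -> weight_vector alpha x -> act (x : g) v = 0.
Hypothesis v_h : forall t : subvs_of h, act (vsval t) v = (lambda t : K) *: v.
Hypothesis v_neq0 : v != 0.
Hypothesis phi_lin : linear phi.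
Hypothesis phi_neg : forall y m u, neg y m -> phi (act y u) = 0.
Hypothesis phi_faithful : forall N : M -> Prop, op_submod act N ->
  (forall n, N n -> n \in cyclic_sub act v) -> (forall n, N n -> phi n = 0) ->
  forall n, N n -> n = 0.

Let act0 : op_submod act (fun m => m = 0).
Proof.
split=> // [a p q -> ->|x p ->]; first by rewrite scaler0 addr0.
exact: lin_0.
Qed.

Lemma foldr_act_linear (s : seq g) : linear (fun u => foldr act u s).
Proof. by elim: s => //= x s IH a p q; rewrite IH act_linr. Qed.

Lemma enveloping_map : exists f : enveloping g -> M, [/\ linear f,
  forall x q, f (lact x q) = act x (f q) & f (env_one g) = v].
Proof.
pose f0 := mlift (fun s : seq g => foldr act v s).
have f0L : linear f0 by exact: mlift_linear.
have f0W s : f0 (word s) = foldr act v s by exact: mliftU.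
have [u||f [fL fa fE]] := @lieQuot_lift _ g M act
    (LieQuotData (@env_linearr K g) (@env_stable K g) (@env_linearl K g) (@env_lie K g)) f0 f0L.
- apply: (gen_submod_ind (S := fun u => f0 u = 0)) => [|{}u]; last first.
    case=> [[p [q [a [x [y ->]]]]]|[p [q [x [y ->]]]]].
      rewrite (lin_B f0L) f0L !f0W !foldr_cat /= act_linl foldr_act_linear.
      by rewrite subrr.
    rewrite !(lin_B f0L) !f0W !foldr_cat /= act_lie (lin_B (foldr_act_linear _)).
    by rewrite subrr.
  split=> [|a p q p0 q0|[]//]; first exact: lin_0.
  by rewrite f0L p0 q0 scaler0 addr0.
- move=> x; apply: malg_eq => [a p q|a p q|s] /=.
  + by rewrite env_linearr f0L.
  + by rewrite f0L act_linr.
  + by rewrite [env_act _ _]env_actU !f0W.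
by exists f; split=> //; rewrite fE f0W.
Qed.

Lemma verma_map : exists f : verma P lambda -> M, [/\ linear f,
  forall x q, f (lact x q) = act x (f q) & f (verma_one P lambda) = v].
Proof.
have [f [fL fa f1]] := enveloping_map.
have [|f' [f'L f'a f'E]] := @quot_gen_lift _ _ _ act _ (verma_rel P lambda) f fL fa _ act0.
  move=> u [[alpha [x [Pa xa ->]]]|[t ->]].
    by rewrite fa f1 (v_pos Pa xa).
  by rewrite (lin_B fL) fa f1 (lin_Z fL) f1 v_h subrr.
by exists f'; split=> //; rewrite f'E f1.
Qed.

(** A proper submodule of the Verma module has no component in degree 0, since a nonzero multiple of
    the generator would generate everything. Its image is then killed by [phi], which vanishes on
    lowered vectors, and [phi_faithful] makes the image zero. So the map factors through the
    irreducible quotient. *)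
Lemma L_embeds : embeds act (L P lambda) (fun m => m \in cyclic_sub act v).
Proof.
have [f [fL fa f1]] := verma_map.
pose one := verma_one P lambda.
have grad := @graded_decomp _ _ _ _ _ (verma P lambda) one
  (@verma_one_pos _ _ _ P lambda) (@verma_one_h _ _ _ P lambda)
  (@verma_ind _ _ _ P lambda) neg triangular.
have img z : f z \in cyclic_sub act v.
  move: z; apply: verma_ind.
    split=> [|a p q pS qS|x p pS].
    - by rewrite (lin_0 fL) rpred0.
    - by rewrite fL rpredD ?rpredZ.
    - by rewrite fa gen_submod_op.
  by rewrite f1 mem_gen_submod.
have gradphi k z : graded one neg k z -> (0 < k)%N -> phi (f z) = 0.
  elim=> {k z} [|k|k a z z' _ IH _ IH'|y m k z ym _ _] //.
  - by rewrite (lin_0 fL) (lin_0 phi_lin).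
  - by move=> k0; rewrite fL phi_lin IH // IH' // scaler0 addr0.
  - by rewrite fa (phi_neg _ ym).
have kill z : in_proper_submodule z -> f z = 0.
  case=> S [Ssub Sproper Sz]; have [S0 SD SA] := Ssub.
  apply: (phi_faithful (N := fun n => exists2 s, S s & f s = n)); last by exists z.
  - split=> [|a p q [s Ss <-] [s' Ss' <-]|x p [s Ss <-]].
    + by exists 0; rewrite ?(lin_0 fL).
    + by exists (a *: s + s'); [exact: SD | rewrite fL].
    + by exists (lact x s); [exact: SA | rewrite fa].
  - by move=> n [s _ <-].
  move=> _ [s Ss <-]; have [n [F [FG sE]]] := grad s.
  have F0 : F 0%N = 0.
    have SF0 : S (F 0%N).
      apply: (submod_graded0 _ char0 neg_height Ssub FG (n := n)); last by rewrite -sE.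
      exact: verma_one_h.
    have [c cE] := graded0 neg_gt0 (FG 0%N).
    have [c0|c0] := eqVneq c 0; first by rewrite cE c0 scale0r.
    case: Sproper; apply: verma_ind => //.
    have := SD c^-1 _ 0 SF0 S0.
    by rewrite cE scalerA mulVf // scale1r addr0.
  rewrite sE big_nat_recl // F0 add0r (lin_sum fL) (lin_sum phi_lin) big1 // => k _.
  exact: (gradphi k.+1).
have [f' [f'L f'a f'E]] := quot_gen_lift fL fa kill act0.
exists f'; split=> // [q1 q2 /eqP|m].
  rewrite -subr_eq0 -(lin_B f'L) => /eqP; rewrite -(quot_reprK (q1 - q2)) f'E => fz.
  apply/eqP; rewrite -subr_eq0 -(quot_reprK (q1 - q2)); apply/eqP.
  (* Injectivity: the kernel of the Verma map is itself a proper submodule, because the generator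
     goes to v, which is nonzero. *)
  apply/quot_pi_eq0/mem_gen_submod; exists (fun z => f z = 0); split=> //.
    split=> [|a p q p0 q0|x p p0]; first exact: lin_0.
    - by rewrite fL p0 q0 scaler0 addr0.
    - by rewrite fa p0; have [_ _] := act0; apply.
  by move=> /(_ one); rewrite f1; apply/eqP.
split=> [|[q <-]]; last by rewrite -[q]quot_reprK f'E img.
apply: (gen_submod_ind (S := fun m => exists q, f' q = m)).
  split=> [|a p q [s <-] [s' <-]|x p [s <-]].
  - by exists 0; rewrite (lin_0 f'L).
  - by exists (a *: s + s'); rewrite f'L.
  - by exists (lact x s); rewrite f'a.
by move=> u ->; exists (quot_pi _ one); rewrite f'E.
Qed.

End IrreducibleEmbedding.

Section EmbeddingTheory.
Variables (K : fieldType) (g : lieAlgType K) (M : lmodType K).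
Variable act : g -> M -> M.
Implicit Types (N : lieModType g) (I J : M -> Prop).

Lemma embeds_ext N I J : (forall m, I m <-> J m) -> embeds act N I -> embeds act N J.
Proof.
move=> IJ [f [fL fI fa fE]]; exists f; split=> // m.
by rewrite -IJ fE.
Qed.

Lemma embeds_iso N1 N2 I : embeds act N1 I -> embeds act N2 I -> N1 ≃ N2.
Proof.
move=> [f1 [f1L f1I f1a f1E]] [f2 [f2L f2I f2a f2E]].
have g12 n : exists n', f2 n' = f1 n by apply/f2E/f1E; exists n.
have g21 n : exists n', f1 n' = f2 n by apply/f1E/f2E; exists n.
have [u uE] := choice g12; have [u' u'E] := choice g21.
exists u; split=> [a p q||x n].
- by apply: f2I; rewrite uE f1L f2L !uE.
- by exists u' => n; [apply: f1I; rewrite u'E uE | apply: f2I; rewrite uE u'E].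
- by apply: f2I; rewrite uE f1a f2a uE.
Qed.

Lemma embeds0 : op_submod act (fun m => m = 0) ->
  embeds act (lie_dsum0 : lieModType g) (fun m => m = 0).
Proof.
move=> [_ _ a0]; exists (fun=> 0); split=> [a p q|p q _|x n|m].
- by rewrite scaler0 addr0.
- by apply/rowP => -[].
- by rewrite a0.
- by split=> [->|[n <-]] //; exists 0.
Qed.

Lemma embeds_dsum N1 N2 I J : (forall x, linear (act x)) ->
  embeds act N1 I -> embeds act N2 J -> (forall m, I m -> J m -> m = 0) ->
  embeds act (N1 ⊕ N2) (fun m => exists p q, [/\ I p, J q & m = p + q]).
Proof.
move=> actL [f1 [f1L f1I f1a f1E]] [f2 [f2L f2I f2a f2E]] IJ.
exists (fun n => f1 n.1 + f2 n.2); split=> [a p q|[p1 p2] [q1 q2] /= E|x n|m].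
- by rewrite f1L f2L scalerDr addrACA.
- have D : f1 (p1 - q1) = f2 (q2 - p2).
    rewrite (lin_B f1L) (lin_B f2L); apply/eqP.
    by rewrite subr_eq addrAC eq_sym subr_eq E addrC.
  have Z : f1 (p1 - q1) = 0.
    by apply: IJ; [apply/f1E; exists (p1 - q1) | rewrite D; apply/f2E; exists (q2 - p2)].
  have /eqP : p1 - q1 = 0 by apply: f1I; rewrite Z (lin_0 f1L).
  have /eqP : q2 - p2 = 0 by apply: f2I; rewrite -D Z (lin_0 f2L).
  by rewrite !subr_eq0 => /eqP-> /eqP->.
- by rewrite (lin_D (actL x)) f1a f2a.
- split=> [[p [q [/f1E[n1 <-] /f2E[n2 <-] ->]]]|[n <-]]; first by exists (n1, n2).
  by exists (f1 n.1), (f2 n.2); split=> //; [apply/f1E | apply/f2E]; eexists.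
Qed.

Lemma embeds_map N I (T : M -> M) : linear T ->
  (forall x m, I m -> T (act x m) = act x (T m)) ->
  (forall m, I m -> T m = 0 -> m = 0) ->
  embeds act N I -> embeds act N (fun m => exists2 n, I n & m = T n).
Proof.
move=> TL Ta T0 [f [fL fI fa fE]].
exists (T \o f); split=> [a p q|p q /= E|x n|m] /=.
- by rewrite fL TL.
- have /T0 /(_ _) Z : I (f (p - q)) by apply/fE; eexists.
  have /eqP : p - q = 0 by apply: fI; rewrite (lin_0 fL) Z // (lin_B fL) (lin_B TL) E subrr.
  by rewrite subr_eq0 => /eqP.
- by rewrite fa Ta //; apply/fE; eexists.
- split=> [[n /fE[n' <-] ->]|[n <-]]; first by exists n'.
  by exists (f n) => //; apply/fE; exists n.
Qed.

End EmbeddingTheory.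

(** * The decomposition of the Fock space *)

Section Grading.
Variables (K : fieldType) (l : nat).
Local Notation M := (fock K l).
Implicit Types (D : {pred state l}) (m : M).

Definition supported D m := forall s, s \notin D -> kcoef s m = 0.

Lemma supported_lin D a m m' :
  supported D m -> supported D m' -> supported D (a *: m + m').
Proof. by move=> mD mD' s sD; rewrite linearP /= mD // mD' // scaler0 addr0. Qed.
Lemma supported0 D : supported D 0.
Proof. by move=> s _; rewrite linear0. Qed.
Lemma supportedZ D a m : supported D m -> supported D (a *: m).
Proof. by move=> mD; rewrite -[_ *: _]addr0; apply: supported_lin => //; exact: supported0. Qed.
Lemma supportedD D m m' : supported D m -> supported D m' -> supported D (m + m').
Proof. by move=> mD mD'; rewrite -[m]scale1r; apply: supported_lin. Qed.
Lemma supported_sum D I (r : seq I) (F : I -> M) :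
  (forall i, supported D (F i)) -> supported D (\sum_(i <- r) F i).
Proof. by move=> FD; apply: big_ind => //; [exact: supported0 | exact: supportedD]. Qed.
Lemma supported_ket D A a : (A, a) \in D -> supported D (ket K A a).
Proof. by move=> sD s sD'; rewrite kcoefE; case: eqP => // ss; rewrite -ss sD in sD'. Qed.

(** The projection onto the kets in D; it turns the vanishing of coefficients into the induction
    principle [supported_ind]. *)
Definition restrict D : M -> M :=
  ket_lift (fun s : state l => if s \in D then ket K s.1 s.2 else 0).
HB.instance Definition _ D := GRing.isLinear.Build K M M *:%R (restrict D)
  (ket_lift_linear _).

Lemma restrictU D A a : restrict D (ket K A a) = if (A, a) \in D then ket K A a else 0.
Proof. exact: ket_liftE. Qed.

Lemma kcoef_restrict D s m : kcoef s (restrict D m) = (s \in D)%:R * kcoef s m.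
Proof.
move: m; apply: ket_ext => [k m n|k m n|A a]; first by rewrite !linearP.
  by rewrite linearP mulrDr; congr (_ + _); rewrite /= /GRing.scale /= mulrCA.
rewrite restrictU kcoefE; case: ifPn => sD; rewrite ?linear0 ?kcoefE;
  case: eqP => [sE|_]; rewrite ?mulr0 // -?sE ?sD ?mulr1 //.
by rewrite (negPf sD).
Qed.

Lemma restrict_id D m : supported D m -> restrict D m = m.
Proof.
move=> mD; apply/eqP; rewrite -subr_eq0; apply/eqP/kcoef_eq0 => s.
rewrite linearB /= kcoef_restrict; have [_|/mD->] := boolP (s \in D).
  by rewrite mul1r subrr.
by rewrite mulr0 subr0.
Qed.

Lemma supported_ind D (P : M -> Prop) : P 0 ->
  (forall k u v, P u -> P v -> P (k *: u + v)) ->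
  (forall A a, (A, a) \in D -> P (ket K A a)) -> forall m, supported D m -> P m.
Proof.
move=> P0 PD PK m /restrict_id <-; move: m; apply: ket_ind => [|k u v|A a].
- by rewrite linear0.
- by rewrite linearP; apply: PD.
- by rewrite restrictU; case: ifP => // /PK.
Qed.

Lemma supported_map (D D' : {pred state l}) (f : M -> M) : linear f ->
  (forall A a, (A, a) \in D -> supported D' (f (ket K A a))) ->
  forall m, supported D m -> supported D' (f m).
Proof.
move=> fL fK; apply: supported_ind => // [|k u v].
  by rewrite (lin_0 fL); exact: supported0.
by rewrite fL; exact: supported_lin.
Qed.

Definition occ_size (a : occ l) : nat := \sum_i a i.
(** Only the parity of the polynomial degree is recorded: a Weyl operator changes the degree by one
    in either direction, so the quadratic action of sp preserves the parity but not the degree. *)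
Definition grade (d : nat) (p : bool) : {pred state l} :=
  [pred s : state l | (#|s.1| == d) && (odd (occ_size s.2) == p)].

Lemma gradeE d p A a : ((A, a) \in grade d p) = (#|A| == d) && (odd (occ_size a) == p).
Proof. by []. Qed.

Lemma occ_size_incr i (a : occ l) : occ_size (incr i a) = (occ_size a).+1.
Proof.
rewrite /occ_size (eq_bigr (fun j => a j + (j == i))%N); last by move=> j _; rewrite ffunE.
rewrite big_split /= (bigD1 i (F := fun j => nat_of_bool _)) //= eqxx.
by rewrite [X in (_ + (_ + X))%N]big1 ?addn1 // => j /negPf->.
Qed.

Lemma incr_decr i (a : occ l) : (0 < a i)%N -> incr i (decr i a) = a.
Proof.
by move=> ai; apply/ffunP => j; rewrite !ffunE; case: eqP => [->|_];
  rewrite ?subn0 ?addn0 // subnK.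
Qed.

Lemma occ_size_decr i (a : occ l) : (0 < a i)%N -> (occ_size (decr i a)).+1 = occ_size a.
Proof. by move=> ai; rewrite -(occ_size_incr i) incr_decr. Qed.

Lemma supported_cre t d p m :
  supported (grade d p) m -> supported (grade d.+1 p) (cre t m).
Proof.
apply: supported_map => [k u v|A a]; first exact: linearP.
rewrite gradeE => /andP[/eqP Ad ap]; rewrite creU; case: ifPn => tA; first exact: supported0.
by apply/supportedZ/supported_ket; rewrite gradeE cardsU1 tA Ad ap eqxx.
Qed.

Lemma supported_ann t d p m :
  supported (grade d.+1 p) m -> supported (grade d p) (ann t m).
Proof.
apply: supported_map => [k u v|A a]; first exact: linearP.
rewrite gradeE => /andP[/eqP Ad ap]; rewrite annU; case: ifPn => tA; last exact: supported0.
apply/supportedZ/supported_ket; rewrite gradeE ap andbT.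
by have := cardsD1 t A; rewrite tA Ad add1n => -[->].
Qed.

Lemma supported_ann0 t p m : supported (grade 0 p) m -> ann t m = 0.
Proof.
move: m; apply: supported_ind => [|k u v u0 v0|A a]; first by rewrite linear0.
  by rewrite linearP /= u0 v0 scaler0 addr0.
by rewrite gradeE cards_eq0 => /andP[/eqP-> _]; rewrite annU inE.
Qed.

Lemma supported_bos t d p m :
  supported (grade d p) m -> supported (grade d (~~ p)) (bos t m).
Proof.
apply: supported_map => [k u v|A a]; first exact: linearP.
rewrite gradeE => /andP[Ad /eqP ap]; rewrite /bos; case: t.1; last first.
  by rewrite mulxU; apply: supported_ket; rewrite gradeE Ad occ_size_incr /= ap.
rewrite derU; have [->|ai] := posnP (a t.2); first by rewrite scale0r; exact: supported0.
apply/supportedZ/supported_ket; rewrite gradeE Ad /=.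
by have := occ_size_decr ai; rewrite -ap => <-; rewrite /= negbK.
Qed.

End Grading.

(** * The contravariant form *)

Section ContravariantForm.
Variables (K : fieldType) (l : nat).
Hypothesis char0 : forall n, n.+1%:R != 0 :> K.
Local Notation M := (fock K l).
Implicit Types (m n : M).

Definition csign (t : mode l) : K := if t.1 then 1 else -1.
(** The factorials make multiplication by x_i and differentiation adjoint. The sign for each
    occupied mode (false, i) makes the adjoint of [ext u] equal to [- ctr (swap u)] for every u, so
    that adjoints of elements of sp lie again in sp. *)
Definition ket_norm (s : state l) : K :=
  (\prod_(t in s.1) csign t) * \prod_i ((s.2 i)`!)%:R.

Lemma ket_norm_neq0 s : ket_norm s != 0.
Proof.
rewrite mulf_neq0 //; apply/prodf_neq0 => t _.
  by rewrite /csign; case: ifP; rewrite ?oppr_eq0 oner_neq0.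
by rewrite -(prednK (fact_gt0 _)) char0.
Qed.

Definition cform m n : K^o :=
  ket_lift (fun s : state l => ket_norm s *: kcoef s n : K^o) m.

Lemma cform_linl n : linear (cform ^~ n).
Proof. exact: ket_lift_linear. Qed.
Lemma cformE A a n : cform (ket K A a) n = ket_norm (A, a) * kcoef (A, a) n.
Proof. exact: ket_liftE. Qed.
Lemma cform_linr m : linear (cform m).
Proof.
move=> k n n'; move: m; apply: ket_ext => [c u v|c u v|A a].
- exact: cform_linl.
- by rewrite !cform_linl !scalerDr !scalerA mulrC addrACA.
- by rewrite !cformE linearP /= mulrDr; congr (_ + _); rewrite /GRing.scale /= mulrCA.
Qed.

Lemma cform_nondeg n : (forall m, cform m n = 0) -> n = 0.
Proof.
move=> n0; apply: kcoef_eq0 => -[A a]; apply/eqP.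
have /eqP := n0 (ket K A a); rewrite cformE mulf_eq0 (negPf (ket_norm_neq0 _)) /=.
by [].
Qed.

Lemma cform_ket A a B c :
  cform (ket K A a) (ket K B c) = ket_norm (A, a) * ((B, c) == (A, a))%:R.
Proof. by rewrite cformE kcoefE. Qed.

Lemma state_eqE (A B : {set mode l}) (a c : occ l) :
  ((A, a) == (B, c) :> state l) = (A == B) && (a == c).
Proof. by []. Qed.

Fact cform_adjoint_ext (f f' : M -> M) (c : K) : linear f -> linear f' ->
  (forall A a B a', cform (f (ket K A a)) (ket K B a') = c * cform (ket K A a) (f' (ket K B a'))) ->
  forall m n, cform (f m) n = c * cform m (f' n).
Proof.
move=> fL f'L H m n; move: m; apply: ket_ext => [k u v|k u v|A a].
- by rewrite fL cform_linl.
- by rewrite cform_linl mulrDr; congr (_ + _); rewrite /GRing.scale /= mulrCA.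
move: n; apply: ket_ext => [k u v|k u v|B a'] //.
- by rewrite cform_linr.
- by rewrite f'L cform_linr mulrDr; congr (_ + _); rewrite /GRing.scale /= mulrCA.
Qed.

Lemma ket_norm_add t (A : {set mode l}) (a : occ l) : t \notin A -> ket_norm (t |: A, a) = csign t * ket_norm (A, a).
Proof. by move=> tA; rewrite /ket_norm big_setU1 //= mulrA. Qed.

Lemma csign_sqr t : csign t * csign t = 1.
Proof. by rewrite /csign; case: ifP; rewrite ?mulrNN mulr1. Qed.

Lemma cform_cre t m n : cform (cre t m) n = csign t * cform m (ann t n).
Proof.
move: m n; apply: cform_adjoint_ext => [k u v|k u v|A a B a']; try exact: linearP.
rewrite creU annU; case: ifPn => tA; case: ifPn => tB;
  rewrite ?(lin_0 (cform_linl _)) ?(lin_0 (cform_linr _)) ?mulr0 //;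
  rewrite ?(lin_Z (cform_linl _)) ?(lin_Z (cform_linr _)) /= cform_ket state_eqE.
- case: eqP => [AB|_]; last by rewrite mulr0 scaler0 mulr0.
  by rewrite -AB !inE eqxx in tA.
- rewrite cform_ket state_eqE ket_norm_add // /GRing.scale /=.
  have -> : (B == t |: A) = (B :\ t == A).
    by apply/eqP/eqP => [->|<-]; rewrite ?setU1K // setD1K.
  case: eqP => [BA|_] /=; last by rewrite !mulr0.
  by rewrite -{1}BA [fsign K t (_ :\ _)]/fsign below_self -/(fsign K t B); ring.
- case: eqP => [BA|_]; last by rewrite mulr0 scaler0.
  by rewrite BA !inE eqxx in tB.
Qed.

Lemma cformC m n : cform m n = cform n m.
Proof.
move: m; apply: ket_ext => [k u v|k u v|A a]; first exact: cform_linl.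
  exact: cform_linr.
move: n; apply: ket_ext => [k u v|k u v|B c]; first exact: cform_linr.
  exact: cform_linl.
by rewrite !cform_ket eq_sym; case: eqP => [->|]; rewrite ?mulr0.
Qed.

Lemma cform_ann t m n : cform (ann t m) n = csign t * cform m (cre t n).
Proof. by rewrite cformC [cform m _]cformC cform_cre mulrA csign_sqr mul1r cformC. Qed.

Lemma cform_mulx i m n : cform (mulx i m) n = cform m (der i n).
Proof.
rewrite -[RHS]mul1r; move: m n.
apply: cform_adjoint_ext => [k u v|k u v|A a B a']; try exact: linearP.
rewrite mulxU derU (lin_Z (cform_linr _)) !cform_ket !state_eqE mul1r.
have [a'0|ai] := posnP (a' i).
  rewrite a'0 scale0r; case: (eqVneq a' (incr i a)) => [a'E|]; last by rewrite andbF mulr0.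
  by move: a'0; rewrite a'E ffunE eqxx addn1.
have -> : (a' == incr i a) = (decr i a' == a).
  apply/eqP/eqP => [->|<-]; last by rewrite incr_decr.
  by apply/ffunP => j; rewrite !ffunE addnK.
case: (eqVneq (decr i a') a) => [aE|_]; last by rewrite !andbF !mulr0 scaler0.
rewrite andbT /GRing.scale /= mulrA; congr (_ * _).
rewrite /ket_norm /= mulrCA; congr (_ * _).
rewrite (bigD1 i) //= [X in _ = _ * X](bigD1 i) //= mulrA -natrM; congr (_%:R * _).
  by rewrite -aE !ffunE eqxx /= addn1 subn1 prednK // -{1}(prednK ai) factS prednK.
by apply: eq_bigr => j ji; rewrite ffunE (negPf ji) addn0.
Qed.

Lemma cform_der i m n : cform (der i m) n = cform m (mulx i n).
Proof. by rewrite cformC -cform_mulx cformC. Qed.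

Lemma cform_bos t m n : cform (bos t m) n = cform m (bos (conj_mode t) n).
Proof. by rewrite /bos /=; case: t.1; rewrite ?cform_der ?cform_mulx. Qed.

End ContravariantForm.

Section ContravariantAction.
Variables (K : fieldType) (l : nat) (V : vectType K) (w : {skew_symmetric V}).
Hypothesis char0 : forall n, n.+1%:R != 0 :> K.
Variable b : symp_basis l w.
Local Notation M := (fock K l).
Implicit Types (u v z : V) (m n : M) (x y : sp w).

(** Passing to adjoints applies this exchange of conjugate basis vectors to both arguments of
    [quad]. It induces the transposition of sp, which sends each weight space to the opposite
    one. *)
Definition swap u : V := \sum_t w (dualb b t) u *: b (conj_mode t).

Lemma swap_linear : linear swap.
Proof.
move=> a u v; rewrite scaler_sumr -big_split; apply: eq_bigr => t _ /=.
by rewrite formPr scalerDl scalerA.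
Qed.

Lemma swapE t : swap (b t) = b (conj_mode t).
Proof.
rewrite /swap (bigD1 t) //= dualb_form eqxx scale1r big1 ?addr0 // => s st.
by rewrite dualb_form (negPf st) scale0r.
Qed.

Lemma swap_dualb t : swap (dualb b t) = - dualb b (conj_mode t).
Proof.
rewrite /dualb (lin_Z swap_linear) swapE conj_modeK -scaleNr; congr (_ *: _).
by rewrite /=; case: t.1; rewrite ?expr1 ?expr0 ?opprK.
Qed.

Lemma ctr_basis t m : ctr b (b t) m = csign K t *: ann (conj_mode t) m.
Proof.
have -> : b t = csign K t *: dualb b (conj_mode t).
  by rewrite /dualb conj_modeK scalerA /csign /=; case: t.1;
    rewrite ?expr1 ?expr0 ?mulr1 ?mulrNN ?mulr1 scale1r.
by rewrite (lin_Z (ctr_linl _ _)) ctrE.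
Qed.

Lemma cform_ext u m n : cform (ext b u m) n = - cform m (ctr b (swap u) n).
Proof.
move: u; apply: (@basis_ext _ _ _ _ b K^o) => [k u v|k u v|t].
- by rewrite ext_linl cform_linl.
- by rewrite swap_linear ctr_linl cform_linr -!scaleN1r !scalerDr !scalerA mulrC.
rewrite extE swapE ctr_basis (lin_Z (cform_linr _)) cform_cre conj_modeK /csign /=.
by case: t.1; rewrite /= /GRing.scale /= ?mulN1r ?opprK ?mul1r.
Qed.

Lemma cform_ctr u m n : cform (ctr b u m) n = - cform m (ext b (swap u) n).
Proof.
move: u; apply: (@basis_ext _ _ _ _ b K^o) => [k u v|k u v|t].
- by rewrite ctr_linl cform_linl.
- by rewrite swap_linear ext_linl cform_linr -!scaleN1r !scalerDr !scalerA mulrC.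
rewrite swapE extE ctr_basis (lin_Z (cform_linl _)) cform_ann /csign /=.
by case: t.1; rewrite /= /GRing.scale /= ?mulN1r ?opprK ?mul1r.
Qed.

Lemma cform_weyl u m n : cform (weyl b u m) n = cform m (weyl b (swap u) n).
Proof.
move: u; apply: (@basis_ext _ _ _ _ b K^o) => [k u v|k u v|t].
- by rewrite weyl_linl cform_linl.
- by rewrite swap_linear weyl_linl cform_linr.
by rewrite !weylE swapE weylE cform_bos.
Qed.

(** Adjoints reverse products; the symmetry of [quad] in u and v absorbs the reversal, and the two
    minus signs of the fermionic adjoints cancel. *)
Lemma cform_quad u v m n :
  cform (quad b u v m) n = cform m (quad b (swap u) (swap v) n).
Proof.
rewrite /quad !(lin_D (cform_linl _)) !(lin_D (cform_linr _)).
rewrite (lin_Z (cform_linl _)) (lin_Z (cform_linr _)).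
rewrite !(lin_D (cform_linl _)) !(lin_D (cform_linr _)).
rewrite !cform_ext !cform_ctr !cform_weyl !opprK.
by congr (_ + _ *: _); rewrite addrC.
Qed.

Fact sp_quad_linear u v : linear (sp_quad w u v).
Proof. by move=> a z z'; rewrite /sp_quad !formPr !scalerDl !scalerDr !scalerA addrACA. Qed.
HB.instance Definition _ u v := GRing.isLinear.Build K V V *:%R (sp_quad w u v)
  (sp_quad_linear u v).

Definition sp_elt u v : sp w := vsproj (sp_space w) (linfun (sp_quad w u v)).

Lemma sp_eltE u v z : sp_val (sp_elt u v) z = sp_quad w u v z.
Proof.
rewrite /sp_val /sp_elt vsprojK ?lfunE //; apply/mem_sp_space => z1 z2.
rewrite !lfunE /= /sp_quad !formPl !formPr !(lin_Z (form_linl w _)) !(lin_Z (form_linr w _)).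
rewrite [w z1 v]form_skew [w z1 u]form_skew /GRing.scale /=; ring.
Qed.

Lemma sp_ext x y : (forall z, sp_val x z = sp_val y z) -> x = y.
Proof. by move=> xy; apply/subvs_inj/lfunP. Qed.

Lemma sp_elt_linl v : linear (sp_elt ^~ v).
Proof.
move=> a u u'; apply: sp_ext => z; rewrite sp_valL !sp_eltE /sp_quad !formPl.
by rewrite !scalerDr !scalerDl !scalerA [w v z * a]mulrC addrACA.
Qed.
Lemma sp_elt_linr u : linear (sp_elt u).
Proof.
move=> a v v'; apply: sp_ext => z; rewrite sp_valL !sp_eltE /sp_quad !formPl.
by rewrite !scalerDr !scalerDl !scalerA [w u z * a]mulrC addrACA.
Qed.

Lemma two_neq0 : 2%:R != 0 :> K. Proof. exact: char0. Qed.

Lemma sp_elt_sum x : x = 2%:R^-1 *: \sum_t sp_elt (dualb b t) (sp_val x (b t)).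
Proof.
apply: sp_ext => z; rewrite -{1}(sp_quad_sum two_neq0 b).
have vL : linear (fun y => sp_val y z) by move=> a y y'; exact: sp_valL.
rewrite (lin_Z vL) (lin_sum vL); congr (_ *: _).
by apply: eq_bigr => t _; rewrite sp_eltE.
Qed.

Lemma sp_act_elt u v m : sp_act b (sp_elt u v) m = quad b u v m.
Proof.
have H p q : \sum_t w p (b t) *: quad b (dualb b t) q m = quad b p q m.
  rewrite [in RHS](basis_expand b p) (lin_sum (quad_linl b q m)).
  by apply: eq_bigr => t _; apply/esym/(lin_Z (quad_linl b q m)).
rewrite /sp_act; under eq_bigr => t _ do rewrite sp_eltE /sp_quad quad_linr
  (lin_Z (quad_linr b _ _)).
rewrite big_split /= !H.
by rewrite [quad b v u m]quadC -mulr2n -scaler_nat scalerA mulVf ?two_neq0 // scale1r.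
Qed.

Lemma cform_sp_act x : exists x', forall m n,
  cform (sp_act b x m) n = cform m (sp_act b x' n).
Proof.
exists (2%:R^-1 *: \sum_t sp_elt (swap (dualb b t)) (swap (sp_val x (b t)))) => m n.
rewrite (lin_Z (sp_act_linl b n)) (lin_sum (sp_act_linl b n)) (lin_Z (cform_linr _)).
rewrite (lin_sum (cform_linr _)) {1}/sp_act (lin_Z (cform_linl _)) (lin_sum (cform_linl _)).
by congr (_ *: _); apply: eq_bigr => t _; rewrite cform_quad sp_act_elt.
Qed.

Lemma cform_sp_elt u v m n :
  cform (sp_act b (sp_elt u v) m) n = cform m (sp_act b (sp_elt (swap u) (swap v)) n).
Proof. by rewrite !sp_act_elt cform_quad. Qed.

(** The canonical tensor with one factor acting fermionically and the other by a Weyl operator; its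
    invariance makes [ospX] and [ospY] commute with sp. *)
Definition ospX m : M := \sum_t ext b (b t) (weyl b (dualb b t) m).
Definition ospY m : M := \sum_t ctr b (b t) (weyl b (dualb b t) m).

Fact ospX_linear : linear ospX.
Proof.
move=> a m n; rewrite /ospX scaler_sumr -big_split; apply: eq_bigr => t _ /=.
by rewrite [weyl _ _ _]linearP [ext _ _ _]linearP.
Qed.
Fact ospY_linear : linear ospY.
Proof.
move=> a m n; rewrite /ospY scaler_sumr -big_split; apply: eq_bigr => t _ /=.
by rewrite [weyl _ _ _]linearP [ctr _ _ _]linearP.
Qed.
HB.instance Definition _ := GRing.isLinear.Build K M M *:%R ospX ospX_linear.
HB.instance Definition _ := GRing.isLinear.Build K M M *:%R ospY ospY_linear.

(** The terms in which x hits one of the two factors cancel by [sp_contract]. *)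
Fact osp_invariant (Z Z' : V -> M -> M) : (forall u, linear (Z u)) ->
  (forall m, linear (Z ^~ m)) -> (forall u, linear (Z' u)) ->
  (forall m, linear (Z' ^~ m)) ->
  (forall x z m, sp_act b x (Z z m) = Z (sp_val x z) m + Z z (sp_act b x m)) ->
  (forall x z m, sp_act b x (Z' z m) = Z' (sp_val x z) m + Z' z (sp_act b x m)) ->
  forall x m, sp_act b x (\sum_t Z (b t) (Z' (dualb b t) m)) =
    \sum_t Z (b t) (Z' (dualb b t) (sp_act b x m)).
Proof.
move=> Zr Zl Z'r Z'l HZ HZ' x m; rewrite linear_sum /=.
under eq_bigr => t _ do rewrite HZ HZ' (lin_D (Zr _)).
rewrite 2!big_split /= addrA [X in X + _](_ : _ = 0) ?add0r //.
have := @sp_contract _ _ _ _ b _ (fun u v => Z v (Z' u m)) x.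
move=> /= ->; rewrite ?subrr // => u a z z'.
by rewrite Z'l Zr.
Qed.

Lemma sp_act_ospX x m : sp_act b x (ospX m) = ospX (sp_act b x m).
Proof.
apply: osp_invariant => [u a p q|p|u a p q|p|y z p|y z p].
- exact: linearP.
- exact: ext_linl.
- exact: linearP.
- exact: weyl_linl.
- exact: sp_act_ext two_neq0 _ _ _ _.
- exact: sp_act_weyl two_neq0 _ _ _ _.
Qed.

Lemma sp_act_ospY x m : sp_act b x (ospY m) = ospY (sp_act b x m).
Proof.
apply: osp_invariant => [u a p q|p|u a p q|p|y z p|y z p].
- exact: linearP.
- exact: ctr_linl.
- exact: linearP.
- exact: weyl_linl.
- exact: sp_act_ctr two_neq0 _ _ _ _.
- exact: sp_act_weyl two_neq0 _ _ _ _.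
Qed.

(** Hence the image of X is orthogonal to the kernel of Y, the fact behind irreducibility. *)
Lemma cform_ospX m n : cform (ospX m) n = cform m (ospY n).
Proof.
rewrite /ospX /ospY (lin_sum (cform_linl _)) (lin_sum (cform_linr _)).
rewrite [RHS](reindex_inj (can_inj (@conj_modeK l))) /=; apply: eq_bigr => t _.
rewrite cform_ext cform_weyl swapE swap_dualb (lin_N (weyl_linl _ _)).
by rewrite (lin_N (cform_linr _)) opprK ctr_weyl.
Qed.

(** Reordering a pair of terms leaves a Weyl commutator times a product of fermionic operators, and
    a fermionic anticommutator times a product of Weyl operators. The first kind contracts to minus
    the number operator, the second to the scalar l. *)
Lemma ospXY m : ospX (ospY m) + ospY (ospX m) =
  l%:R *: m - \sum_t cre t (ann t m).
Proof.
rewrite /ospX /ospY.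
under eq_bigr => s _ do rewrite [weyl _ _ (\sum_t _)]linear_sum [ext _ _ (\sum_t _)]linear_sum /=.
under [X in _ + X]eq_bigr => s _ do
  rewrite [weyl _ _ (\sum_t _)]linear_sum [ctr _ _ (\sum_t _)]linear_sum /=.
rewrite [X in _ + X]exchange_big /= -big_split /=.
have E s t : ext b (b s) (weyl b (dualb b s) (ctr b (b t) (weyl b (dualb b t) m)))
   + ctr b (b t) (weyl b (dualb b t) (ext b (b s) (weyl b (dualb b s) m)))
   = w (dualb b s) (dualb b t) *: ext b (b s) (ctr b (b t) m)
     + w (b t) (b s) *: weyl b (dualb b t) (weyl b (dualb b s) m).
  rewrite -ctr_weyl -[weyl b (dualb b t) (ext _ _ _)]ext_weyl ctr_ext.
  rewrite [weyl b (dualb b s) (weyl _ _ _)]weyl_comm linearD linearZ /= linearD linearZ /=.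
  by rewrite -!addrA [X in _ + X]addrC subrK.
under eq_bigr => s _ do rewrite -big_split /=.
under eq_bigr => s _ do under eq_bigr => t _ do rewrite E.
under eq_bigr => s _ do rewrite big_split /=.
rewrite big_split /= addrC; congr (_ + _); last first.
  rewrite -sumrN; apply: eq_bigr => s _.
  rewrite -(extE b) -[ann s m](ctrE b) -linearN /= -(lin_N (ctr_linl b m)).
  rewrite [- dualb b s](dualb_expand b) (lin_sum (ctr_linl b m)).
  rewrite [ext _ _ (\sum_t _)]linear_sum /=.
  apply: eq_bigr => t _; rewrite (lin_Z (ctr_linl b m)) [ext _ _ (_ *: _)]linearZ /=.
  by rewrite (lin_N (form_linr w _)) -form_skew.
have H t : \sum_s w (b s) (b t) *: weyl b (dualb b s) (weyl b (dualb b t) m)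
   = - weyl b (b t) (weyl b (dualb b t) m).
  rewrite -(lin_N (weyl_linl b _)) [- b t](basis_expand b) (lin_sum (weyl_linl b _)).
  apply: eq_bigr => s _; rewrite [RHS](lin_Z (weyl_linl b _)); congr (_ *: _).
  by rewrite (lin_N (form_linl w _)) -form_skew.
under eq_bigr => t _ do rewrite H.
have S : \sum_t weyl b (b t) (weyl b (dualb b t) m) =
    - \sum_t weyl b (dualb b t) (weyl b (b t) m).
  have := @dual_swap _ _ _ _ b _ (fun u v => weyl b u (weyl b v m)).
  apply=> [u a z z'|u]; last exact: weyl_linl.
  by rewrite weyl_linl linearP.
(* Since the canonical tensor is skew, twice the sum is a sum of commutators, each equal to 1, over
   the 2 l modes. *)
apply: (scalerI two_neq0); rewrite scaler_nat mulr2n {1}sumrN {1}S opprK -big_split /=.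
under eq_bigr => t _ do rewrite weyl_comm addrK dualb_form eqxx scale1r.
rewrite sumr_const card_prod card_bool card_ord scalerA -natrM scaler_nat.
by rewrite mulnC.
Qed.

Lemma mode_sum (W : nmodType) (F : mode l -> W) :
  \sum_t F t = \sum_(i < l) (F (true, i) + F (false, i)).
Proof.
rewrite (eq_bigr (fun t => F (t.1, t.2))); last by case.
rewrite -(pair_bigA _ (fun c i => F (c, i))) /= big_bool /= -big_split.
exact: eq_bigr.
Qed.

(** The operators [ext] anticommute, so only commutators of Weyl operators survive and the
    polynomial part disappears: X^2 is exterior multiplication by the invariant bivector. *)
Lemma ospX_sqr m : ospX (ospX m) = \sum_(i < l) cre (true, i) (cre (false, i) m).
Proof.
pose c s t := ext b (b s) (ext b (b t) (weyl b (dualb b s) (weyl b (dualb b t) m))).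
have E : ospX (ospX m) = \sum_s \sum_t c s t.
  rewrite /ospX; apply: eq_bigr => s _.
  rewrite [weyl _ _ (\sum_t _)]linear_sum [ext _ _ (\sum_t _)]linear_sum /=.
  apply: eq_bigr => t _.
  by rewrite /c -ext_weyl.
have cN s t : c s t + c t s = w (dualb b s) (dualb b t) *: ext b (b s) (ext b (b t) m).
  rewrite /c [ext b (b t) (ext b (b s) _)]ext_anti weyl_comm linearD linearZ /=.
  by rewrite linearD linearZ /= addrK.
apply: (scalerI two_neq0); rewrite scaler_nat mulr2n E {2}exchange_big -big_split /=.
under eq_bigr => s _ do rewrite -big_split /=.
under eq_bigr => s _ do under eq_bigr => t _ do rewrite cN.
have H s : \sum_t w (dualb b s) (dualb b t) *: ext b (b s) (ext b (b t) m)
    = - ext b (b s) (ext b (dualb b s) m).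
  rewrite -linearN /= -(lin_N (ext_linl b m)) [- dualb b s](dualb_expand b).
  rewrite (lin_sum (ext_linl b m)) [ext _ _ (\sum_t _)]linear_sum /=.
  apply: eq_bigr => t _.
  rewrite (lin_Z (ext_linl b m)) [ext _ _ (_ *: _)]linearZ /=; congr (_ *: _).
  by rewrite (lin_N (form_linr w _)) -form_skew.
under eq_bigr => s _ do rewrite H /dualb (lin_Z (ext_linl b m))
  [ext _ _ (_ *: _)]linearZ /= !extE.
rewrite mode_sum scaler_nat mulr2n -big_split; apply: eq_bigr => i _ /=.
rewrite expr1 expr0 scaleN1r scale1r opprK; congr (_ + _).
by apply/eqP; rewrite eqr_oppLR -addr_eq0 cre_anti.
Qed.

End ContravariantAction.

(** * Generation by a singular vector modulo the image of X *)

Section Generation.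
Variables (K : fieldType) (l : nat) (V : vectType K) (w : {skew_symmetric V}).
Hypothesis char0 : forall n, n.+1%:R != 0 :> K.
Variable b : symp_basis l w.
Local Notation M := (fock K l).
Implicit Types (m : M) (A : {set mode l}) (a : occ l) (i k : 'I_l).

Let two0 : 2%:R != 0 :> K := char0 1.
Local Notation e i := (true, i).
Local Notation f i := (false, i).

Lemma quad_ff i k m : quad b (b (f i)) (b (f k)) m =
  mulx i (mulx k m) - cre (f i) (ann (e k) m) - cre (f k) (ann (e i) m).
Proof.
rewrite /quad !extE !ctr_basis !weylE /bos /= mulxC -mulr2n -scaler_nat.
by rewrite scalerA mulVf // scale1r !linearZ /= /csign /= !scaleN1r addrC addrA.
Qed.

Lemma quad_ef k i m : i != k -> quad b (b (e k)) (b (f i)) m =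
  - cre (e k) (ann (e i) m) + cre (f i) (ann (f k) m) + mulx i (der k m).
Proof.
move=> ik; rewrite /quad !extE !ctr_basis !weylE /bos /=.
have -> : der k (mulx i m) = mulx i (der k m).
  by apply/eqP; rewrite -subr_eq0 der_mulx [k == i]eq_sym (negPf ik) scale0r.
rewrite -mulr2n -scaler_nat scalerA mulVf // scale1r !linearZ /= /csign /=.
by rewrite scaleN1r scale1r.
Qed.

Lemma ospXE m :
  ospX b m = \sum_i (- cre (e i) (mulx i m) + cre (f i) (der i m)).
Proof.
rewrite /ospX mode_sum; apply: eq_bigr => i _; rewrite !extE /dualb /=.
by rewrite expr1 expr0 scaleN1r scale1r (lin_N (weyl_linl _ _)) !weylE linearN.
Qed.

Lemma supported_ospX d p m :
  supported (grade d p) m -> supported (grade d.+1 (~~ p)) (ospX b m).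
Proof.
move=> mD; rewrite ospXE; apply: supported_sum => i; apply: supportedD.
  rewrite -scaleN1r; apply/supportedZ/supported_cre.
  by have := supported_bos (f i) mD.
by apply: supported_cre; have := supported_bos (e i) mD.
Qed.

Lemma cre_mulx t i m : cre t (mulx i m) = mulx i (cre t m).
Proof. exact: (cre_bos t (f i) m). Qed.

(* lowers the number of modes of type f by one, modulo the image of sp and of ospX *)
Lemma lower_identity k m : \sum_i cre (f k) (ann (e i) (cre (e i) m)) =
  - \sum_i quad b (b (f i)) (b (f k)) (cre (e i) m) - ospX b (mulx k m)
  - ospX b (ospX b (ann (e k) m)) + \sum_i mulx k (cre (f i) (der i m)).
Proof.
rewrite (ospX_sqr char0) ospXE -!sumrN -!big_split; apply: eq_bigr => i _ /=.
rewrite quad_ff -!cre_mulx.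
have -> : ann (e k) (cre (e i) m) = (k == i)%:R *: m - cre (e i) (ann (e k) m).
  apply/eqP; rewrite eq_sym subr_eq eq_sym; apply/eqP.
  exact: (ann_cre (e k) (e i) m).
have -> : der i (mulx k m) = (k == i)%:R *: m + mulx k (der i m).
  by rewrite eq_sym -der_mulx subrK.
rewrite [cre (f i) (_ - _)]linearB [cre (f i) (_ *: _ + _)]linearD /=.
have -> : cre (f i) (cre (e i) (ann (e k) m)) = - cre (e i) (cre (f i) (ann (e k) m)).
  by apply/eqP; rewrite -addr_eq0 cre_anti.
set x1 := cre (e i) (mulx i _); set x2 := cre (f i) (_ *: m); set x3 := cre (e i) _.
set x4 := cre (f k) _; set x5 := cre (f i) _.
rewrite !(opprD, opprK) !addrA [RHS](AC 9 (4*(1*5)*(2*6)*(3*8)*(7*9)))/=.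
by rewrite !addNr !subrr !addr0.
Qed.

Definition ep A : {set 'I_l} := [set i | e i \in A].
Definition fp A : {set 'I_l} := [set i | f i \in A].

Lemma card_parts A : #|A| = (#|ep A| + #|fp A|)%N.
Proof.
rewrite -!sum1_card [LHS]big_mkcond mode_sum big_split /=.
by congr (_ + _)%N; rewrite [RHS]big_mkcond; apply: eq_bigr => i _; rewrite inE.
Qed.

Lemma ep_remf k A : ep (A :\ f k) = ep A.
Proof. by apply/setP => i; rewrite !inE. Qed.
Lemma fp_adde k A : fp (e k |: A) = fp A.
Proof. by apply/setP => i; rewrite !inE. Qed.
Lemma fp_reme k A : fp (A :\ e k) = fp A.
Proof. by apply/setP => i; rewrite !inE. Qed.
Lemma fp_remf k A : fp (A :\ f k) = fp A :\ k.
Proof. by apply/setP => i; rewrite !inE. Qed.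
Lemma ep_adde k A : ep (e k |: A) = k |: ep A.
Proof. by apply/setP => i; rewrite !inE. Qed.
Lemma ep_reme k A : ep (A :\ e k) = ep A :\ k.
Proof. by apply/setP => i; rewrite !inE. Qed.

Lemma ann_cre_ket t A a :
  ann t (cre t (ket K A a)) = if t \in A then 0 else ket K A a.
Proof.
rewrite creU; case: ifPn => tA; first by rewrite linear0.
rewrite linearZ /= annU setU11 scalerA setU1K // -[fsign K t (_ |: _)]/((-1) ^+ _).
by rewrite -below_self setU1K // fsign_sqr scale1r.
Qed.

Lemma sum_ann_cre k A a :
  \sum_i cre (f k) (ann (e i) (cre (e i) (ket K A a))) =
  #|~: ep A|%:R *: cre (f k) (ket K A a).
Proof.
rewrite -sum1_card natr_sum scaler_suml [RHS]big_mkcond /=; apply: eq_bigr => i _.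
by rewrite ann_cre_ket !inE; case: ifP => _; rewrite ?linear0 ?scale1r.
Qed.

Definition initial n : {set 'I_l} := [set i : 'I_l | (i < n)%N].
Definition top n : {set mode l} := [set t : mode l | t.1 && (t.2 < n)%N].

Lemma card_initial n : (n <= l)%N -> #|initial n| = n.
Proof.
move=> nl; rewrite (_ : initial n = [set widen_ord nl i | i in 'I_n]).
  by rewrite card_imset ?card_ord // => i j /(congr1 val) /= /val_inj.
apply/setP => i; rewrite inE; apply/idP/imsetP => [iN|[j _ ->] /=]; last exact: ltn_ord.
by exists (Ordinal iN) => //; apply: val_inj.
Qed.

Lemma down_closed_initial (D : {set 'I_l}) :
  (forall i k, k \in D -> (i < k)%N -> i \in D) -> D = initial #|D|.
Proof.
move=> Dd; apply/eqP; rewrite eqEcard card_initial ?leqnn ?andbT; last first.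
  by rewrite -[X in (_ <= X)%N](card_ord l) max_card.
apply/subsetP => k kD; rewrite inE -(card_initial (ltn_ord k)) subset_leq_card //.
apply/subsetP => i; rewrite inE ltnS leq_eqVlt => /orP[/eqP/val_inj->//|].
exact: Dd.
Qed.

Lemma fp0_top A n : fp A = set0 -> ep A = initial n -> A = top n.
Proof.
move=> /setP fA /setP eA; apply/setP => -[[] i]; rewrite !inE /=.
  by have := eA i; rewrite !inE.
by have := fA i; rewrite !inE.
Qed.

(** In [grade_generation] Q becomes the sum of N_j and the image of X. Writing the source degree as
    d with [d.+1 = j] leaves [QX] without content at j = 0. *)
Variables (Q : M -> Prop) (j : nat) (p : bool).
Hypothesis Q_submod : op_submod (sp_act b) Q.
Hypothesis QX : forall d m, d.+1 = j -> supported (grade d (~~ p)) m -> Q (ospX b m).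

Lemma Q0 : Q 0. Proof. by case: Q_submod. Qed.
Lemma QD m n : Q m -> Q n -> Q (m + n).
Proof. by case: Q_submod => _ H _ Qm Qn; rewrite -[m]scale1r; apply: H. Qed.
Lemma QZ c m : Q m -> Q (c *: m).
Proof. by case: Q_submod => _ H _ Qm; rewrite -[_ *: _]addr0; apply: H => //; exact: Q0. Qed.
Lemma QN m : Q m -> Q (- m). Proof. by rewrite -scaleN1r; exact: QZ. Qed.
Lemma QB m n : Q m -> Q n -> Q (m - n). Proof. by move=> Qm /QN; apply: QD. Qed.
Lemma Qsum (F : 'I_l -> M) : (forall i, Q (F i)) -> Q (\sum_i F i).
Proof. by move=> QF; apply: big_ind => //; [exact: Q0 | exact: QD]. Qed.
Lemma Qquad u v m : Q m -> Q (quad b u v m).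
Proof. by case: Q_submod => _ _ H /H; rewrite -(sp_act_elt char0); apply. Qed.
Lemma QZ_inv c m : c != 0 -> Q (c *: m) -> Q m.
Proof. by move=> c0 /(QZ c^-1); rewrite scalerA mulVf // scale1r. Qed.

Lemma Q_cre (R : {set mode l} -> bool) t A a : (forall B, R B -> Q (ket K B a)) ->
  (t \notin A -> R (t |: A)) -> Q (cre t (ket K A a)).
Proof.
move=> QR RA; rewrite creU; case: ifPn => [_|/RA/QR]; first exact: Q0.
exact: QZ.
Qed.

Lemma Q_cre_ann s t A a : (forall B : {set mode l}, #|B| = j -> Q (ket K B a)) -> #|A| = j ->
  Q (cre s (ann t (ket K A a))).
Proof.
move=> QA Aj; rewrite annU; case: ifPn => tA; last by rewrite linear0; exact: Q0.
rewrite linearZ; apply: QZ; apply: (@Q_cre (fun B : {set mode l} => #|B| == j)) => [B /eqP/QA//|sA].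
by rewrite cardsU1 sA; have := cardsD1 t A; rewrite tA Aj => <-.
Qed.

(** The element of sp given by f_i and f_k multiplies by x_i x_k up to fermionic terms that keep the
    exterior degree and do not raise the polynomial degree. A monomial of degree at least 2 thus
    reduces to degree lower by two. *)
Lemma reduce_occ : (forall A a, (A, a) \in grade j p -> (occ_size a <= 1)%N ->
    Q (ket K A a)) ->
  forall A a, (A, a) \in grade j p -> Q (ket K A a).
Proof.
move=> Q1 A a; move En : (occ_size a) => n.
elim/ltn_ind: n A a En => n IHn A a En /[dup] Aa; rewrite gradeE => /andP[/eqP Aj /eqP ap].
have [n1|n1] := leqP n 1; first by apply: Q1 => //; rewrite En.
have pos (c : occ l) : (0 < occ_size c)%N -> exists i, (0 < c i)%N.
  by rewrite lt0n sum_nat_eq0 => /forallPn[i ci]; exists i; rewrite lt0n.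
have /pos[i ai] : (0 < occ_size a)%N by rewrite En ltnW.
have E1 := occ_size_decr ai.
have /pos[k ak] : (0 < occ_size (decr i a))%N by rewrite -ltnS E1 En.
have E2 := occ_size_decr ak; set c := decr k (decr i a) in E2.
have QC (B : {set mode l}) : #|B| = j -> Q (ket K B c).
  move=> Bj; apply: (IHn (occ_size c)) => //; first by rewrite -En -E1 -E2 ltnS leqW.
  by rewrite gradeE Bj eqxx -ap -E1 -E2 /= negbK eqxx.
have -> : ket K A a = quad b (b (f i)) (b (f k)) (ket K A c)
    + (cre (f i) (ann (e k) (ket K A c)) + cre (f k) (ann (e i) (ket K A c))).
  by rewrite quad_ff -[_ - _ - _]addrA -opprD subrK !mulxU /c !incr_decr.
apply: QD; first exact/Qquad/QC.
by apply: QD; apply: Q_cre_ann.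
Qed.

Definition level A : nat := \sum_(i in ep A) i.

Lemma lower_eq i k A a : i != k -> fp A = set0 ->
  cre (e k) (ann (e i) (ket K A a)) =
  mulx i (der k (ket K A a)) - quad b (b (e k)) (b (f i)) (ket K A a).
Proof.
move=> ik fA; have /setP/(_ k) := fA; rewrite !inE => fkA.
have -> : cre (e k) (ann (e i) (ket K A a)) = mulx i (der k (ket K A a))
    - (- cre (e k) (ann (e i) (ket K A a)) + mulx i (der k (ket K A a))).
  by rewrite opprD opprK addrC subrK.
by rewrite quad_ef // [ann (f k) _]annU fkA linear0 addr0.
Qed.

(** A set with e_k occupied and e_i empty for some i < k is reached from the set with e_i in place
    of e_k by the lowering element of e_k and f_i, whose Weyl part x_i d/dx_k vanishes because [a k]
    is zero. The sum of the occupied indices, [level], is smaller for the source. *)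
Lemma initial_reduction (a : occ l) : (forall k, a k != 0%N -> k.+1 = l) ->
  Q (ket K (top j) a) -> forall A, fp A = set0 -> #|A| = j ->
  (forall k, k \in ep A -> a k = 0%N) -> Q (ket K A a).
Proof.
move=> al Qtop A; move En : (level A) => n.
elim/ltn_ind: n A En => n IHn A En fA Aj aA.
have [[k [i [kA ik iA]]]|noex] := pselect (exists k i, [/\ k \in ep A, (i < k)%N & i \notin ep A]);
  last first.
  suff -> : A = top j by [].
  apply: fp0_top => //; rewrite [LHS]down_closed_initial.
    by have := card_parts A; rewrite fA cards0 addn0 Aj => <-.
  move=> i k kA ik; apply/negPn/negP => iA; apply: noex; by exists k, i.
have ekA : e k \in A by rewrite inE in kA.
have eiA : e i \notin A by rewrite inE in iA.
have ik' : i != k by rewrite -val_eqE /= neq_ltn ik.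
pose A' := e i |: (A :\ e k).
have eiA1 : e i \notin A :\ e k by rewrite !inE negb_and eiA orbT.
have fA' : fp A' = set0 by rewrite fp_adde fp_reme.
have QA' : Q (ket K A' a).
  apply: (IHn (level A')) => //.
  - rewrite -En /level ep_adde ep_reme big_setU1 /=; last by rewrite in_setD1 (negPf iA) andbF.
    by rewrite [X in (_ < X)%N](big_setD1 k) //= ltn_add2r.
  - by rewrite cardsU1 eiA1 -Aj (cardsD1 (e k) A) ekA.
  move=> k'; rewrite ep_adde ep_reme !inE => /orP[/eqP->|/andP[_ k'A]].
    (* As i < k, the index i is not the last one, the only one where [a] may be nonzero. *)
    apply/eqP/negPn/negP => /al il.
    by have := leq_ltn_trans ik (ltn_ord k); rewrite il ltnn.
  by apply: aA; rewrite inE.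
have : Q (cre (e k) (ann (e i) (ket K A' a))).
  rewrite lower_eq // derU aA // scale0r linear0 sub0r.
  exact/QN/Qquad.
rewrite annU setU11 linearZ /= creU (setU1K eiA1) setD11 setD1K // scalerA.
by apply: QZ_inv; rewrite mulf_neq0 ?fsign_neq0.
Qed.

(** This is [lower_identity] read modulo Q: its remaining terms are sp images of states with the f
    modes of A, in Q by hypothesis, and images of X. The coefficient counts the empty e modes, on
    which [ann] after [cre] is the identity. *)
Lemma f_reduction A a k : #|A|.+1 = j -> odd (occ_size a) = p ->
  (forall B, fp B = fp A -> #|B| = j -> Q (ket K B a)) ->
  Q (#|~: ep A|%:R *: cre (f k) (ket K A a)
     - \sum_i mulx k (cre (f i) (der i (ket K A a)))).
Proof.
move=> Aj ap QH; rewrite -sum_ann_cre lower_identity addrK.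
have supA : supported (grade #|A| p) (ket K A a).
  by apply: supported_ket; rewrite gradeE ap !eqxx.
apply: QB; first apply: QB.
- rewrite -sumrN; apply: Qsum => i; apply/QN/Qquad.
  apply: (@Q_cre (fun B => (fp B == fp A) && (#|B| == j))) => [B /andP[/eqP Bf /eqP Bj]|iA].
    exact: QH.
  by rewrite fp_adde cardsU1 iA eqxx -Aj /=.
- by apply: (QX Aj); have := supported_bos (f k) supA.
case: (posnP #|A|) => [A0|A0].
  rewrite A0 in supA; rewrite (supported_ann0 _ supA) !linear0; exact: Q0.
apply: (QX Aj); rewrite -(prednK A0); apply/supported_ospX/supported_ann.
by rewrite prednK.
Qed.

Definition occ0 : occ l := [ffun=> 0%N].

Lemma occ_size_eq0 a : occ_size a = 0%N -> a = occ0.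
Proof.
move=> /eqP; rewrite sum_nat_eq0 => /forallP a0; apply/ffunP => i; rewrite ffunE.
exact/eqP/a0.
Qed.

Lemma card_ep_lt A k : f k \in A -> (#|ep A| < #|A|)%N.
Proof.
by move=> kA; rewrite card_parts -addn1 leq_add2l card_gt0; apply/set0Pn; exists k; rewrite inE.
Qed.

Lemma card_epC A : (#|ep A| + #|~: ep A| = l)%N.
Proof. by rewrite cardsC card_ord. Qed.

Lemma der_occ0 i A : der i (ket K A occ0) = 0.
Proof. by rewrite derU ffunE scale0r. Qed.

Lemma generation_even : p = false -> (j <= l)%N -> Q (ket K (top j) occ0) ->
  forall m, supported (grade j p) m -> Q m.
Proof.
move=> p0 jl Qtop; apply: supported_ind; first exact: Q0.
  by case: Q_submod.
apply: reduce_occ => A a; rewrite gradeE p0 => /andP[/eqP Aj /eqP ap] a1.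
have /occ_size_eq0 -> : occ_size a = 0%N.
  by move: ap a1; case: (occ_size a) => [|[|]].
move En : #|fp A| => n; elim: n A En Aj => [|n IHn] A fA Aj.
  apply: initial_reduction => //; first by move=> k; rewrite ffunE.
    by apply/eqP; rewrite -cards_eq0 fA.
  by move=> k; rewrite ffunE.
have [k kA] : exists k, k \in fp A by apply/set0Pn; rewrite -card_gt0 fA.
have fkA : f k \in A by rewrite inE in kA.
have fpA' : #|fp (A :\ f k)| = n.
  by rewrite fp_remf; have := cardsD1 k (fp A); rewrite kA fA => -[].
have A'j : #|A :\ f k|.+1 = j by rewrite -Aj (cardsD1 (f k) A) fkA.
have occ00 : occ_size occ0 = 0%N by rewrite /occ_size big1 // => i _; rewrite ffunE.
have : Q (#|~: ep (A :\ f k)|%:R *: cre (f k) (ket K (A :\ f k) occ0)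
    - \sum_i mulx k (cre (f i) (der i (ket K (A :\ f k) occ0)))).
  by apply: f_reduction => // [|B Bf Bj]; rewrite ?occ00 ?p0 //; apply: IHn; rewrite ?Bf.
rewrite [X in _ - X]big1 ?subr0; last by move=> i _; rewrite der_occ0 !linear0.
rewrite ep_remf creU setD11 setD1K // scalerA; apply: QZ_inv.
rewrite mulf_neq0 ?fsign_neq0 //.
(* Some f mode is occupied, so fewer than j <= l of the e modes are, and the coefficient is
   positive. *)
have : (0 < #|~: ep A|)%N.
  by rewrite -(ltn_add2l #|ep A|) addn0 card_epC (leq_trans (card_ep_lt fkA)) ?Aj.
by case: #|_|.
Qed.

Definition occ1 k : occ l := incr k occ0.

Lemma occ_size_eq1 a : occ_size a = 1%N -> exists k, a = occ1 k.
Proof.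
move=> a1; have : occ_size a != 0%N by rewrite a1.
rewrite sum_nat_eq0 => /forallPn[k ak]; exists k; rewrite -lt0n in ak.
rewrite -(incr_decr ak); congr incr; apply: occ_size_eq0.
by have := occ_size_decr ak; rewrite a1 => -[].
Qed.

Lemma occ1_size k : occ_size (occ1 k) = 1%N.
Proof. by rewrite occ_size_incr /occ_size big1 // => i _; rewrite ffunE. Qed.

Lemma der_occ1 i k A : der i (ket K A (occ1 k)) = (i == k)%:R *: ket K A occ0.
Proof.
rewrite derU !ffunE add0n; case: eqP => [->|_]; last by rewrite !scale0r.
by congr (_ *: ket K _ _); apply/ffunP => n; rewrite !ffunE addnK.
Qed.

Lemma mulx_occ0 k A : mulx k (ket K A occ0) = ket K A (occ1 k).
Proof. exact: mulxU. Qed.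

Section Odd.
Variable n : 'I_l.
Hypothesis n_last : n.+1 = l.
Hypothesis p_odd : p = true.
Hypothesis j_lt : (j < l)%N.
Hypothesis Qtop : Q (ket K (top j) (occ1 n)).

Let Qlast A : fp A = set0 -> #|A| = j -> n \notin ep A -> Q (ket K A (occ1 n)).
Proof.
move=> fA Aj nA; apply: initial_reduction => // [k|k kA].
  by rewrite !ffunE add0n; case: (eqVneq k n) => [->|].
by rewrite !ffunE add0n; case: (eqVneq k n) => // kn; rewrite -kn kA in nA.
Qed.

Let move_last i A : i != n -> fp A = set0 -> ket K A (occ1 i) =
  quad b (b (e n)) (b (f i)) (ket K A (occ1 n))
  + cre (e n) (ann (e i) (ket K A (occ1 n))).
Proof.
by move=> ni fA; rewrite lower_eq // der_occ1 eqxx scale1r mulx_occ0 addrC subrK.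
Qed.

(** With e_n occupied, d/dx_n no longer kills the lowering terms of [initial_reduction]. Instead X
    is applied to the state without e_n and x_n: modulo Q all its nonzero terms agree, so it is a
    nonzero multiple of the wanted state. *)
Let Qfp0_last A : fp A = set0 -> #|A| = j -> Q (ket K A (occ1 n)).
Proof.
move=> fA Aj; have [nA|nA] := boolP (n \in ep A); last exact: Qlast.
have enA : e n \in A by rewrite inE in nA.
pose A0 := A :\ e n; have fA0 : fp A0 = set0 by rewrite fp_reme.
have A0j : #|A0|.+1 = j by rewrite -Aj (cardsD1 (e n) A) enA.
have nA0 : n \notin ep A0 by rewrite ep_reme setD11.
pose T := cre (e n) (ket K A0 (occ1 n)).
pose c i : K := ((i == n) || (i \notin ep A0))%:R.
(* Trading x_i for x_n by [move_last] costs an sp image of a state in which e_n is still empty,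
   hence an element of Q. *)
have E i : exists2 q, Q q & cre (e i) (mulx i (ket K A0 occ0)) = c i *: T + q.
  have [->|ni] := eqVneq i n.
    by exists 0; [exact: Q0 | rewrite /c eqxx scale1r addr0 mulx_occ0].
  have [iA|iA] := boolP (i \in ep A0).
    exists 0; first exact: Q0.
    rewrite /c (negPf ni) iA scale0r addr0 mulx_occ0 creU.
    by rewrite inE in iA; rewrite iA.
  have eiA : e i \notin A0 by rewrite inE in iA.
  have fA1 : fp (e i |: A0) = set0 by rewrite fp_adde.
  have A1j : #|e i |: A0| = j by rewrite cardsU1 eiA.
  exists (fsign K (e i) A0 *: quad b (b (e n)) (b (f i)) (ket K (e i |: A0) (occ1 n))).
    apply/QZ/Qquad/Qlast => //; rewrite ep_adde in_setU1 negb_or nA0.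
    by rewrite eq_sym ni.
  rewrite /c (negPf ni) iA scale1r mulx_occ0 creU (negPf eiA) move_last // scalerDr.
  rewrite addrC; congr (_ + _).
  have -> (x : M) : fsign K (e i) A0 *: cre (e n) x = cre (e n) (fsign K (e i) A0 *: x).
    by rewrite linearZ.
  congr (cre _ _).
  have := ann_cre_ket (e i) A0 (occ1 n); rewrite (negPf eiA) creU (negPf eiA) => <-.
  by rewrite linearZ.
have cE : Q ((\sum_i c i) *: T).
  have [q qE] := choice (fun i => let: ex_intro2 q Qq E := E i in ex_intro _ q (conj Qq E)).
  have -> : (\sum_i c i) *: T = - ospX b (ket K A0 occ0) - \sum_i q i.
    rewrite ospXE scaler_suml -sumrN -sumrB; apply: eq_bigr => i _.
    rewrite der_occ0 linear0 addr0 opprK; have [_ ->] := qE i.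
    by rewrite addrK.
  apply: QB; last by apply: Qsum => i; have [] := qE i.
  apply/QN/(QX A0j)/supported_ket; rewrite gradeE eqxx p_odd /=.
  by rewrite (_ : occ_size occ0 = 0%N) // /occ_size big1 // => i _; rewrite ffunE.
have : Q T.
  apply: QZ_inv cE; rewrite -natr_sum (bigD1 n) //= eqxx add1n; exact: char0.
by rewrite /T creU setD11 setD1K //; apply: QZ_inv; rewrite fsign_neq0.
Qed.

Let Qfp0 A i : fp A = set0 -> #|A| = j -> Q (ket K A (occ1 i)).
Proof.
move=> fA Aj; have [->|ni] := eqVneq i n; first exact: Qfp0_last.
rewrite move_last //; apply: QD; first exact/Qquad/Qfp0_last.
rewrite annU; case: ifPn => iA; last by rewrite linear0; exact: Q0.
rewrite linearZ; apply: QZ.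
apply: (@Q_cre (fun B => (fp B == set0) && (#|B| == j))) => [B /andP[/eqP Bf /eqP Bj]|nA].
  exact: Qfp0_last.
rewrite fp_adde fp_reme fA eqxx cardsU1 nA; apply/eqP.
by rewrite -Aj (cardsD1 (e i) A) iA.
Qed.

(** The correction sum in [f_reduction] now has one term, in which x and f have exchanged their
    indices. Combining the relation with its mirror image leaves the factor c^2 - 1, with c the
    number of empty e modes. *)
Lemma generation_odd m : supported (grade j p) m -> Q m.
Proof.
move: m; apply: supported_ind; first exact: Q0.
  by case: Q_submod.
apply: reduce_occ => A a; rewrite gradeE p_odd => /andP[/eqP Aj /eqP ap] a1.
have /occ_size_eq1[m ->] : occ_size a = 1%N.
  by move: ap a1; case: (occ_size a) => [|[|]].
move En : #|fp A| => r; elim: r A En Aj m => [|r IHr] A fA Aj m.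
  by apply: Qfp0 => //; apply/eqP; rewrite -cards_eq0 fA.
have [k kA] : exists k, k \in fp A by apply/set0Pn; rewrite -card_gt0 fA.
have fkA : f k \in A by rewrite inE in kA.
pose A0 := A :\ f k.
have fpA0 : #|fp A0| = r.
  by rewrite fp_remf; have := cardsD1 k (fp A); rewrite kA fA => -[].
have A0j : #|A0|.+1 = j by rewrite -Aj (cardsD1 (f k) A) fkA.
pose c : K := #|~: ep A0|%:R.
have step k1 k2 : Q (c *: mulx k1 (cre (f k2) (ket K A0 occ0))
    - mulx k2 (cre (f k1) (ket K A0 occ0))).
  have : Q (#|~: ep A0|%:R *: cre (f k2) (ket K A0 (occ1 k1))
      - \sum_i mulx k2 (cre (f i) (der i (ket K A0 (occ1 k1))))).
    apply: f_reduction => // [|B Bf Bj]; first by rewrite occ1_size p_odd.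
    by apply: IHr => //; rewrite Bf.
  rewrite (bigD1 k1) //= [\sum_(i < l | _) _]big1 ?addr0 => [|i ik]; last first.
    by rewrite der_occ1 (negPf ik) scale0r !linear0.
  by rewrite der_occ1 eqxx scale1r -mulx_occ0 cre_mulx.
have := QD (QZ c (step m k)) (step k m).
rewrite scalerBr addrA subrK scalerA -{2}[mulx m _]scale1r -scalerBl.
rewrite -cre_mulx mulx_occ0 creU setD11 setD1K // scalerA; apply: QZ_inv.
rewrite mulf_neq0 ?fsign_neq0 //.
(* Fewer than j of the e modes are occupied and j < l, so at least two are empty; c = 1 would be
   fatal. *)
have : (2 <= #|~: ep A0|)%N.
  rewrite -(leq_add2l #|ep A0|) card_epC addn2 ep_remf.
  by rewrite (leq_trans _ j_lt) // ltnS -Aj (card_ep_lt fkA).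
rewrite /c; case: #|_| => [|[|r']] // _.
rewrite (_ : _ - 1 = (r'.+1 * r'.+3)%:R) ?natrM ?mulf_neq0 ?char0 //.
by rewrite -!natr1; ring.
Qed.

End Odd.

End Generation.

Lemma eigenvectors_independent (K : fieldType) (M : lmodType K) (I : eqType)
  (T : M -> M) (lam : I -> K) (s : seq I) (F : I -> M) : linear T -> uniq s ->
  {in s &, injective lam} -> (forall i, i \in s -> T (F i) = lam i *: F i) ->
  \sum_(i <- s) F i = 0 -> forall i, i \in s -> F i = 0.
Proof.
move=> TL; elim: s F => // i s IHs F /= /andP[is_ us] lamI TF S0.
have tail k : k \in s -> F k = 0.
  move=> ks; have := IHs (fun k => (lam k - lam i) *: F k) us.
  have lamI' : {in s &, injective lam}.
    by move=> x y xs ys; apply: lamI; rewrite inE ?xs ?ys orbT.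
  move=> /(_ lamI') H; have /eqP : (lam k - lam i) *: F k = 0.
    apply: H => // [x xs|].
      by rewrite (lin_Z TL) TF ?inE ?xs ?orbT // !scalerA mulrC.
    have : T (\sum_(x <- i :: s) F x) - lam i *: \sum_(x <- i :: s) F x = 0.
      by rewrite S0 (lin_0 TL) scaler0 subrr.
    rewrite big_cons (lin_D TL) TF ?mem_head // scalerDr opprD addrACA subrr add0r.
    rewrite (lin_sum TL) scaler_sumr -sumrB => E; rewrite -[RHS]E; rewrite big_seq [RHS]big_seq.
    by apply: eq_bigr => x xs; rewrite TF ?inE ?xs ?orbT // scalerBl.
  rewrite scaler_eq0 subr_eq0 => /orP[/eqP ki|/eqP //].
  have ki' : k = i by apply: lamI ki; rewrite inE ?ks ?eqxx ?orbT.
  by rewrite -ki' ks in is_.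
move=> k; rewrite inE => /orP[/eqP->|/tail//].
by move: S0; rewrite big_cons big_seq big1 ?addr0.
Qed.

(** * Eigenvalues of Y X and the decomposition into layers *)

Section SpinorDecomposition.
Variables (K : fieldType) (l : nat) (V : vectType K) (w : {skew_symmetric V}).
Hypothesis char0 : forall n, n.+1%:R != 0 :> K.
Variable b : symp_basis l w.
Variable n : 'I_l.
Hypothesis n_last : n.+1 = l.
Local Notation M := (fock K l).
Implicit Types (m : M) (A : {set mode l}) (a : occ l) (j r k : nat) (p : bool).
Local Notation e i := (true, i).
Local Notation f i := (false, i).
Local Notation act := (sp_act b).
Local Notation X := (ospX b).
Local Notation Y := (ospY b).

Lemma supported_ext u d p m :
  supported (grade d p) m -> supported (grade d.+1 p) (ext b u m).
Proof. by move=> mD; apply: supported_sum => t; apply/supportedZ/supported_cre. Qed.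
Lemma supported_ctr u d p m :
  supported (grade d.+1 p) m -> supported (grade d p) (ctr b u m).
Proof. by move=> mD; apply: supported_sum => t; apply/supportedZ/supported_ann. Qed.
Lemma supported_ctr0 u p m : supported (grade 0 p) m -> ctr b u m = 0.
Proof.
by move=> mD; rewrite /ctr big1 // => t _; rewrite (supported_ann0 _ mD) scaler0.
Qed.
Lemma supported_weyl u d p m :
  supported (grade d p) m -> supported (grade d (~~ p)) (weyl b u m).
Proof. by move=> mD; apply: supported_sum => t; apply/supportedZ/supported_bos. Qed.

Lemma supported_quad u v d p m :
  supported (grade d p) m -> supported (grade d p) (quad b u v m).
Proof.
move=> mD; apply: supportedD.
  case: d mD => [|d] mD.
    by rewrite !(supported_ctr0 _ mD) !linear0 addr0; exact: supported0.
  by apply: supportedD; apply/supported_ext/supported_ctr.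
by apply/supportedZ/supportedD; rewrite -[p]negbK; do 2!apply: supported_weyl.
Qed.

Lemma supported_act x d p m :
  supported (grade d p) m -> supported (grade d p) (act x m).
Proof.
by move=> mD; apply/supportedZ/supported_sum => t; exact: supported_quad.
Qed.

Lemma number_op d p m : supported (grade d p) m ->
  \sum_t cre t (ann t m) = d%:R *: m.
Proof.
move: m; apply: supported_ind => [|k u v uD vD|A a].
- by rewrite scaler0 big1 // => t _; rewrite !linear0.
- rewrite scalerDr scalerA mulrC -scalerA -uD -vD scaler_sumr -big_split.
  by apply: eq_bigr => t _; rewrite [ann t _]linearP [cre t _]linearP.
rewrite gradeE => /andP[/eqP <- _]; rewrite -sum1_card natr_sum scaler_suml.
rewrite [RHS]big_mkcond; apply: eq_bigr => t _; rewrite annU; case: ifP => tA.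
  rewrite linearZ /= creU setD11 setD1K // scalerA {2}/fsign below_self.
  by rewrite fsign_sqr.
by rewrite linear0.
Qed.

Lemma ospYX d p m : supported (grade d p) m ->
  Y (X m) = (l%:R - d%:R) *: m - X (Y m).
Proof.
move=> mD; apply/eqP; rewrite eq_sym subr_eq eq_sym addrC; apply/eqP.
by rewrite (ospXY char0) (number_op mD) scalerBl.
Qed.

Definition hwv j p : M := ket K (top l j) (if p then occ1 n else occ0 l).
Definition hwm j p : {pred M} := cyclic_sub act (hwv j p).
(** In the odd case j = l is excluded: Y does not annihilate e_1 ... e_l x_l. *)
Definition admissible j p := if p then (j < l)%N else (j <= l)%N.

Lemma occ0_size : occ_size (occ0 l) = 0%N.
Proof. by rewrite /occ_size big1 // => i _; rewrite ffunE. Qed.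

Lemma ep_top j : ep (top l j) = initial l j.
Proof. by apply/setP => i; rewrite !inE. Qed.
Lemma fp_top j : fp (top l j) = set0.
Proof. by apply/setP => i; rewrite !inE. Qed.

Lemma admissible_le j p : admissible j p -> (j <= l)%N.
Proof. by case: p => // /ltnW. Qed.

Lemma hwv_grade j p : admissible j p -> supported (grade j p) (hwv j p).
Proof.
move=> jp; apply: supported_ket; rewrite gradeE card_parts ep_top fp_top cards0 addn0.
rewrite card_initial ?(admissible_le jp) // eqxx /=.
by case: p {jp}; rewrite ?occ1_size ?occ0_size.
Qed.

Lemma hwm_act j p x m : m \in hwm j p -> act x m \in hwm j p.
Proof. exact: gen_submod_op. Qed.

Lemma hwm_ind j p (S : M -> Prop) : op_submod act S -> S (hwv j p) ->
  forall m, m \in hwm j p -> S m.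
Proof. by move=> SS Sv; apply: (gen_submod_ind SS) => m ->. Qed.

Lemma hwm_grade j p m : admissible j p -> m \in hwm j p -> supported (grade j p) m.
Proof.
move=> jp; move: m; apply: hwm_ind; last exact: hwv_grade.
split=> [|a u v|x u]; [exact: supported0 | exact: supported_lin | exact: supported_act].
Qed.

Lemma ospYE m : Y m = \sum_i (- ann (f i) (mulx i m) - ann (e i) (der i m)).
Proof.
rewrite /ospY mode_sum; apply: eq_bigr => i _; rewrite !ctr_basis /dualb /=.
rewrite expr1 expr0 scaleN1r scale1r (lin_N (weyl_linl _ _)) !weylE linearN.
by rewrite /csign /= scale1r scaleN1r.
Qed.

Lemma ospY_hwv j p : admissible j p -> Y (hwv j p) = 0.
Proof.
move=> jp; rewrite ospYE big1 // => i _; rewrite mulxU annU inE /= oppr0 sub0r.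
apply/eqP; rewrite oppr_eq0 derU linearZ /= annU inE /=.
case: p jp => [/= jl|_]; last by rewrite ffunE scale0r.
case: ifPn => ij; last by rewrite scaler0.
rewrite !ffunE add0n; case: (eqVneq i n) => [ni|_]; last by rewrite scale0r.
by have := leq_ltn_trans ij jl; rewrite ni n_last ltnn.
Qed.

Lemma ospY_hwm j p m : admissible j p -> m \in hwm j p -> Y m = 0.
Proof.
move=> jp; move: m; apply: hwm_ind; last exact: ospY_hwv.
split=> [|a u v u0 v0|x u u0]; first exact: linear0.
  by rewrite linearP /= u0 v0 scaler0 addr0.
by rewrite -(sp_act_ospY char0) u0 linear0.
Qed.

(** The sum of N_j and the image of X is stable under sp, so the generation lemmas apply to it. The
    match on j expresses that there is no exterior degree below 0. *)
Lemma grade_generation j p m : admissible j p -> supported (grade j p) m ->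
  exists u m', [/\ u \in hwm j p,
    if j is d.+1 then supported (grade d (~~ p)) m' else m' = 0 & m = u + X m'].
Proof.
move=> jp; pose Q m := exists u m', [/\ u \in hwm j p,
    if j is d.+1 then supported (grade d (~~ p)) m' else m' = 0 & m = u + X m'].
have Qsub : op_submod act Q.
  split=> [|a u v [u1 [u2 [u1P u2P ->]]] [v1 [v2 [v1P v2P ->]]]|x u [u1 [u2 [u1P u2P ->]]]].
  - exists 0, 0; split; rewrite ?rpred0 ?linear0 ?addr0 //.
    by case: (j) => // d; exact: supported0.
  - exists (a *: u1 + v1), (a *: u2 + v2); split; first by rewrite rpredD ?rpredZ.
      case: (j) u2P v2P => [->->|d]; first by rewrite scaler0 addr0.
      exact: supported_lin.
    by rewrite scalerDr [X _ in RHS]linearP addrACA.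
  - exists (act x u1), (act x u2); split; first exact: hwm_act.
      by case: (j) u2P => [->|d]; [exact: linear0 | exact: supported_act].
    by rewrite linearD /= (sp_act_ospX char0).
have QX d m' : d.+1 = j -> supported (grade d (~~ p)) m' -> Q (X m').
  by move=> dj m'P; exists 0, m'; rewrite rpred0 add0r -dj.
have Qv : Q (hwv j p).
  exists (hwv j p), 0; split; rewrite ?linear0 ?addr0 ?mem_gen_submod //.
  by case: (j) => // d; exact: supported0.
suff : forall m, supported (grade j p) m -> Q m by exact.
move: Q Qsub QX Qv; case: p jp => jp Q Qsub QX Qv {}m.
  exact: (generation_odd char0 Qsub QX n_last erefl jp Qv).
exact: (generation_even char0 Qsub QX erefl jp Qv).
Qed.

(** N is orthogonal to N_j, because adjoints of sp lie in sp, and to the image of X, because Y kills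
    N_j. By [grade_generation] it is orthogonal to its whole graded part, and the other kets have no
    coefficient in it. *)
Lemma hwm_faithful j p (N : M -> Prop) : admissible j p -> op_submod act N ->
  (forall m, N m -> m \in hwm j p) -> (forall m, N m -> cform (hwv j p) m = 0) ->
  forall m, N m -> m = 0.
Proof.
move=> jp Nsub Nh Nv m Nm; apply: (cform_nondeg char0) => q.
have orth u : u \in hwm j p -> forall m', N m' -> cform u m' = 0.
  move: u; apply: hwm_ind => //; split=> [m' _|a u v u0 v0 m' Nm'|x u u0 m' Nm'].
  - exact: (lin_0 (cform_linl _)).
  - by rewrite cform_linl u0 // v0 // scaler0 addr0.
  - have [x' ->] := cform_sp_act char0 b x; apply: u0.
    by have [_ _] := Nsub; apply.
move: q; apply: ket_ext => [a u v|a u v|A a]; first exact: cform_linl.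
  by rewrite scaler0 addr0.
have [Aa|Aa] := boolP ((A, a) \in grade j p).
  have [u [m' [uP _ ->]]] := grade_generation jp (supported_ket K Aa).
  rewrite (lin_D (cform_linl _)) (orth u uP m Nm) add0r cform_ospX.
  by rewrite (ospY_hwm jp (Nh _ Nm)) (lin_0 (cform_linr _)).
by rewrite cformE (hwm_grade jp (Nh _ Nm) Aa) mulr0.
Qed.

(** The scalar of Y X on X^k N_j. It solves c_0 = l - j and c_(k+1) = l - (j + k + 1) - c_k, the
    recursion imposed by X Y + Y X = l - d; the sign change at each step causes the two cases. *)
Definition ycoef j k : K :=
  if odd k then - k./2.+1%:R else l%:R - (j + k./2)%:R.

Lemma ycoefS j k : ycoef j k.+1 = l%:R - (j + k.+1)%:R - ycoef j k.
Proof.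
rewrite /ycoef /= uphalf_half; case: (boolP (odd k)) => ok /=.
  rewrite -{2}[k]odd_double_half ok opprK add1n addSn -addnn !natrD -!natr1 !natrD; ring.
rewrite -{2}[k]odd_double_half (negPf ok) !add0n -addnn -!natr1 !natrD -!natr1 !natrD; ring.
Qed.

Lemma iter_ospX_grade j p k m : supported (grade j p) m ->
  supported (grade (k + j) (odd k (+) p)) (iter k X m).
Proof.
by move=> mD; elim: k => //= k IHk; rewrite addNb; exact: supported_ospX.
Qed.

Lemma ospY_iter j p k m : admissible j p -> m \in hwm j p ->
  Y (iter k.+1 X m) = ycoef j k *: iter k X m.
Proof.
move=> jp mh; have mD := hwm_grade jp mh; elim: k => [|k IHk].
  by rewrite /= (ospYX mD) (ospY_hwm jp mh) linear0 subr0 /ycoef /= addn0.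
rewrite [LHS](ospYX (iter_ospX_grade (k := k.+1) mD)) IHk linearZ /= -scalerBl.
by rewrite ycoefS addnC.
Qed.

Lemma ycoef_neq0 j k : (j + k < l)%N -> ycoef j k != 0.
Proof.
move=> jk; rewrite /ycoef; case: ifP => _; first by rewrite oppr_eq0.
have jk2 : (j + k./2 < l)%N by apply: leq_ltn_trans jk; rewrite leq_add2l; lia.
by rewrite -natrB ?(ltnW jk2) // -(prednK (_ : 0 < l - (j + k./2)))%N ?subn_gt0.
Qed.

Lemma iter_ospX_inj j p k m : admissible j p -> (j + k <= l)%N -> m \in hwm j p ->
  iter k X m = 0 -> m = 0.
Proof.
move=> jp; elim: k => // k IHk jk mh Xm; apply: IHk => //.
  by apply: leq_trans jk; rewrite leq_add2l.
apply/eqP; have := ospY_iter k jp mh; rewrite Xm linear0 => /esym/eqP.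
by rewrite scaler_eq0 (negPf (ycoef_neq0 _)) //; move: jk; rewrite addnS.
Qed.

Lemma natr_inj_char0 : injective (fun k : nat => k%:R : K).
Proof.
move=> x y; wlog xy : x y / (x <= y)%N => [H|/esym/eqP].
  by case: (leqP x y) => [/H//|/ltnW/H H' /esym/H'].
rewrite -subr_eq0 -natrB // => yx; apply/eqP; rewrite eqn_leq xy /= -subn_eq0.
by move: yx; case: (y - x)%N => // d; rewrite (negPf (char0 d)).
Qed.

(** The scalar is l - (r + j)/2, which is nonnegative, when r - j is even, and -(r - j + 1)/2, which
    is negative, when it is odd; each is strictly monotone in j. *)
Lemma ycoef_inj r : (r <= l)%N -> {in iota 0 r.+1 &, injective (fun j => ycoef j (r - j))}.
Proof.
move=> rl j j'; rewrite !mem_iota /= !add0n !ltnS => jr j'r.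
have nat_neg x y : x%:R = - y.+1%:R :> K -> False.
  by move/eqP; rewrite -addr_eq0 -natrD addnS (negPf (char0 _)).
rewrite /ycoef; case: ifP => o1; case: ifP => o2 /eqP.
- by rewrite eqr_opp => /eqP/natr_inj_char0; lia.
- by rewrite -natrB; [rewrite eq_sym => /eqP/nat_neg | lia].
- by rewrite -natrB; [move=> /eqP/nat_neg | lia].
- by rewrite -!natrB; [move=> /eqP/natr_inj_char0; lia | lia | lia].
Qed.

Definition layer r j m :=
  exists2 u, u \in hwm j (odd (r - j)) & m = iter (r - j) X u.
(** Indexing by a list lets the summands come in the order of the theorem; only the list up to
    permutation matters, by [layers_perm]. *)
Definition layers r (s : seq nat) m := exists F : nat -> M,
  (forall j, j \in s -> layer r j (F j)) /\ m = \sum_(j <- s) F j.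

(** Iterates [grade_generation] down the exterior degree; each X flips the polynomial parity, which
    accounts for the shift by [odd (r - j)]. *)
Lemma grade_sum r p m : admissible r p -> supported (grade r p) m ->
  exists F : nat -> M, (forall j, (j <= r)%N -> F j \in hwm j (odd (r - j) (+) p)) /\
    m = \sum_(0 <= j < r.+1) iter (r - j) X (F j).
Proof.
elim: r p m => [|r IHr] p m rp /(grade_generation rp) [u [m' [uP m'P ->]]].
  exists (fun=> u); split=> [j|]; first by rewrite leqn0 => /eqP->; rewrite subnn.
  by rewrite big_nat1 m'P linear0 addr0.
have [|F [FP ->]] := IHr (~~ p) m' _ m'P.
  by move: rp; rewrite /admissible; case: p {m'P uP} => //= /ltnW/ltnW.
exists (fun j => if j == r.+1 then u else F j); split=> [j jr|].
  case: eqP => [->|/eqP jr']; first by rewrite subnn.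
  have {jr'}jr : (j <= r)%N by rewrite -ltnS ltn_neqAle jr' jr.
  by rewrite subSn //= addNb -addbN; exact: FP.
rewrite [RHS]big_nat_recr //= eqxx subnn addrC; congr (_ + _).
rewrite linear_sum /= !big_nat; apply: eq_bigr => j /andP[_ jr].
by rewrite ltn_eqF // subSn.
Qed.

Lemma layer_eigen r j m : (j <= r)%N -> (r <= l)%N -> layer r j m ->
  Y (X m) = ycoef j (r - j) *: m.
Proof.
move=> jr rl [u uP ->]; apply: (ospY_iter _ _ uP); rewrite /admissible.
(* An odd difference is nonzero, so j < r <= l in the odd case. *)
by case: ifP => [o|_]; [case: (ltngtP j r) jr o => // [|->]; rewrite ?subnn //; lia | lia].
Qed.

Lemma layer0 r j : layer r j 0.
Proof.
by exists 0; [exact: rpred0 | elim: (r - j)%N => //= k <-; rewrite linear0].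
Qed.

Lemma iter_ospX_linear k : linear (iter k X).
Proof. by elim: k => // k IHk a u v; rewrite !iterS IHk linearP. Qed.

Lemma layerB r j m m' : layer r j m -> layer r j m' -> layer r j (m - m').
Proof.
move=> [u uP ->] [v vP ->]; exists (u - v); first exact: rpredB.
by rewrite (lin_B (iter_ospX_linear _)).
Qed.

Lemma layer_independent r (s : seq nat) (F : nat -> M) : (r <= l)%N -> uniq s ->
  {subset s <= iota 0 r.+1} -> (forall j, j \in s -> layer r j (F j)) ->
  \sum_(j <- s) F j = 0 -> forall j, j \in s -> F j = 0.
Proof.
move=> rl us sr FP; apply: (@eigenvectors_independent _ _ _ (Y \o X)
  (fun j => ycoef j (r - j))) => // [a u v|j j' /sr js /sr j's|j js] /=.
- by rewrite [X _]linearP [Y _]linearP.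
- exact: ycoef_inj.
- by apply: layer_eigen (FP _ js) => //; have := sr _ js; rewrite mem_iota.
Qed.

Lemma layers_perm r s s' m : perm_eq s s' -> layers r s m -> layers r s' m.
Proof.
move=> ss' [F [FP ->]]; exists F; split=> [j|]; first by rewrite -(perm_mem ss'); exact: FP.
exact: perm_big.
Qed.

Lemma layers_grade r m : (r <= l)%N ->
  layers r (iota 0 r.+1) m <-> supported (grade r false) m.
Proof.
move=> rl; split=> [[F [FP ->]]|mD].
  rewrite big_seq; apply: (big_ind (supported (grade r false))) => [||j js].
  - exact: supported0.
  - exact: supportedD.
  have [u uP ->] := FP j js; move: js; rewrite mem_iota add0n ltnS /= => jr.
  have -> : false = odd (r - j) (+) odd (r - j) by rewrite addbb.
  rewrite -{1}(subnK jr); apply: iter_ospX_grade; apply: hwm_grade uP.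
  rewrite /admissible; case: ifP => [o|_]; last exact: leq_trans jr rl.
  by case: (ltngtP j r) jr o => // [jr _ _|->]; [exact: leq_trans jr rl | rewrite subnn].
have [F [FP ->]] := grade_sum (p := false) rl mD.
exists (fun j => iter (r - j) X (F j)); split=> // j.
rewrite mem_iota add0n ltnS /= => jr; exists (F j) => //.
by have := FP j jr; rewrite addbF.
Qed.

Section Embed.
Variable r : nat.
Hypothesis r_le : (r <= l)%N.
Implicit Types N : lieModType (sp w).

Lemma embeds_single N j : embeds act N (layer r j) -> embeds act N (layers r [:: j]).
Proof.
apply: embeds_ext => m; split=> [mc|[F [FP ->]]]; last by rewrite big_seq1; apply: FP; rewrite inE.
by exists (fun=> m); split=> [k|]; [rewrite inE => /eqP-> | rewrite big_seq1].
Qed.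

Lemma embeds_cat N1 N2 s1 s2 : uniq (s1 ++ s2) -> {subset s1 ++ s2 <= iota 0 r.+1} ->
  embeds act N1 (layers r s1) -> embeds act N2 (layers r s2) ->
  embeds act (N1 ⊕ N2) (layers r (s1 ++ s2)).
Proof.
move=> us sr e1 e2.
have disj j : j \in s1 -> j \in s2 -> False.
  by move: us; rewrite cat_uniq => /and3P[_ /hasPn H _] j1 /H; rewrite j1.
have glue (F1 F2 : nat -> M) : \sum_(j <- s1 ++ s2) (if j \in s1 then F1 j else F2 j)
    = \sum_(j <- s1) F1 j + \sum_(j <- s2) F2 j.
  rewrite big_cat /=; congr (_ + _); rewrite big_seq [RHS]big_seq; apply: eq_bigr => j js.
    by rewrite js.
  by case: ifP => // /disj/(_ js).
have := embeds_dsum (fun x => @linearP _ _ _ _ (sp_act b x)) e1 e2.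
move=> H; apply: embeds_ext (H _) => [m|m [F1 [F1P ->]] [F2 [F2P E]]].
  split=> [[u [v [[F1 [F1P ->]] [F2 [F2P ->]] ->]]]|[F [FP ->]]].
    exists (fun j => if j \in s1 then F1 j else F2 j); split=> // j.
    by rewrite mem_cat; case: ifP => [/F1P//|_ /= /F2P].
  exists (\sum_(j <- s1) F j), (\sum_(j <- s2) F j); split; last by rewrite big_cat.
  - by exists F; split=> // j js; apply: FP; rewrite mem_cat js.
  - by exists F; split=> // j js; apply: FP; rewrite mem_cat js orbT.
(* Equality of a sum over s1 with a sum over s2 becomes a vanishing sum over their concatenation, to
   which independence applies. *)
pose F j := if j \in s1 then F1 j else - F2 j.
have F0 : forall j, j \in s1 ++ s2 -> F j = 0.
  apply: (layer_independent r_le us sr) => [j|].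
    rewrite mem_cat /F; case: ifP => [/F1P//|_ /= /F2P FC].
    by rewrite -sub0r; apply: layerB => //; exact: layer0.
  by rewrite glue sumrN E subrr.
rewrite big_seq big1 // => j js; have := F0 j; rewrite mem_cat js /F js; exact.
Qed.

Lemma embeds_bigsum (s : seq nat) (g : nat -> nat) (N : nat -> lieModType (sp w)) :
  uniq (map g s) -> {subset map g s <= iota 0 r.+1} ->
  (forall k, k \in s -> embeds act (N k) (layer r (g k))) ->
  embeds act (\big[@lie_dsum _ _ / lie_dsum0]_(k <- s) N k) (layers r (map g s)).
Proof.
elim: s => [|k s IHs] us sr Ne.
  rewrite big_nil; apply: embeds_ext (embeds0 _) => [m|].
    split=> [->|[F [_ ->]]]; last by rewrite big_nil.
    by exists (fun=> 0); rewrite big_nil.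
  by split=> // [a p q -> ->|x p ->]; rewrite ?scaler0 ?addr0 ?linear0.
rewrite big_cons; apply: (embeds_cat (s1 := [:: g k])) => //.
  by apply/embeds_single/Ne; exact: mem_head.
apply: IHs => [|j js|k' k's]; first by case/andP: us.
  by apply: sr; rewrite inE js orbT.
by apply: Ne; rewrite inE k's orbT.
Qed.

End Embed.

End SpinorDecomposition.

(** * Weights and roots of sp *)

Section WeightBasis.
Variables (K : fieldType) (l : nat) (V : vectType K) (w : {skew_symmetric V}).
Variables (h : {vspace sp w}) (epsilon : 'I_l -> hdual h) (H : 'I_l -> subvs_of h).
Hypothesis char0 : forall n, n.+1%:R != 0 :> K.
Hypothesis w_nondeg : forall u, (forall v, w u v = 0) -> u = 0.
Hypothesis dimV : \dim {: V} = (2 * l)%N.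
Hypothesis epsilonH : forall i k, epsilon i (H k) = (i == k)%:R.
Implicit Types (s : subvs_of h) (t : mode l).

Definition mode_wt t : hdual h := if t.1 then epsilon t.2 else - epsilon t.2.

Hypothesis weights_V : forall t, is_weight (natural w) (mode_wt t).

Lemma mode_wtE t s : mode_wt t s = if t.1 then epsilon t.2 s else - epsilon t.2 s.
Proof. by rewrite /mode_wt; case: t.1; rewrite ?lfunE. Qed.

Lemma mode_wt_conj t : mode_wt (conj_mode t) = - mode_wt t.
Proof. by rewrite /mode_wt /=; case: t.1; rewrite ?opprK. Qed.

(** On this element the weights of V take the 2 l distinct values from -l to l without 0. It
    separates these weights, and later measures the height of root vectors by positive integers. *)
Definition rho_vee : subvs_of h := \sum_(k < l) (l - k)%:R *: H k.

Lemma epsilon_rho i : epsilon i rho_vee = (l - i)%:R.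
Proof.
rewrite linear_sum /= (bigD1 i) //= big1 => [|k ki]; rewrite linearZ /= epsilonH.
  by rewrite eqxx addr0 [_ *: _]mulr1.
by rewrite eq_sym (negPf ki) scaler0.
Qed.

Lemma mode_wt_rho_inj : injective (fun t => mode_wt t rho_vee : K).
Proof.
have pos (i : 'I_l) : (0 < l - i)%N by rewrite subn_gt0.
have inj (i k : 'I_l) : (l - i)%:R = (l - k)%:R :> K -> i = k.
  move/(natr_inj_char0 char0) => ik; apply: val_inj => /=.
  by have := ltn_ord i; have := ltn_ord k; lia.
have sgn (i k : 'I_l) : (l - i)%:R = - (l - k)%:R :> K -> False.
  move/eqP; rewrite -addr_eq0 -natrD; have := pos i.
  by case: (l - i)%N => // d _; rewrite addSn (negPf (char0 _)).
move=> [[] i] [[] k] /=; rewrite !mode_wtE /= !epsilon_rho.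
- by move/inj->.
- by move/sgn.
- by move/esym/sgn.
- by move/oppr_inj/inj->.
Qed.

Lemma wt_form0 (mu nu : hdual h) s u v : sp_val (vsval s) u = (mu s : K) *: u ->
  sp_val (vsval s) v = (nu s : K) *: v -> (mu s : K) + nu s != 0 -> w u v = 0.
Proof.
move=> su sv munu; have := sp_valP (vsval s) u v.
rewrite su sv (lin_Z (form_linl w v)) (lin_Z (form_linr w u)) => /eqP.
by rewrite -addr_eq0 /GRing.scale /= -mulrDl mulf_eq0 (negPf munu) => /eqP.
Qed.

(** Weight vectors for the 2 l weights are independent since [rho_vee] has distinct eigenvalues on
    them, so they form a basis by dimension. Only opposite weights pair nontrivially, nondegeneracy
    makes these pairings nonzero, and rescaling the vectors of weight -epsilon_i makes them 1. *)
Lemma weight_basis : exists b : symp_basis l w,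
  forall s t, sp_val (vsval s) (b t) = (mode_wt t s : K) *: b t.
Proof.
have ex t : exists u : V,
    u != 0 /\ forall s, sp_val (vsval s) u = (mode_wt t s : K) *: u.
  by have [u u0 uw] := weights_V t; exists u.
have [v vP] := choice ex.
pose X := [tuple v (enum_val i) | i < #|mode l|].
have freeX : free X.
  apply/freeP => c; under eq_bigr => i _ do rewrite -tnth_nth tnth_mktuple.
  move=> c0 i; have := @eigenvectors_independent _ _ _ (sp_val (vsval rho_vee))
    (fun i : 'I_#|mode l| => mode_wt (enum_val i) rho_vee) (index_enum _)
    (fun i => c i *: v (enum_val i)).
  move=> /(_ _ _ _ _ c0 i (mem_index_enum _)) E; apply/eqP.
  have /eqP : c i *: v (enum_val i) = 0.
    apply: E => [a p q||x y _ _ /mode_wt_rho_inj /enum_val_inj //|k _].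
    - exact: linearP.
    - exact: index_enum_uniq.
    - by rewrite linearZ /=; have [_ ->] := vP (enum_val k); rewrite !scalerA mulrC.
  by rewrite scaler_eq0; have [/negPf-> _] := vP (enum_val i); rewrite orbF.
have basisX : basis_of {: V} X.
  by rewrite basisEfree freeX subvf size_tuple dimV card_prod card_bool card_ord /=.
have span u : exists c : mode l -> K, u = \sum_t c t *: v t.
  exists (fun t => coord X (enum_rank t) u).
  rewrite {1}(coord_basis basisX (memvf u)).
  under eq_bigr => i _ do rewrite -tnth_nth tnth_mktuple.
  rewrite (reindex enum_rank) /=; last first.
    by exists enum_val => t _; rewrite ?enum_rankK ?enum_valK.
  by apply: eq_bigr => t _; rewrite enum_rankK.
have orth (s t : mode l) : t != conj_mode s -> w (v s) (v t) = 0.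
  move=> st; have [_ /(_ rho_vee) sw] := vP s; have [_ /(_ rho_vee) tw] := vP t.
  apply: (wt_form0 sw tw); apply: contraNneq st => E; apply/eqP/mode_wt_rho_inj.
  by rewrite mode_wt_conj lfunE /=; apply/eqP; rewrite -addr_eq0 addrC E.
have form_sum u (c : mode l -> K) t : u = \sum_t c t *: v t ->
    w (v (conj_mode t)) u = c t * w (v (conj_mode t)) (v t).
  move=> ->; rewrite (lin_sum (form_linr w _)) (bigD1 t) //= big1 ?addr0.
    by rewrite (lin_Z (form_linr w _)).
  by move=> k kt; rewrite (lin_Z (form_linr w _)) orth ?scaler0 // conj_modeK.
pose a i : K := w (v (true, i)) (v (false, i)).
have a0 i : a i != 0.
  apply/eqP => ai; have [/eqP v0 _] := vP (true, i); apply: v0; apply: w_nondeg => u.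
  have [c uE] := span u; rewrite (form_sum u c (false, i) uE).
  by rewrite -/(a i) ai mulr0.
pose b t : V := if t.1 then v t else (a t.2)^-1 *: v t.
have bform (s t : mode l) : w (b s) (b t) = sympl K s t.
  rewrite /sympl; case: (eqVneq s.2 t.2) => st; last first.
    rewrite /b; have E : w (v s) (v t) = 0.
      by apply: orth; apply: contraNneq st => ->.
    by case: s.1; case: t.1; rewrite ?(lin_Z (form_linl w _)) ?(lin_Z (form_linr w _)) E ?scaler0.
  case: s t st => [[] i] [[] k] /= <-; rewrite /b /= ?subrr.
  - by apply: orth.
  - by rewrite (lin_Z (form_linr w _)) -/(a i) subr0 [_ *: _]mulVf.
  - rewrite (lin_Z (form_linl w _)) form_skew -/(a i) sub0r scalerN.
    by rewrite [_ *: _]mulVf.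
  - rewrite (lin_Z (form_linl w _)) (lin_Z (form_linr w _)) orth ?scaler0 //.
have bspan u : u = \sum_(t : mode l) ((-1) ^+ t.1 * w (b (~~ t.1, t.2)) u) *: b t.
  have [c uE] := span u; rewrite {1}uE; apply: eq_bigr => t _; rewrite /b.
  case: t => [[] i] /=.
    rewrite (lin_Z (form_linl w _)) (form_sum u c (true, i) uE) form_skew -/(a i).
    by rewrite expr1 /GRing.scale /= !mulrN !mulN1r opprK mulrCA mulVf // mulr1.
  rewrite (form_sum u c (false, i) uE) -/(a i) scalerA expr0 mul1r.
  by rewrite mulfK.
exists (SympBasis bform bspan) => s t; rewrite /= /b.
have [_ vs] := vP t; case: ifP => _; first exact: vs.
by rewrite linearZ /= vs !scalerA mulrC.
Qed.

End WeightBasis.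

(** * Roots, simple roots and the positive system *)

Section RootSystem.
Variables (K : fieldType) (l : nat) (V : vectType K) (w : {skew_symmetric V}).
Variables (h : {vspace sp w}) (epsilon : 'I_l -> hdual h) (H : 'I_l -> subvs_of h).
Hypothesis char0 : forall n, n.+1%:R != 0 :> K.
Hypothesis epsilonH : forall i k, epsilon i (H k) = (i == k)%:R.
Variable b : symp_basis l w.
Local Notation wt := (mode_wt epsilon).
Hypothesis b_wt : forall (s : subvs_of h) t,
  sp_val (vsval s) (b t) = (wt t s : K) *: b t.
Implicit Types (s : subvs_of h) (t u : mode l) (x y : sp w) (i k : 'I_l).
Local Notation e i := (true, i).
Local Notation f i := (false, i).

Lemma wt_e i : wt (e i) = epsilon i. Proof. by []. Qed.
Lemma wt_f i : wt (f i) = - epsilon i. Proof. by []. Qed.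

Lemma dualb_wt s t : sp_val (vsval s) (dualb b t) = - (wt t s : K) *: dualb b t.
Proof.
by rewrite /dualb linearZ /= b_wt mode_wt_conj lfunE /= !scalerA mulrC.
Qed.

Lemma basis_neq0 t : b t != 0.
Proof.
apply/eqP => bt0; have := dualb_form b t t.
by rewrite bt0 (lin_0 (form_linr w _)) eqxx => /esym/eqP; rewrite oner_eq0.
Qed.

Lemma weight_coord (nu : hdual h) z t :
  (forall s, sp_val (vsval s) z = (nu s : K) *: z) ->
  w (dualb b t) z != 0 -> wt t = nu.
Proof.
move=> zw z0; apply/lfunP => s; apply: (mulIf z0).
have := sp_valP (vsval s) (dualb b t) z.
rewrite dualb_wt zw (lin_Z (form_linl w z)) (lin_Z (form_linr w _)).
by rewrite /GRing.scale /= mulNr => /oppr_inj.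
Qed.

Lemma sp_val_lin z : linear (fun y : sp w => sp_val y z).
Proof. by move=> a x y; rewrite sp_valL. Qed.

Lemma root_vector_coord (alpha : hdual h) (x : adjoint (sp w)) t u :
  weight_vector alpha x -> w (dualb b u) (sp_val (x : sp w) (b t)) != 0 ->
  wt u = wt t + alpha.
Proof.
move=> xw; apply: weight_coord => s.
have E : sp_val (lie (vsval s) (x : sp w)) (b t) = (alpha s : K) *: sp_val (x : sp w) (b t).
  rewrite -(lin_Z (sp_val_lin (b t))); congr (sp_val _ (b t)); exact: xw.
move: E; rewrite sp_lieE !lfun_simp b_wt linearZ /=.
move/eqP; rewrite subr_eq => /eqP ->.
by rewrite -scalerDl addrC ?lfun_simp.
Qed.

Lemma lie_sp_elt x (u v : V) :
  lie x (sp_elt w u v) = sp_elt w (sp_val x u) v + sp_elt w u (sp_val x v).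
Proof.
apply: sp_ext => z; rewrite [RHS](lin_D (sp_val_lin z)) sp_lieE !lfun_simp.
rewrite !sp_eltE /sp_quad linearD !linearZ /= !sp_valP.
rewrite !scaleNr opprD [X in X + _ = _]addrC addrACA; congr (_ + _).
exact: addrC.
Qed.

Lemma sp_elt_wt t u : weight_vector (wt t + wt u) (sp_elt w (b t) (b u) : adjoint (sp w)).
Proof.
move=> s; have := lie_sp_elt (vsval s) (b t) (b u).
rewrite !b_wt (lin_Z (sp_elt_linl w _)) (lin_Z (sp_elt_linr w _)) -scalerDl.
by rewrite lfunE; exact.
Qed.

Lemma wt_H t k : wt t (H k) = if t.1 then (t.2 == k)%:R else - (t.2 == k)%:R.
Proof. by rewrite mode_wtE epsilonH. Qed.

Lemma sp_elt_neq0 t u : sp_elt w (b t) (b u) != 0.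
Proof.
apply/eqP => E; have : sp_val (sp_elt w (b t) (b u)) (dualb b t) = 0.
  by rewrite E (lin_0 (sp_val_lin _)).
have wd (k : mode l) : w (b k) (dualb b t) = - (t == k)%:R by rewrite form_skew dualb_form.
rewrite sp_eltE /sp_quad !wd eqxx scaleN1r scaleNr -opprD => /eqP.
rewrite oppr_eq0; case: (eqVneq t u) => [<-|_].
  rewrite scale1r -mulr2n -scaler_nat scaler_eq0 (negPf (basis_neq0 t)) orbF.
  by rewrite (negPf (char0 1)).
by rewrite scale0r addr0 (negPf (basis_neq0 u)).
Qed.

Lemma wt_sum_root t u : wt t + wt u != 0 -> is_root (wt t + wt u).
Proof.
move=> tu; split=> //; exists (sp_elt w (b t) (b u)); first exact: sp_elt_neq0.
exact: sp_elt_wt.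
Qed.

(** A nonzero matrix coefficient from b_t to b_u gives alpha = wt u - wt t, and - wt t is the weight
    of the conjugate mode. *)
Lemma root_vectorP (alpha : hdual h) (x : adjoint (sp w)) :
  x != 0 -> weight_vector alpha x -> exists t u, alpha = wt t + wt u.
Proof.
move=> x0 xw; have [t xt] : exists t, sp_val (x : sp w) (b t) != 0.
  apply: contrapT => nex; case/negP: x0; apply/eqP.
  have : (x : sp w) = 0.
    apply: sp_ext; apply: (@basis_ext _ _ _ _ b V (sp_val (x : sp w))) => [a p q|a p q|t].
    - exact: linearP.
    - exact: linearP.
    - rewrite (lin_0 (sp_val_lin _)); apply/eqP/negPn/negP => xt.
      by apply: nex; exists t.
  exact.
have [u xu] : exists u, w (dualb b u) (sp_val (x : sp w) (b t)) != 0.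
  apply: contrapT => nex; case/negP: xt; apply/eqP.
  rewrite [sp_val _ _](dualb_expand b) big1 // => u _.
  have [->|xu] := eqVneq (w (dualb b u) (sp_val (x : sp w) (b t))) 0.
    by rewrite scale0r.
  by case: nex; exists u.
exists u, (conj_mode t); have := root_vector_coord xw xu => ->.
by rewrite mode_wt_conj addrAC subrr add0r.
Qed.

Section PositiveSystem.
Variables (P : hdual h -> Prop) (c : 'I_l -> subvs_of h) (alpha : 'I_l -> hdual h).
Hypothesis P_pos : positive_system P.
Hypothesis alpha_P : forall i, P (alpha i).
Hypothesis alphaC : forall i, coroot (alpha i) (c i).
Hypothesis epsilonC : forall i k,
  epsilon i (c k) = (i == k)%:R - (i == k.+1 :> nat)%:R.

Let tri (x : K) := [\/ x = 1, x = 0 | x = -1].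

Let sum_two (x y : K) : tri x -> tri y -> x + y = 2%:R -> x = 1 /\ y = 1.
Proof.
have bad (k : nat) (z : K) : z = 2%:R - k.+1%:R -> z = 2%:R :> K -> False.
  move=> -> /(congr1 (fun z => 2%:R - z)); rewrite subrr opprB addrCA subrr addr0.
  by move/eqP; rewrite (negPf (char0 k)).
case=> ->; case=> -> // E; exfalso.
- by apply: (bad 0%N _ _ E); ring.
- by apply: (bad 1%N _ _ E); ring.
- by apply: (bad 0%N _ _ E); ring.
- by apply: (bad 1%N _ _ E); ring.
- by apply: (bad 2%N _ _ E); ring.
- by apply: (bad 1%N _ _ E); ring.
- by apply: (bad 2%N _ _ E); ring.
- by apply: (bad 3%N _ _ E); ring.
Qed.

Let wtC t k : wt t (c k) =
  let d := (t.2 == k)%:R - (t.2 == k.+1 :> nat)%:R : K in if t.1 then d else - d.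
Proof. by rewrite mode_wtE epsilonC. Qed.

Let tri_wtC t k : tri (wt t (c k)).
Proof.
rewrite wtC; case: t => q i /=; case: (eqVneq i k) => [->|_].
  by rewrite ltn_eqF // subr0; case: q; [constructor 1 | constructor 3].
case: eqP => _; rewrite ?subr0 ?sub0r ?oppr0 ?opprK.
  by case: q; [constructor 3 | constructor 1].
by case: q; constructor 2.
Qed.

Let one_neg : (1 : K) <> -1.
Proof. by move/eqP; rewrite -addr_eq0 -[1 + 1]/(2%:R) (negPf (char0 1)). Qed.

Let wtC1 t k : wt t (c k) = 1 :> K ->
  t = e k \/ exists2 i : 'I_l, i = k.+1 :> nat & t = f i.
Proof.
rewrite wtC; case: t => q i /=; case: (eqVneq i k) => [->|_].
  rewrite ltn_eqF // subr0; case: q; first by left.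
  by move/esym/one_neg.
case: eqP => [ik|_]; rewrite ?subr0 ?sub0r ?oppr0 ?opprK; case: q => //.
- by move/esym/one_neg.
- by right; exists i.
- by move/esym/eqP; rewrite oner_eq0.
- by move/esym/eqP; rewrite oner_eq0.
Qed.

Let alpha_root i : is_root (alpha i).
Proof. by have [H1 _ _] := P_pos; apply: H1. Qed.

(** A basis vector occurring in x b (e k) has a weight with value 1 on [H k]; only epsilon_k has
    this value, and that would force a = 0. *)
Let kill_e (a : hdual h) (x : adjoint (sp w)) k : a != 0 -> a (H k) = 0 ->
  weight_vector a x -> sp_val (x : sp w) (b (e k)) = 0.
Proof.
move=> a0 ak xw; rewrite [sp_val _ _](dualb_expand b) big1 // => u _.
have [->|xu] := eqVneq (w (dualb b u) (sp_val (x : sp w) (b (e k)))) 0.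
  by rewrite scale0r.
have E := root_vector_coord xw xu; have := wt_H u k.
rewrite E lfunE /= wt_H /= eqxx ak addr0 => uk.
have ue : u = e k.
  move: uk; case: (u) => [[] i] /=; case: eqP => [->|_] //=.
  - by move/eqP; rewrite oner_eq0.
  - by rewrite oppr0 => /eqP; rewrite oner_eq0.
by case/eqP: a0; apply: (addrI (wt (e k))); rewrite -E ue addr0.
Qed.

(** By [kill_e] root vectors for both signs of alpha_i kill b (e k), hence so does their bracket,
    the coroot. But the coroot multiplies b (e k) by its epsilon_k value. *)
Let exclude i k : alpha i (H k) = 0 -> epsilon k (c i) != 0 -> False.
Proof.
move=> ak /eqP; apply; have [a0 _] := alpha_root i.
have [_ [x [y [xw yw cE]]]] := alphaC i.
have a0' : - alpha i != 0 by rewrite oppr_eq0.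
have ak' : (- alpha i) (H k) = 0 by rewrite lfunE /= ak oppr0.
have := b_wt (c i) (e k); rewrite cE sp_lieE !lfun_simp.
rewrite (kill_e a0 ak xw) (kill_e a0' ak' yw) !linear0 addr0 => /esym/eqP.
by rewrite scaler_eq0 (negPf (basis_neq0 _)) orbF => /eqP.
Qed.

(** The simple root is a sum of two weights of V, and its coroot takes the value 2 on the sum and
    values in {1, 0, -1} on each weight. So both values are 1, which only the weights epsilon_j and
    -epsilon_(j+1) attain. *)
Lemma alpha_cases (j : 'I_l) : [\/ alpha j = epsilon j + epsilon j,
  exists2 k : 'I_l, k = j.+1 :> nat & alpha j = epsilon j - epsilon k |
  exists2 k : 'I_l, k = j.+1 :> nat & alpha j = - epsilon k - epsilon k].
Proof.
have [_ [x x0 xw]] := alpha_root j; have [t [u aE]] := root_vectorP x0 xw.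
have [a2 _] := alphaC j; have := sum_two (tri_wtC t j) (tri_wtC u j).
have -> : wt t (c j) + wt u (c j) = 2%:R :> K by rewrite -a2 aE lfunE.
move=> /(_ erefl) [/wtC1 t1 /wtC1 u1]; rewrite aE.
case: t1 => [->|[k kj ->]]; case: u1 => [->|[k' kj' ->]].
- by constructor 1.
- by constructor 2; exists k'.
- by constructor 2; exists k => //; rewrite addrC.
- have -> : k' = k by apply: val_inj; rewrite /= kj kj'.
  by constructor 3; exists k.
Qed.

(** Each of the long candidates 2 epsilon_j and -2 epsilon_(j+1) misses one of the two indices at
    which the coroot is nonzero, so [exclude] rules it out. *)
Lemma alpha_gap (j k : 'I_l) : k = j.+1 :> nat -> alpha j = epsilon j - epsilon k.
Proof.
move=> kj; have jk : j != k by rewrite -val_eqE /= kj ltn_eqF.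
case: (alpha_cases j) => [aE|[k' k'j ->]|[k' k'j aE]].
- case: (exclude (i := j) (k := k)).
    by rewrite aE lfunE /= epsilonH (negPf jk) addr0.
  by rewrite epsilonC kj eqxx [k == j]eq_sym (negPf jk) sub0r oppr_eq0 oner_eq0.
- by have -> : k' = k by apply: val_inj; rewrite /= kj k'j.
- have k'k : k' = k by apply: val_inj; rewrite /= kj k'j.
  case: (exclude (i := j) (k := j)).
    by rewrite aE k'k !lfunE /= !lfunE /= epsilonH [k == j]eq_sym (negPf jk) oppr0 addr0.
  by rewrite epsilonC eqxx ltn_eqF // subr0 oner_eq0.
Qed.

Variable n : 'I_l.
Hypothesis n_last : n.+1 = l.

Lemma alpha_last : alpha n = epsilon n + epsilon n.
Proof.
by case: (alpha_cases n) => // -[k kn]; have := ltn_ord k; rewrite kn n_last ltnn.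
Qed.

Let P_add a a' t u : P a -> P a' -> a + a' = wt t + wt u -> wt t + wt u != 0 ->
  P (wt t + wt u).
Proof.
move=> Pa Pa' E tu; rewrite -E; have [_ _] := P_pos; apply => //.
by rewrite E; exact: wt_sum_root.
Qed.

(** Each partial sum of consecutive simple roots is again a root, so closure of the positive system
    applies step by step. *)
Lemma P_sub i k : (i < k)%N -> P (epsilon i - epsilon k).
Proof.
move Ed : (k - i)%N => d; elim: d i Ed => [|d IHd] i Ed ik; first by lia.
have [ki|ki] := eqVneq (k : nat) i.+1; first by rewrite -(alpha_gap ki).
have il : (i.+1 < l)%N by have := ltn_ord k; lia.
pose i' := Ordinal il; have Pi' : P (epsilon i' - epsilon k).
  by apply: IHd => /=; lia.
have Pi : P (epsilon i - epsilon i') by rewrite -(@alpha_gap i i').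
apply: (P_add (t := e i) (u := f k) Pi Pi').
  by rewrite /mode_wt /= addrA subrK.
apply/eqP => /(congr1 (fun a : hdual h => a (H i))).
rewrite add_lfunE zero_lfunE !wt_H /= eqxx (_ : k == i = false) ?oppr0 ?addr0.
  by apply/eqP; rewrite oner_eq0.
by apply/eqP => kE; rewrite kE ltnn in ik.
Qed.

Lemma P_addee i k : P (epsilon i + epsilon k).
Proof.
have nz p q : wt (e p) + wt (e q) != 0.
  apply/eqP => /(congr1 (fun a : hdual h => a (H p))).
  rewrite add_lfunE zero_lfunE !wt_H /= eqxx -natrD; apply/eqP; rewrite add1n.
  exact: char0.
have lt_n p : p != n -> (p < n)%N.
  by rewrite -val_eqE /= => pn; have := ltn_ord p; lia.
have Pn : P (epsilon n + epsilon n) by rewrite -alpha_last.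
have P1 p : P (epsilon p + epsilon n).
  have [->//|/lt_n/P_sub pn] := eqVneq p n.
  by apply: (P_add (t := e p) (u := e n) pn Pn); rewrite ?nz // addrA subrK.
have [->//|/lt_n/P_sub kn] := eqVneq k n.
apply: (P_add (t := e i) (u := e k) kn (P1 i)); rewrite ?nz //.
by rewrite addrCA subrK.
Qed.

Lemma P_opp a : P a -> P (- a) -> False.
Proof.
have [H1 H2 _] := P_pos => Pa; have /H2[/(_ Pa) H3 _] := H1 _ Pa; exact: H3.
Qed.

Lemma not_P0 : ~ P 0.
Proof. by have [H1 _ _] := P_pos => /H1[/eqP]. Qed.

End PositiveSystem.

End RootSystem.

(** * Triangular decomposition and weights of the singular vectors *)

Section TriangularDecomposition.
Variables (K : fieldType) (l : nat) (V : vectType K) (w : {skew_symmetric V}).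
Variables (h : {vspace sp w}) (epsilon : 'I_l -> hdual h) (H : 'I_l -> subvs_of h).
Hypothesis char0 : forall n, n.+1%:R != 0 :> K.
Hypothesis epsilonH : forall i k, epsilon i (H k) = (i == k)%:R.
Variable b : symp_basis l w.
Local Notation wt := (mode_wt epsilon).
Hypothesis b_wt : forall (s : subvs_of h) t,
  sp_val (vsval s) (b t) = (wt t s : K) *: b t.
Hypothesis h_normal : forall x : sp w,
  (forall y, y \in h -> lie x y \in h) -> x \in h.
Variable P : hdual h -> Prop.
Hypothesis P_sub : forall i k : 'I_l, (i < k)%N -> P (epsilon i - epsilon k).
Hypothesis P_add : forall i k, P (epsilon i + epsilon k).
Hypothesis P_opp : forall a, P a -> P (- a) -> False.
Hypothesis not_P0 : ~ P 0.
Variable n : 'I_l.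
Hypothesis n_last : n.+1 = l.
Implicit Types (s : subvs_of h) (t u : mode l) (x y : sp w) (i k : 'I_l) (j r : nat) (p : bool).
Local Notation e i := (true, i).
Local Notation f i := (false, i).
Local Notation M := (fock K l).
Local Notation act := (sp_act b).

Lemma quad_ee i k (m : M) : quad b (b (e i)) (b (e k)) m =
  cre (e i) (ann (f k) m) + cre (e k) (ann (f i) m) + der i (der k m).
Proof.
rewrite /quad !extE !ctr_basis !weylE /bos /= derC -mulr2n -scaler_nat.
by rewrite scalerA mulVf ?(char0 1) // scale1r /csign /= !scale1r.
Qed.

Lemma quad_ef_diag i (m : M) : quad b (b (e i)) (b (f i)) m =
  - cre (e i) (ann (e i) m) + cre (f i) (ann (f i) m)
  + mulx i (der i m) + 2%:R^-1 *: m.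
Proof.
rewrite /quad !extE !ctr_basis !weylE /bos /=.
have -> : der i (mulx i m) = m + mulx i (der i m).
  by have := der_mulx i i m; rewrite eqxx scale1r => /eqP; rewrite subr_eq => /eqP.
rewrite [X in 2%:R^-1 *: X](_ : _ = mulx i (der i m) *+ 2 + m); last first.
  by rewrite mulr2n -addrA addrC.
rewrite scalerDr -scaler_nat scalerA mulVf ?(char0 1) // scale1r.
by rewrite linearZ /= /csign /= scaleN1r scale1r addrA.
Qed.

Lemma der_hwv i j p : i != n -> der i (hwv K n j p) = 0.
Proof.
by move=> ni; rewrite /hwv; case: p; rewrite ?der_occ1 ?der_occ0 // (negPf ni) scale0r.
Qed.

Lemma der2_hwv i k j p : der i (der k (hwv K n j p)) = 0.
Proof.
rewrite /hwv; case: p; rewrite ?der_occ1 ?der_occ0 ?linear0 //.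
by rewrite linearZ /= der_occ0 scaler0.
Qed.

Lemma ann_f_hwv i j p : ann (f i) (hwv K n j p) = 0.
Proof. by rewrite /hwv annU inE. Qed.

(** Positive pairs are two e modes, or e_i with f_k for i < k. In the latter case an occupied e_k
    entails an occupied e_i, as the occupied modes form an initial segment, and d/dx_i kills x_n
    because i is not last. *)
Lemma pos_quad_hwv t u j p : P (wt t + wt u) -> quad b (b t) (b u) (hwv K n j p) = 0.
Proof.
have ef i k : P (wt (e i) + wt (f k)) -> quad b (b (e i)) (b (f k)) (hwv K n j p) = 0.
  rewrite wt_e wt_f; case: (ltngtP i k) => [ik _|ki Pik|/val_inj->].
  - rewrite (quad_ef char0) -?val_eqE /= ?(gtn_eqF ik) // ann_f_hwv der_hwv; last first.
      by rewrite -val_eqE /=; have := ltn_ord k; move: n_last; lia.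
    rewrite !linear0 !addr0 /hwv annU inE /=; case: ifP => kj; last by rewrite !linear0.
    rewrite linearZ /= creU !inE /= (ltn_trans ik kj) andbT mode_eqE /=.
    by rewrite -val_eqE /= (ltn_eqF ik) /= scaler0 oppr0.
  - by case: (P_opp Pik); rewrite opprB; exact: P_sub.
  - by rewrite subrr => /not_P0.
case: t u => [[] i] [[] k] Ptu.
- by rewrite quad_ee !ann_f_hwv der2_hwv !linear0 !addr0.
- exact: ef.
- by rewrite quadC; apply: ef; rewrite addrC.
- by case: (P_opp Ptu); rewrite !wt_f opprD !opprK.
Qed.

(** When x is expanded over pairs of basis vectors, a nonzero coefficient forces the weights of the
    pair to add up to alpha, so [pos_quad_hwv] applies to every surviving term. *)
Lemma hwv_pos (alpha : hdual h) (x : adjoint (sp w)) j p :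
  P alpha -> weight_vector alpha x -> act (x : sp w) (hwv K n j p) = 0.
Proof.
move=> Pa xw; rewrite /sp_act big1 ?scaler0 // => t _.
rewrite [sp_val _ _](dualb_expand b) (lin_sum (quad_linr b _ _)) big1 // => u _.
rewrite (lin_Z (quad_linr b _ _)) /dualb (lin_Z (quad_linl b _ _)).
have [->|xu] := eqVneq (w (dualb b u) (sp_val (x : sp w) (b t))) 0.
  by rewrite scale0r.
rewrite pos_quad_hwv ?scaler0 // (root_vector_coord b_wt xw xu) mode_wt_conj addrA.
by rewrite addNr add0r.
Qed.

(** The shift by -1/2 comes from the symmetrised Weyl part, (x d + d x)/2 = x d + 1/2; each occupied
    e_i adds epsilon_i, and the factor x_n subtracts epsilon_n. *)
Definition hw j p : hdual h := \sum_(i < l | (i < j)%N) epsilon i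
  - 2%:R^-1 *: (\sum_i epsilon i) - (if p then epsilon n else 0).

Lemma hwv_weight s j p : act (vsval s) (hwv K n j p) = (hw j p s : K) *: hwv K n j p.
Proof.
rewrite /sp_act; under eq_bigr => t _ do rewrite b_wt (lin_Z (quad_linr b _ _)).
rewrite mode_sum.
have E i : (wt (e i) s : K) *: quad b (dualb b (e i)) (b (e i)) (hwv K n j p)
    + (wt (f i) s : K) *: quad b (dualb b (f i)) (b (f i)) (hwv K n j p) =
    (2%:R * (epsilon i s * ((i < j)%N%:R - 2%:R^-1 - (p && (i == n))%:R) : K))
      *: hwv K n j p.
  rewrite /dualb /= expr1 expr0 scaleN1r scale1r (lin_N (quad_linl b _ _)).
  rewrite [quad b (b (f i)) _ _]quadC !mode_wtE /= scaleNr scalerN -opprD -mulr2n.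
  rewrite quad_ef_diag ann_f_hwv linear0 addr0.
  have -> : cre (e i) (ann (e i) (hwv K n j p)) = (i < j)%N%:R *: hwv K n j p.
    rewrite /hwv annU inE /=; case: ifP => ij; last by rewrite linear0 scale0r.
    rewrite linearZ /= creU setD11 setD1K ?inE //= scalerA {2}/fsign below_self.
    by rewrite fsign_sqr.
  have -> : mulx i (der i (hwv K n j p)) = (p && (i == n))%:R *: hwv K n j p.
    rewrite /hwv; case: p => /=; last by rewrite der_occ0 linear0 scale0r.
    rewrite der_occ1; case: eqP => [->|_]; last by rewrite !scale0r linear0.
    by rewrite !scale1r mulx_occ0.
  rewrite -scaleNr -!scalerDl scalerA -scaler_nat -scaleNr scalerA; congr (_ *: _).
  by move: (epsilon i s : K) (2%:R^-1 : K) => z c; ring.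
under eq_bigr => i _ do rewrite E.
rewrite -scaler_suml -mulr_sumr scalerA mulrA mulVf ?(char0 1) // mul1r; congr (_ *: _).
rewrite /hw !lfun_simp /= (eq_bigr (fun i => epsilon i s * (i < j)%N%:R
   - 2%:R^-1 * epsilon i s - epsilon i s * (p && (i == n))%:R)); last first.
  by move=> i _; ring.
rewrite !sumrB -mulr_sumr; congr (_ - _ - _).
- rewrite [RHS]big_mkcond; apply: eq_bigr => i _.
  by case: ifP => _; rewrite ?mulr1 ?mulr0.
- case: (p) => /=; last by rewrite big1 ?lfunE // => i _; rewrite mulr0.
  rewrite (bigD1 n) //= eqxx mulr1 big1 ?addr0 // => i /negPf->.
  by rewrite mulr0.
Qed.

Definition neg_elt (y : sp w) (m : nat) := (0 < m)%N /\ exists t u,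
  [/\ y = sp_elt w (b t) (b u), P (- (wt t + wt u)) &
      (wt t (rho_vee H) : K) + wt u (rho_vee H) = - m%:R].

Lemma neg_elt_height y m : neg_elt y m -> lie (vsval (rho_vee H)) y = - m%:R *: y.
Proof.
move=> [_ [t [u [-> _ tu]]]]; have := sp_elt_wt b_wt t u (rho_vee H).
by rewrite lfunE /= tu.
Qed.

Lemma sp_eltC (u v : V) : sp_elt w u v = sp_elt w v u.
Proof. by apply: sp_ext => z; rewrite !sp_eltE /sp_quad addrC. Qed.

(** The element has weight 0, so it commutes with h and normalises it; a Cartan subalgebra is its
    own normaliser. *)
Lemma sp_elt_h i : sp_elt w (b (e i)) (b (f i)) \in h.
Proof.
apply: h_normal => y yh; have := sp_elt_wt b_wt (e i) (f i) (vsproj h y).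
rewrite wt_f subrr vsprojK // lfunE scale0r => E.
have -> : lie (sp_elt w (b (e i)) (b (f i))) y = 0; last exact: rpred0.
by rewrite lieC [lie y _]E oppr0.
Qed.

Lemma sp_triangular (Q : sp w -> Prop) : (forall a x y, Q x -> Q y -> Q (a *: x + y)) ->
  (forall y m, neg_elt y m -> Q y) -> (forall s, Q (vsval s)) ->
  (forall alpha (x : adjoint (sp w)), P alpha -> weight_vector alpha x -> Q x) ->
  forall x, Q x.
Proof.
move=> QD Qneg Qh Qpos.
have Q0 : Q 0 by have := Qh 0; rewrite linear0.
have QZ a x : Q x -> Q (a *: x) by move=> Qx; rewrite -[_ *: _]addr0; apply: QD.
have QS (F : mode l -> sp w) : (forall t, Q (F t)) -> Q (\sum_t F t).
  move=> QF; apply: big_ind => // x y Qx Qy.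
  by rewrite -[x]scale1r; apply: QD.
have rho i : epsilon i (rho_vee H) = (l - i)%:R by rewrite (epsilon_rho epsilonH).
have Qef i k : Q (sp_elt w (b (e i)) (b (f k))).
  case: (ltngtP i k) => [ik|ki|/val_inj->].
  - by apply: (Qpos _ _ _ (sp_elt_wt b_wt _ _)); rewrite wt_f; exact: P_sub.
  - apply: (Qneg _ (i - k)%N); split; first by rewrite subn_gt0.
    exists (e i), (f k); split=> //; first by rewrite wt_f opprB; exact: P_sub.
    rewrite !mode_wtE /= !rho; have := ltn_ord i; have := ltn_ord k => kl il.
    by rewrite !natrB 1?ltnW //; ring.
  - by have := Qh (vsproj h (sp_elt w (b (e k)) (b (f k)))); rewrite vsprojK // sp_elt_h.
have Qtu t u : Q (sp_elt w (b t) (b u)).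
  case: t u => [[] i] [[] k] //.
  - by apply: (Qpos _ _ _ (sp_elt_wt b_wt _ _)); exact: P_add.
  - by rewrite sp_eltC.
  - apply: (Qneg _ ((l - i) + (l - k))%N); split.
      by have := ltn_ord i; lia.
    exists (f i), (f k); split=> //; first by rewrite !wt_f opprD !opprK.
    by rewrite !mode_wtE /= !rho natrD opprD.
move=> x; rewrite [x](sp_elt_sum char0 b); apply/QZ/QS => t.
rewrite [sp_val _ _](dualb_expand b) (lin_sum (sp_elt_linr w _)); apply: QS => u.
rewrite (lin_Z (sp_elt_linr w _)); apply/QZ.
rewrite /dualb (lin_Z (sp_elt_linl w _)).
exact/QZ/Qtu.
Qed.

(** The adjoint of a negative element is positive, and positive elements kill the singular
    vector. *)
Lemma cform_neg y m j p (v : M) : neg_elt y m -> cform (hwv K n j p) (act y v) = 0.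
Proof.
move=> [_ [t [u [-> Ptu _]]]]; rewrite cformC (cform_sp_elt char0) (sp_act_elt char0) !swapE.
rewrite pos_quad_hwv ?(lin_0 (cform_linr _)) //.
by rewrite !mode_wt_conj -opprD.
Qed.

Lemma L_hw_embeds j p : admissible l j p ->
  embeds act (L P (hw j p)) (fun m => m \in hwm b n j p).
Proof.
move=> jp; have Cneg y m v : neg_elt y m -> cform (hwv K n j p) (act y v) = 0.
  exact: cform_neg.
apply: (@L_embeds _ _ _ _ _ _ act (fun x => @linearP _ _ _ _ (sp_act b x))
  (sp_act_linl b) (sp_act_lie (char0 1) b) neg_elt (rho_vee H) char0
  (fun y m => @proj1 _ _) neg_elt_height sp_triangular _ (cform (hwv K n j p))) => //.
- by move=> alpha x Pa xw; exact: hwv_pos xw.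
- by move=> s; exact: hwv_weight.
- apply/eqP => v0; have := cformE (top l j) (if p then occ1 n else occ0 l) (hwv K n j p).
  rewrite kcoefE eqxx mulr1 -/(hwv K n j p) {2}v0 (lin_0 (cform_linr _)) => /esym/eqP.
  by rewrite (negPf (ket_norm_neq0 char0 _)).
- exact: cform_linr.
- by move=> N; exact: (hwm_faithful char0 n_last).
Qed.

Lemma embeds_layer r j : (r <= l)%N -> (j <= r)%N ->
  embeds act (L P (hw j (odd (r - j)))) (layer b n r j).
Proof.
move=> rl jr; have adm : admissible l j (odd (r - j)).
  rewrite /admissible; case: ifP => [o|_]; last exact: leq_trans jr rl.
  case: (ltngtP j r) jr o => // [jr _ _|->]; first exact: leq_trans jr rl.
  by rewrite subnn.
apply: (embeds_map (T := iter (r - j) (ospX b)) _ _ _ (L_hw_embeds adm)) => [|x m|m].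
- exact: iter_ospX_linear.
- by move=> _; elim: (r - j)%N => //= k IHk; rewrite IHk (sp_act_ospX char0).
- move=> mh; apply: (iter_ospX_inj char0 n_last adm) => //.
  by rewrite subnKC.
Qed.

End TriangularDecomposition.

(** * Exterior powers and tensor products *)

Section ExteriorPower.
Variables (K : fieldType) (g : lieAlgType K) (r : nat) (N : lieModType g).
Implicit Types (f : {ffun 'I_r -> N}) (i k : 'I_r).

Definition ewedge f : Λ^r N := quot_pi _ (wedge f).

Lemma ewedge_lin f i a u v : ewedge (ffun_upd f i (a *: u + v)) =
  a *: ewedge (ffun_upd f i u) + ewedge (ffun_upd f i v).
Proof.
rewrite /ewedge -quot_pi_linear; apply/quot_piP/mem_gen_submod.
by left; exists f, i, a, u, v.
Qed.

Lemma ewedge_linear f i : linear (fun u => ewedge (ffun_upd f i u)).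
Proof. by move=> a u v; rewrite ewedge_lin. Qed.

Lemma ewedge_alt f i k : i != k -> f i = f k -> ewedge f = 0.
Proof.
move=> ik fik; apply/quot_pi_eq0/mem_gen_submod.
by right; exists f, i, k.
Qed.

Lemma ewedge_act x f :
  lact x (ewedge f) = \sum_(i < r) ewedge (ffun_upd f i (lact x (f i))).
Proof.
rewrite /ewedge [lact _ _](lieQuot_actE x) /= [exterior_act _ _]exterior_actU.
exact: (lin_sum (quot_pi_linear _)).
Qed.

Lemma exterior_ind (S : Λ^r N -> Prop) : S 0 ->
  (forall a u v, S u -> S v -> S (a *: u + v)) -> (forall f, S (ewedge f)) ->
  forall q, S q.
Proof.
move=> S0 SD Se q; rewrite -[q]quot_reprK; move: (quot_repr q).
apply: free_mod_ind => [|a u v|f]; last exact: Se.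
- by rewrite (lin_0 (quot_pi_linear _)).
- by rewrite quot_pi_linear; apply: SD.
Qed.

Lemma ffun_upd_id f i : ffun_upd f i (f i) = f.
Proof. by apply/ffunP => k; rewrite ffunE; case: eqP => // ->. Qed.

Lemma ewedge_swap f i k : i != k ->
  ewedge [ffun j => f (tperm i k j)] = - ewedge f.
Proof.
move=> ik; pose G u v := ffun_upd (ffun_upd f i u) k v.
have G0 u : ewedge (G u u) = 0.
  by apply: (ewedge_alt ik); rewrite !ffunE eqxx (negPf ik) eqxx.
have updC u v : G u v = ffun_upd (ffun_upd f k v) i u.
  apply/ffunP => j; rewrite !ffunE; case: (eqVneq j k) => // ->.
  by rewrite eq_sym (negPf ik).
have Gl u u' v : ewedge (G (u + u') v) = ewedge (G u v) + ewedge (G u' v).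
  by rewrite !updC; exact: (lin_D (ewedge_linear _ _)).
have Gr u v v' : ewedge (G u (v + v')) = ewedge (G u v) + ewedge (G u v').
  exact: (lin_D (ewedge_linear _ _)).
have := G0 (f i + f k); rewrite Gl !Gr !G0 add0r addr0.
have -> : G (f i) (f k) = f by rewrite /G !ffun_upd_id.
have -> : G (f k) (f i) = [ffun j => f (tperm i k j)].
  apply/ffunP => j; rewrite !ffunE; case: (eqVneq j k) => [->|jk].
    by rewrite tpermR.
  by case: (eqVneq j i) => [->|ji]; rewrite ?tpermL // tpermD // eq_sym.
by move/eqP; rewrite addr_eq0 => /eqP ->; rewrite opprK.
Qed.

Lemma ewedge_perm f (s : {perm 'I_r}) : exists c : K,
  ewedge [ffun j => f (s j)] = c *: ewedge f.
Proof.
have [ts -> dts] := prod_tpermP s; elim: ts dts f {s} => [|[i k] ts IHs] /= dts f.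
  exists 1; rewrite big_nil scale1r; congr ewedge; apply/ffunP => j.
  by rewrite ffunE perm1.
case/andP: dts => /= ik dts; rewrite big_cons /=.
have [c E] := IHs dts f.
exists (- c); rewrite scaleNr -E -(ewedge_swap _ ik).
by congr ewedge; apply/ffunP => j; rewrite !ffunE permM.
Qed.

Section Spanning.
Variables (T : finType) (beta : T -> N) (t0 : T).
Hypothesis beta_span : forall u, exists c : T -> K, u = \sum_t c t *: beta t.

Definition basis_wedge (A : {set T}) : Λ^r N :=
  ewedge [ffun k : 'I_r => beta (nth t0 (enum A) k)].

(** Only spanning is established here. Independence of these wedges comes from their action on the
    Fock space, where they produce multiples of distinct kets. *)
Lemma exterior_span q : exists c : {set T} -> K,
  q = \sum_(A : {set T} | #|A| == r) c A *: basis_wedge A.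
Proof.
pose D q := exists c : {set T} -> K, q = \sum_(A : {set T} | #|A| == r) c A *: basis_wedge A.
have D0 : D 0 by exists (fun=> 0); rewrite big1 // => A _; rewrite scale0r.
have DL a u v : D u -> D v -> D (a *: u + v).
  move=> [c ->] [c' ->]; exists (fun A => a * c A + c' A).
  rewrite scaler_sumr -big_split; apply: eq_bigr => A _ /=.
  by rewrite scalerDl scalerA.
have Dbasis (s : 'I_r -> T) : D (ewedge [ffun k => beta (s k)]).
  case: (boolP (injectiveb s)) => [/injectiveP sI|/injectivePn[i [k ik sik]]]; last first.
    by rewrite (ewedge_alt ik) // !ffunE sik.
  (* An injective tuple is the enumeration of its image composed with a permutation of the
     positions. *)
  pose A := [set s k | k : 'I_r].
  have Ar : #|A| = r by rewrite card_imset // card_ord.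
  have lt k : (index (s k) (enum A) < r)%N.
    have : (index (s k) (enum A) < size (enum A))%N by rewrite index_mem mem_enum imset_f.
    by rewrite -cardE Ar.
  pose sig k := Ordinal (lt k).
  have sigI : injective sig.
    move=> i k /(congr1 val) /= ik; apply: sI.
    rewrite -[s i](nth_index t0 (s := enum A)) ?mem_enum ?imset_f // ik.
    by rewrite nth_index // mem_enum imset_f.
  have [c E] := ewedge_perm [ffun k : 'I_r => beta (nth t0 (enum A) k)] (perm sigI).
  exists (fun B => if B == A then c else 0).
  rewrite (bigD1 A) ?Ar //= eqxx big1 ?addr0 => [|B /andP[_ /negPf->]]; last by rewrite scale0r.
  rewrite /basis_wedge -E; congr ewedge; apply/ffunP => k.
  by rewrite !ffunE permE /= nth_index // mem_enum imset_f.
move: q; apply: exterior_ind => // f.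
(* The entries are expanded one at a time; those from position m on are already basis vectors. *)
suff H m : (m <= r)%N -> forall f, (forall k, (m <= k)%N -> exists t, f k = beta t) -> D (ewedge f).
  by apply: (H r) => // k; rewrite leqNgt ltn_ord.
elim: m => [_|m IHm mr] {}f fb.
  have [s sE] := choice (fun k => fb k (leq0n _)).
  rewrite (_ : f = [ffun k => beta (s k)]); first exact: Dbasis.
  by apply/ffunP => k; rewrite ffunE.
pose i := Ordinal mr; rewrite -(ffun_upd_id f i).
have [c ->] := beta_span (f i); rewrite (lin_sum (ewedge_linear f i)).
apply: big_ind => [//|u v Du Dv|t _]; first by rewrite -[u]scale1r; apply: DL.
rewrite (lin_Z (ewedge_linear f i)) -[_ *: _]addr0; apply: DL => //.
apply: IHm => [|k mk]; first exact: ltnW.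
rewrite ffunE; case: (eqVneq k i) => [_|ki]; first by exists t.
by apply: fb; rewrite ltn_neqAle mk andbT; apply: contraNneq ki => E; apply/eqP/val_inj.
Qed.

End Spanning.

Section Multiplication.
Variables (M : lmodType K) (act : g -> M -> M) (V : lmodType K) (theta : N -> V).
Variables (gact : g -> V -> V) (Z : V -> M -> M).
Hypothesis two_neq0 : 2%:R != 0 :> K.
Hypothesis act_linr : forall x, linear (act x).
Hypothesis theta_lin : linear theta.
Hypothesis theta_act : forall x u, theta (lact x u) = gact x (theta u).
Hypothesis Z_linl : forall m, linear (Z ^~ m).
Hypothesis Z_linr : forall u, linear (Z u).
Hypothesis Z_anti : forall u v m, Z u (Z v m) = - Z v (Z u m).
Hypothesis Z_act : forall x u m, act x (Z u m) = Z (gact x u) m + Z u (act x m).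

Definition Zprod (vs : seq V) m := foldr Z m vs.

Arguments Zprod : simpl never.

Lemma Zprod_cons v vs m : Zprod (v :: vs) m = Z v (Zprod vs m).
Proof. by []. Qed.

Lemma Zprod_linear vs : linear (Zprod vs).
Proof. by elim: vs => // v vs IHs a m m'; rewrite !Zprod_cons IHs Z_linr. Qed.

Lemma Z_sqr u m : Z u (Z u m) = 0.
Proof.
have /eqP := Z_anti u u m; rewrite -addr_eq0 -mulr2n -scaler_nat scaler_eq0.
by rewrite (negPf two_neq0) => /eqP.
Qed.

Lemma Zprod_mem u (s : seq 'I_r) (F : 'I_r -> V) k m :
  k \in s -> F k = u -> Z u (Zprod (map F s) m) = 0.
Proof.
elim: s => // j s IHs; rewrite inE /= Zprod_cons => /orP[/eqP<- ->|ks Fk].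
  exact: Z_sqr.
by rewrite Z_anti IHs // (lin_0 (Z_linr _)) oppr0.
Qed.

Lemma Zprod_alt (s : seq 'I_r) (F : 'I_r -> V) i k m : uniq s -> i != k ->
  i \in s -> k \in s -> F i = F k -> Zprod (map F s) m = 0.
Proof.
elim: s => // j s IHs /= /andP[_ us] ik; rewrite !inE Zprod_cons.
case/orP=> [/eqP ij|is_] /orP[/eqP kj|ks] Fik.
- by move: ik; rewrite ij kj eqxx.
- by rewrite -ij Fik; apply: (Zprod_mem _ ks).
- by rewrite -kj -Fik; apply: (Zprod_mem _ is_).
- by rewrite IHs // (lin_0 (Z_linr _)).
Qed.

Lemma Zprod_upd_out f i u (s : seq 'I_r) m : i \notin s ->
  Zprod [seq theta (ffun_upd f i u k) | k <- s] m = Zprod [seq theta (f k) | k <- s] m.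
Proof.
move=> is_; congr Zprod; apply/eq_in_map => k ks; rewrite ffunE.
by case: eqP => // ki; rewrite -ki ks in is_.
Qed.

Lemma Zprod_upd f i a u v (s : seq 'I_r) m : uniq s -> i \in s ->
  Zprod [seq theta (ffun_upd f i (a *: u + v) k) | k <- s] m =
  a *: Zprod [seq theta (ffun_upd f i u k) | k <- s] m
  + Zprod [seq theta (ffun_upd f i v k) | k <- s] m.
Proof.
elim: s => //= j s IHs /andP[js us]; rewrite !Zprod_cons inE => /orP[/eqP ij|is_].
  rewrite -ij in js *; rewrite !Zprod_upd_out // !ffunE eqxx theta_lin.
  exact: Z_linl.
rewrite IHs // Z_linr !ffunE; case: (eqVneq j i) => // ji.
by rewrite ji is_ in js.
Qed.

Lemma Zprod_act f x (s : seq 'I_r) m : uniq s ->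
  act x (Zprod [seq theta (f k) | k <- s] m) =
  \sum_(i <- s) Zprod [seq theta (ffun_upd f i (lact x (f i)) k) | k <- s] m
  + Zprod [seq theta (f k) | k <- s] (act x m).
Proof.
elim: s => [|j s IHs] /=; first by rewrite big_nil add0r.
move=> /andP[js us]; rewrite big_cons !Zprod_cons Z_act IHs // (lin_D (Z_linr _)) addrA.
congr (_ + _ + _); first by rewrite Zprod_upd_out // ffunE eqxx theta_act.
rewrite (lin_sum (Z_linr _)) big_seq [RHS]big_seq; apply: eq_bigr => i is_.
rewrite Zprod_cons; congr (Z _ _); rewrite ffunE; case: eqP => // ji.
by rewrite ji is_ in js.
Qed.

(** Anticommuting operators square to zero since 2 is invertible, so for fixed m the ordered product
    of the Z's is alternating and multilinear and factors through the exterior power. *)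
Lemma exterior_mult : exists F : Λ^r N -> M -> M, [/\ forall m, linear (F ^~ m),
  forall q, linear (F q), forall f m, F (ewedge f) m = Zprod [seq theta (f k) | k <- enum 'I_r] m
  & forall x q m, act x (F q m) = F (lact x q) m + F q (act x m)].
Proof.
pose F0 m := mlift (fun f : {ffun 'I_r -> N} => Zprod [seq theta (f k) | k <- enum 'I_r] m).
have F0L m : linear (F0 m) by exact: mlift_linear.
have F0E m f : F0 m (wedge f) = Zprod [seq theta (f k) | k <- enum 'I_r] m by exact: mliftU.
have ex m : exists F : Λ^r N -> M, linear F /\ forall u, F (quot_pi _ u) = F0 m u.
  apply: (quot_lift (F0L m)) => u.
  apply: (gen_submod_ind (S := fun u => F0 m u = 0)) => [|{}u]; last first.
    case=> [[f [i [a [v [v' ->]]]]]|[f [i [k [ik fik ->]]]]].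
      rewrite (lin_B (F0L m)) F0L !F0E Zprod_upd ?enum_uniq ?mem_enum // subrr //.
    by rewrite F0E (@Zprod_alt _ _ i k) ?enum_uniq ?mem_enum // fik.
  split=> [|a p q p0 q0|[]//]; first exact: (lin_0 (F0L m)).
  by rewrite F0L p0 q0 scaler0 addr0.
have [F FP] := choice ex; exists (fun q m => F m q).
have FL m : linear (F m) by have [] := FP m.
have FE f m : F m (ewedge f) = Zprod [seq theta (f k) | k <- enum 'I_r] m.
  by have [_ ->] := FP m; rewrite F0E.
split=> // [q a m m'|x q m].
  move: q; apply: exterior_ind => [|c u v IHu IHv|f].
  - by rewrite !(lin_0 (FL _)) scaler0 addr0.
  - by rewrite !FL IHu IHv !scalerDr !scalerA mulrC addrACA.
  - by rewrite !FE Zprod_linear.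
move: q; apply: exterior_ind => [|a u v IHu IHv|f].
- by rewrite !(lin_0 (FL _)) (lin_0 (act_linr x)) (lin_0 (lact_linearr _)) (lin_0 (FL _)) addr0.
- by rewrite !FL act_linr IHu IHv lact_linearr FL !scalerDr addrACA.
rewrite ewedge_act (lin_sum (FL m)) !FE Zprod_act ?enum_uniq // big_enum /=.
by congr (_ + _); apply: eq_bigr => i _; rewrite FE.
Qed.

End Multiplication.

End ExteriorPower.

Section TensorProduct.
Variables (K : fieldType) (g : lieAlgType K) (N1 N2 : lieModType g).

Definition tens (p : N1) (q : N2) : N1 ⊗ N2 := quot_pi _ (pure p q).

Lemma tens_linl q : linear (tens ^~ q).
Proof.
move=> a p p'; rewrite /tens -quot_pi_linear; apply/quot_piP/mem_gen_submod.
by left; exists a, p, p', q.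
Qed.

Lemma tens_linr p : linear (tens p).
Proof.
move=> a q q'; rewrite /tens -quot_pi_linear; apply/quot_piP/mem_gen_submod.
by right; exists a, p, q, q'.
Qed.

Lemma tens_ind (S : N1 ⊗ N2 -> Prop) : S 0 ->
  (forall a u v, S u -> S v -> S (a *: u + v)) -> (forall p q, S (tens p q)) ->
  forall z, S z.
Proof.
move=> S0 SD St z; rewrite -[z]quot_reprK; move: (quot_repr z).
apply: free_mod_ind => [|a u v|[p q]]; last exact: St.
- by rewrite (lin_0 (quot_pi_linear _)).
- by rewrite quot_pi_linear; apply: SD.
Qed.

Lemma tensor_lift (M : lmodType K) (act : g -> M -> M) (F : N1 -> N2 -> M) :
  (forall x, linear (act x)) -> (forall q, linear (F ^~ q)) -> (forall p, linear (F p)) ->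
  (forall x p q, act x (F p q) = F (lact x p) q + F p (lact x q)) ->
  exists f : N1 ⊗ N2 -> M, [/\ linear f, forall x z, f (lact x z) = act x (f z)
    & forall p q, f (tens p q) = F p q].
Proof.
move=> actL FLl FLr Fact; pose F0 := mlift (fun pq : N1 * N2 => F pq.1 pq.2).
have F0L : linear F0 by exact: mlift_linear.
have F0E p q : F0 (pure p q) = F p q by exact: mliftU.
have F0S u : u \in span_submod (@tensor_rel K g N1 N2) -> F0 u = 0.
  move: u; apply: (gen_submod_ind (S := fun u => F0 u = 0)) => [|u].
    split=> [|a p q p0 q0|[]//]; first exact: (lin_0 F0L).
    by rewrite F0L p0 q0 scaler0 addr0.
  by case=> -[a [p [p' [q ->]]]]; rewrite (lin_B F0L) F0L !F0E ?FLl ?FLr subrr.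
have F0A x u : F0 (tensor_act x u) = act x (F0 u).
  move: u; apply: malg_eq => [a u v|a u v|[p q]].
  - by rewrite tensor_linearr F0L.
  - by rewrite F0L actL.
  - by rewrite -/(pure p q) tensor_actU (lin_D F0L) !F0E Fact.
have [f [fL fa fE]] := @lieQuot_lift _ _ _ act (LieQuotData (@tensor_linearr _ _ N1 N2)
  (@tensor_stable _ _ N1 N2) (@tensor_linearl _ _ N1 N2) (@tensor_lie _ _ N1 N2))
  F0 F0L F0S F0A.
by exists f; split=> // p q; rewrite /tens fE F0E.
Qed.

End TensorProduct.

(** * Tensor products inside the Fock space *)

Section TensorEmbedding.
Variables (K : fieldType) (g : lieAlgType K) (l r : nat) (N1 N2 : lieModType g).
Local Notation M := (fock K l).
Variables (act : g -> M -> M) (V : lmodType K) (theta : N1 -> V).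
Variables (gact : g -> V -> V) (Z : V -> M -> M).
Hypothesis two_neq0 : 2%:R != 0 :> K.
Hypothesis act_linr : forall x, linear (act x).
Hypothesis theta_lin : linear theta.
Hypothesis theta_act : forall x u, theta (lact x u) = gact x (theta u).
Hypothesis Z_linl : forall m, linear (Z ^~ m).
Hypothesis Z_linr : forall u, linear (Z u).
Hypothesis Z_anti : forall u v m, Z u (Z v m) = - Z v (Z u m).
Hypothesis Z_act : forall x u m, act x (Z u m) = Z (gact x u) m + Z u (act x m).

(** Two instances occur: creation from the empty state, with G the identity, and contraction of the
    full state, with G the complement. *)
Variables (beta : mode l -> N1) (t0 : mode l) (A0 : {set mode l}).
Variables (G : {set mode l} -> {set mode l}) (c : {set mode l} -> K).
Variables (D0 D : {pred state l}).
Hypothesis beta_span : forall u, exists k : mode l -> K, u = \sum_t k t *: beta t.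
Hypothesis G_inj : injective G.
Hypothesis c_neq0 : forall A, c A != 0.
Hypothesis Z_ket : forall (A : {set mode l}) a,
  Zprod Z [seq theta (beta t) | t <- enum A] (ket K A0 a) = c A *: ket K (G A) a.
Hypothesis D0_A0 : forall (A : {set mode l}) a, (A, a) \in D0 -> A = A0.
Hypothesis D_G : forall (B : {set mode l}) a, (B, a) \in D <->
  exists A : {set mode l}, [/\ #|A| = r, B = G A & (A0, a) \in D0].

Definition shift (B : {set mode l}) : M -> M := ket_lift (fun s : state l => ket K B s.2).
HB.instance Definition _ B := GRing.isLinear.Build K M M *:%R (shift B)
  (ket_lift_linear _).

Lemma shiftE (B A : {set mode l}) a : shift B (ket K A a) = ket K B a.
Proof. exact: ket_liftE. Qed.

Lemma kcoef_shift (A B : {set mode l}) a m : supported D0 m ->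
  kcoef (B, a) (shift A m) = (A == B)%:R *: kcoef (A0, a) m.
Proof.
move: m; apply: supported_ind => [|k u v uP vP|A' a' /D0_A0->].
- by rewrite !linear0.
- by rewrite !linearP /= uP vP.
- by rewrite shiftE !kcoefE !xpair_eqE eqxx /=; case: eqP; rewrite ?scale1r ?scale0r.
Qed.

Lemma Zprod_shift (A : {set mode l}) m : supported D0 m ->
  Zprod Z [seq theta (beta t) | t <- enum A] m = c A *: shift (G A) m.
Proof.
move: m; apply: supported_ind => [|k u v uP vP|A' a /D0_A0->].
- by rewrite (lin_0 (Zprod_linear Z_linr _)) linear0 scaler0.
- by rewrite (Zprod_linear Z_linr) uP vP [shift _ (_ + _)]linearP scalerDr !scalerA mulrC.
- by rewrite Z_ket shiftE.
Qed.

Lemma tensor_span (z : Λ^r N1 ⊗ N2) : exists nn : {set mode l} -> N2,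
  z = \sum_(A : {set mode l} | #|A| == r) tens (basis_wedge r beta t0 A) (nn A).
Proof.
move: z; apply: tens_ind => [|a u v [nn ->] [nn' ->]|q n].
- exists (fun=> 0); rewrite big1 // => A _; exact: (lin_0 (tens_linr _)).
- exists (fun A => a *: nn A + nn' A); rewrite scaler_sumr -big_split.
  by apply: eq_bigr => A _ /=; rewrite tens_linr.
have [k ->] := exterior_span t0 beta_span q; exists (fun A => k A *: n).
rewrite (lin_sum (tens_linl _)); apply: eq_bigr => A _.
by rewrite (lin_Z (tens_linl _)) (lin_Z (tens_linr _)).
Qed.

(** The basis wedge of A tensored with n goes to a nonzero multiple of the image of n moved to the
    exterior state [G A]. Distinct A give distinct states, so the components [nn A] can be read off
    from coefficients, and injectivity follows without a basis of the tensor product. *)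
Lemma embeds_tensor : embeds act N2 (supported D0) ->
  embeds act (Λ^r N1 ⊗ N2) (supported D).
Proof.
move=> [i [iL iI ia iE]].
have iD n : supported D0 (i n) by apply/iE; exists n.
have [F [FLl FLr FE Fact]] := exterior_mult r two_neq0 act_linr theta_lin theta_act
  Z_linl Z_linr Z_anti Z_act.
have [f [fL fa fE]] : exists f : Λ^r N1 ⊗ N2 -> M, [/\ linear f,
    forall x z, f (lact x z) = act x (f z) & forall p q, f (tens p q) = F p (i q)].
  apply: tensor_lift => // [p a q q'|x p q]; first by rewrite iL FLr.
  by rewrite Fact ia.
have fbE (A : {set mode l}) n : #|A| == r ->
    f (tens (basis_wedge r beta t0 A) n) = c A *: shift (G A) (i n).
  move=> /eqP Ar; rewrite fE FE -Zprod_shift //; congr Zprod.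
  apply: (@eq_from_nth _ 0) => [|k]; rewrite !size_map -enumT size_enum_ord -?cardE // => kr.
  rewrite (nth_map (Ordinal kr)) ?size_enum_ord // ffunE nth_enum_ord //.
  by rewrite (nth_map t0) // -cardE Ar.
have fsE nn : f (\sum_(A : {set mode l} | #|A| == r) tens (basis_wedge r beta t0 A) (nn A)) =
    \sum_(A : {set mode l} | #|A| == r) c A *: shift (G A) (i (nn A)).
  by rewrite (lin_sum fL); apply: eq_bigr => A Ar; exact: fbE.
exists f; split=> // [u v uv|m].
  apply/eqP; rewrite -subr_eq0; apply/eqP.
  have : f (u - v) = 0 by rewrite (lin_B fL) uv subrr.
  have [nn ->] := tensor_span (u - v); rewrite fsE => E.
  rewrite big1 // => A Ar; suff -> : nn A = 0 by exact: (lin_0 (tens_linr _)).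
  apply: iI; rewrite (lin_0 iL); apply: kcoef_eq0 => -[B a].
  have [BD|] := boolP ((B, a) \in D0); last by move/iD.
  have := congr1 (kcoef (G A, a)) E; rewrite linear0 linear_sum (bigD1 A) //=.
  rewrite linearZ /= kcoef_shift // eqxx scale1r (D0_A0 BD) big1 ?addr0.
    by move/eqP; rewrite scaler_eq0 (negPf (c_neq0 A)) => /eqP.
  move=> B' /andP[_ BA]; rewrite linearZ /= kcoef_shift //.
  by rewrite (inj_eq G_inj) (negPf BA) scale0r scaler0.
split=> [|[z <-]].
  move: m; apply: supported_ind => [|k u v [z <-] [z' <-]|B a /D_G[A [Ar -> aD]]].
  - by exists 0; exact: (lin_0 fL).
  - by exists (k *: z + z'); rewrite fL.
  have /iE[n nE] : supported D0 (ket K A0 a) by exact: supported_ket.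
  exists ((c A)^-1 *: tens (basis_wedge r beta t0 A) n).
  by rewrite (lin_Z fL) fbE ?Ar // nE shiftE scalerA mulVf // scale1r.
have [nn ->] := tensor_span z; rewrite fsE => -[B a] BD.
rewrite linear_sum big1 //= => A /eqP Ar; rewrite linearZ /= kcoef_shift //.
case: eqP => [E|_]; last by rewrite scale0r scaler0.
rewrite scale1r iD ?scaler0 //; apply: contra BD => aD.
by apply/D_G; exists A.
Qed.

End TensorEmbedding.

Section SpinorTensor.
Variables (K : fieldType) (l : nat) (V : vectType K) (w : {skew_symmetric V}).
Hypothesis two_neq0 : 2%:R != 0 :> K.
Variable b : symp_basis l w.
Local Notation M := (fock K l).
Local Notation N1 := (dual_natural w).
Implicit Types (A : {set mode l}) (a : occ l) (u v : V) (m : M) (x : sp w).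

(** The inverse of u |-> w u, through which the forms act on the Fock space; it is equivariant
    because sp preserves w. *)
Definition dual_vec (phi : N1) : V := \sum_t (phi : 'Hom(V, K^o)) (b t) *: dualb b t.
Definition dual_form (u : V) : N1 := linfun (w u : V -> K^o).

Lemma dual_formE u v : (dual_form u : 'Hom(V, K^o)) v = w u v.
Proof.
pose f := HB.pack_for {linear V -> K^o} (w u : V -> K^o)
  (GRing.isLinear.Build K V K^o *:%R (w u : V -> K^o) (form_linr w u)).
exact: (lfunE f).
Qed.

Lemma form_dual_vec phi u : w (dual_vec phi) u = (phi : 'Hom(V, K^o)) u.
Proof.
rewrite [u in RHS](dualb_expand b) linear_sum /dual_vec (lin_sum (form_linl w u)).
apply: eq_bigr => t _; rewrite (lin_Z (form_linl w u)) [RHS]linearZ /=.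
exact: mulrC.
Qed.

Lemma dual_vecK phi : dual_form (dual_vec phi) = phi.
Proof. by apply/lfunP => u; rewrite [LHS]dual_formE form_dual_vec. Qed.

Lemma dual_formK u : dual_vec (dual_form u) = u.
Proof.
rewrite [RHS](basis_expand b); apply: eq_bigr => t _.
by rewrite dual_formE.
Qed.

Lemma dual_vec_linear : linear dual_vec.
Proof.
move=> a p q; rewrite /dual_vec scaler_sumr -big_split; apply: eq_bigr => t _ /=.
rewrite add_lfunE scale_lfunE.
pose P := (p : 'Hom(V, K^o)) (b t) : K; pose Q := (q : 'Hom(V, K^o)) (b t) : K.
by have := scalerDl (dualb b t) (a * P) Q; rewrite -scalerA => E; exact: E.
Qed.

Lemma dual_vec_act x phi : dual_vec (lact x phi) = sp_val x (dual_vec phi).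
Proof.
rewrite [RHS](basis_expand b); apply: eq_bigr => t _; congr (_ *: _).
by rewrite sp_valP form_dual_vec [lact _ _]/(dual_act _ _) opp_lfunE comp_lfunE.
Qed.

Lemma dual_form_linear : linear dual_form.
Proof.
move=> a u v; apply/lfunP => z.
by rewrite add_lfunE scale_lfunE !dual_formE formPl.
Qed.

Lemma dual_span (bb : mode l -> V) (c : V -> mode l -> K) :
  (forall u, u = \sum_t c u t *: bb t) ->
  forall phi : N1, exists k : mode l -> K, phi = \sum_t k t *: dual_form (bb t).
Proof.
move=> bbE phi; exists (c (dual_vec phi)).
rewrite -[LHS]dual_vecK {1}[dual_vec phi]bbE (lin_sum dual_form_linear).
by apply: eq_bigr => t _; rewrite (lin_Z dual_form_linear).
Qed.

Lemma ext_ket (s : seq (mode l)) : uniq s -> exists2 c : K, c != 0 &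
  forall a, Zprod (ext b) [seq b t | t <- s] (ket K set0 a) = c *: ket K [set t in s] a.
Proof.
elim: s => [_|t s IHs /andP[ts us]].
  exists 1; first exact: oner_neq0.
  by move=> a; rewrite scale1r; congr ket; apply/setP => t; rewrite !inE.
have [c c0 cE] := IHs us; exists (c * fsign K t [set t in s]).
  by rewrite mulf_neq0 // fsign_neq0.
move=> a; rewrite map_cons Zprod_cons cE extE linearZ /= creU inE (negPf ts) scalerA; congr (_ *: ket _ _ _).
by apply/setP => u; rewrite !inE.
Qed.

Lemma ctr_ket (s : seq (mode l)) : uniq s -> exists2 c : K, c != 0 &
  forall a, Zprod (ctr b) [seq dualb b t | t <- s] (ket K setT a) =
    c *: ket K (~: [set t in s]) a.
Proof.
elim: s => [_|t s IHs /andP[ts us]].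
  exists 1; first exact: oner_neq0.
  by move=> a; rewrite scale1r; congr ket; apply/setP => t; rewrite !inE.
have [c c0 cE] := IHs us; exists (c * fsign K t (~: [set t in s])).
  by rewrite mulf_neq0 // fsign_neq0.
move=> a; rewrite map_cons Zprod_cons cE ctrE linearZ /= annU !inE (negPf ts) scalerA; congr (_ *: ket _ _ _).
by apply/setP => u; rewrite !inE negb_or.
Qed.

Lemma ext_full u m : ext b u (shift setT m) = 0.
Proof.
move: m; apply: (@ket_ext _ _ _ _ (fun=> 0)) => [k m n|k m n|A a].
- by rewrite !linearP.
- by rewrite scaler0 addr0.
rewrite shiftE /ext big1 // => t _; by rewrite creU inE scaler0.
Qed.

Lemma ctr_empty u m : supported (grade 0 false) m -> ctr b u m = 0.
Proof.
move: m; apply: supported_ind => [|k m n m0 n0|A a]; first exact: linear0.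
  by rewrite linearP /= m0 n0 scaler0 addr0.
rewrite gradeE cards_eq0 => /andP[/eqP-> _].
by rewrite /ctr big1 // => t _; rewrite annU inE scaler0.
Qed.

Lemma weyl_shift u m : weyl b u (shift setT m) = shift setT (weyl b u m).
Proof.
rewrite /weyl linear_sum; apply: eq_bigr => t _; rewrite linearZ /=; congr (_ *: _).
move: m; apply: ket_ext => [k m n|k m n|A a]; try by rewrite !linearP.
by rewrite /bos shiftE; case: t.1; rewrite ?derU ?mulxU ?linearZ /= shiftE.
Qed.

(** The full exterior state is invariant under sp like the empty one: there [ext u] after [ctr v] is
    the scalar w v u, and the two fermionic terms of [quad] cancel because w is skew. *)
Lemma sp_act_shift x m : supported (grade 0 false) m ->
  shift setT (sp_act b x m) = sp_act b x (shift setT m).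
Proof.
move=> m0; rewrite /sp_act linearZ /= linear_sum; congr (_ *: _).
apply: eq_bigr => t _; move: (dualb _ _) (sp_val _ _) => u v.
rewrite /quad !(ctr_empty _ m0) !linear0 addr0 add0r linearZ /= linearD /= -!weyl_shift.
suff -> : ext b u (ctr b v (shift setT m)) + ext b v (ctr b u (shift setT m)) = 0.
  by rewrite add0r.
have E u' v' : ext b u' (ctr b v' (shift setT m)) = w v' u' *: shift setT m.
  have := ctr_ext b v' u' (shift setT m); rewrite ext_full linear0 => /eqP.
  by rewrite eq_sym subr_eq0 => /eqP.
by rewrite !E -scalerDl form_skew addNr scale0r.
Qed.

Variables (N2 : lieModType (sp w)) (n : 'I_l).
Hypothesis N2_embeds : embeds (sp_act b) N2 (supported (grade 0 false)).

Lemma embeds_ext_tensor r : embeds (sp_act b) (Λ^r N1 ⊗ N2) (supported (grade r false)).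
Proof.
have ex A : exists c : K, c != 0 /\ forall a,
    Zprod (ext b) [seq b t | t <- enum A] (ket K set0 a) = c *: ket K A a.
  have [c c0 cE] := ext_ket (enum_uniq (mem A)); exists c; split=> // a.
  by rewrite cE set_enum.
have [c cP] := choice ex.
have D_G (B : {set mode l}) a : (B, a) \in grade r false <->
    exists A, [/\ #|A| = r, B = A & (set0 : {set mode l}, a) \in grade 0 false].
  rewrite !gradeE cards0 eqxx /=; split=> [/andP[/eqP Br ap]|[A [Ar -> ->]]].
    by exists B.
  by rewrite Ar eqxx.
apply: (embeds_tensor two_neq0 (fun x => @linearP _ _ _ _ (sp_act b x)) dual_vec_linear dual_vec_act
  (ext_linl b) (fun u => @linearP _ _ _ _ (ext b u)) (ext_anti b) (sp_act_ext two_neq0 b)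
  (true, n) (dual_span (dualb_expand b)) (G := id) (c := c) _ _ _ _ D_G N2_embeds) => // [A|A a|A a].
- by have [] := cP A.
- by have [_ <-] := cP A; congr Zprod; apply: eq_map => t; rewrite dual_formK.
- by rewrite gradeE cards_eq0 => /andP[/eqP].
Qed.

Lemma embeds_ctr_tensor r : (r <= 2 * l)%N ->
  embeds (sp_act b) (Λ^r N1 ⊗ N2) (supported (grade (2 * l - r) false)).
Proof.
move=> rl.
have cardT : #|{: mode l}| = (2 * l)%N by rewrite card_prod card_bool card_ord.
have ex A : exists c : K, c != 0 /\ forall a,
    Zprod (ctr b) [seq dualb b t | t <- enum A] (ket K setT a) = c *: ket K (~: A) a.
  have [c c0 cE] := ctr_ket (enum_uniq (mem A)); exists c; split=> // a.
  by rewrite cE set_enum.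
have [c cP] := choice ex.
have D0E (a : occ l) : ((setT, a) \in grade (2 * l) false) = ~~ odd (occ_size a).
  by rewrite gradeE cardsT cardT eqxx /=; case: odd.
have D_G (B : {set mode l}) a : (B, a) \in grade (2 * l - r) false <->
    exists A, [/\ #|A| = r, B = ~: A & (setT : {set mode l}, a) \in grade (2 * l) false].
  rewrite D0E gradeE eqbF_neg; split=> [/andP[/eqP Br ap]|[A [Ar -> ->]]].
    exists (~: B); rewrite setCK; split=> //.
    by apply: (@addnI #|B|); rewrite cardsC cardT Br subnK.
  by rewrite cardsCs setCK cardT Ar eqxx.
(* The spinor module is moved from the empty to the full exterior state, where contractions can
   start. *)
have N2T : embeds (sp_act b) N2 (supported (grade (2 * l) false)).
  apply: embeds_ext (embeds_map (T := shift setT) _ _ _ N2_embeds); first last.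
  - move=> m m0 Tm; apply: kcoef_eq0 => -[A a].
    have [Aa|] := boolP ((A, a) \in grade 0 false); last by move/m0.
    have /(congr1 (kcoef (setT, a))) := Tm.
    rewrite (@kcoef_shift _ _ set0 (grade 0 false)) // => [|A' a'].
      rewrite eqxx scale1r linear0; move: Aa; rewrite gradeE cards_eq0 => /andP[/eqP->].
      by [].
    by rewrite gradeE cards_eq0 => /andP[/eqP].
  - by move=> x m; exact: sp_act_shift.
  - exact: linearP.
  move=> m; split=> [[m' m'0 ->]|].
    move: m' m'0; apply: supported_map => [|A a]; first exact: linearP.
    rewrite gradeE shiftE => /andP[_ ap]; apply: supported_ket.
    by rewrite D0E -eqbF_neg.
  move: m; apply: supported_ind => [|k u v [u' u0 ->] [v' v0 ->]|A a].
  - by exists 0; [move=> s _; rewrite linear0|rewrite linear0].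
  - exists (k *: u' + v'); last by rewrite linearP.
    by move=> s sD; rewrite linearP /= u0 // v0 // scaler0 addr0.
  rewrite gradeE => /andP[/eqP AT ap]; exists (ket K set0 a); last first.
    rewrite shiftE; congr ket; apply/eqP; rewrite eqEcard subsetT cardsT AT.
      by rewrite cardT leqnn.
  by apply: supported_ket; rewrite gradeE cards0 eqxx.
apply: (embeds_tensor two_neq0 (fun x => @linearP _ _ _ _ (sp_act b x)) dual_vec_linear dual_vec_act
  (ctr_linl b) (fun u => @linearP _ _ _ _ (ctr b u)) (ctr_anti b) (sp_act_ctr two_neq0 b)
  (true, n) (dual_span (basis_expand b)) (@setC_inj _) (c := c) _ _ _ D_G N2T) => [A|A a|A a].
- by have [] := cP A.
- by have [_ <-] := cP A; congr Zprod; apply: eq_map => t; rewrite dual_formK.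
- rewrite gradeE => /andP[/eqP AT _]; apply/eqP; rewrite eqEcard subsetT AT -cardT cardsT.
  exact: leqnn.
Qed.

End SpinorTensor.

(** * Highest weights in terms of fundamental weights *)

Section WeightCoordinates.
Variables (K : fieldType) (l : nat) (V : vectType K) (w : {skew_symmetric V}).
Variables (h : {vspace sp w}) (P : hdual h -> Prop).
Variables (varpi : nat -> hdual h) (epsilon : 'I_l -> hdual h).
Hypothesis char0 : forall n, n.+1%:R != 0 :> K.
Hypothesis varpiE : forall i : nat, (i <= l)%N ->
  varpi i = \sum_(j < l | (j < i)%N) epsilon j.

Lemma varpi0 : varpi 0 = 0.
Proof. by rewrite varpiE // big_pred0 // => j; rewrite ltn0. Qed.

Lemma varpiS (i : 'I_l) : varpi i.+1 = varpi i + epsilon i.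
Proof.
rewrite (varpiE (ltn_ord i)) (varpiE (ltnW (ltn_ord i))) (bigD1 i) //= addrC; congr (_ + _).
by apply: eq_bigl => j; rewrite ltnS ltn_neqAle andbC.
Qed.

Lemma epsilon_coroot (c : 'I_l -> subvs_of h) :
  (forall i j : 'I_l, varpi i.+1 (c j) = (i == j)%:R) ->
  forall i k : 'I_l, epsilon i (c k) = (i == k)%:R - (i == k.+1 :> nat)%:R.
Proof.
move=> vc i k.
have -> : epsilon i = varpi i.+1 - varpi i by rewrite varpiS addrAC subrr add0r.
rewrite add_lfunE opp_lfunE vc; congr (_ - _); case: i => [[|i] il] /=.
  by rewrite varpi0 zero_lfunE.
by rewrite (vc (Ordinal (ltnW il))) eqSS.
Qed.

(** The element dual to epsilon_k is the sum of the simple coroots from index k on, because their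
    epsilon values telescope. *)
Lemma epsilon_dual (c : 'I_l -> subvs_of h) :
  (forall i k : 'I_l, epsilon i (c k) = (i == k)%:R - (i == k.+1 :> nat)%:R) ->
  forall i k : 'I_l, epsilon i (\sum_(j < l | (k <= j)%N) c j) = (i == k)%:R.
Proof.
move=> ec i k; rewrite linear_sum (eq_bigr _ (fun j _ => ec i j)) sumrB.
have E (Q : pred 'I_l) (i' : 'I_l) : \sum_(j < l | Q j) (i' == j)%:R = (Q i')%:R :> K.
  case: (boolP (Q i')) => Qi.
    rewrite (bigD1 i') //= eqxx big1 ?addr0 // => j /andP[_ ji].
    by rewrite eq_sym (negPf ji).
  by rewrite big1 // => j Qj; case: eqP => // ij; rewrite ij Qj in Qi.
rewrite E; have -> : \sum_(j < l | (k <= j)%N) (i == j.+1 :> nat)%:R = (k < i)%N%:R :> K.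
  case: i => [[|i] il] /=; first by rewrite big1.
  by rewrite -(E (fun j => k <= j)%N (Ordinal (ltnW il))); apply: eq_bigr => j _; rewrite eqSS.
by rewrite -val_eqE /=; case: ltngtP => _; rewrite ?subrr ?subr0.
Qed.

Variables (n : 'I_l) (n_last : n.+1 = l).

Lemma hw_false j : (j <= l)%N -> hw epsilon n j false = varpi j - 2^-1 *: varpi l.
Proof.
move=> jl; rewrite /hw subr0 !varpiE //; congr (_ - _ *: _).
by apply: eq_bigl => i; rewrite ltn_ord.
Qed.

(** The coefficient 3/2 is 1/2 plus the 1 from subtracting epsilon_n = varpi_l - varpi_(l-1), the
    weight lost through the factor x_n. *)
Lemma hw_true j : (j <= l)%N ->
  hw epsilon n j true = varpi j + varpi l.-1 - (3 / 2) *: varpi l.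
Proof.
move=> jl; have -> : hw epsilon n j true = varpi j - 2^-1 *: varpi l - epsilon n.
  by rewrite -hw_false // /hw subr0.
have -> : epsilon n = varpi l - varpi l.-1.
  by rewrite -n_last /= varpiS addrAC subrr add0r.
have -> : 3 / 2 = 1 + 2^-1 :> K.
  by rewrite (natrD _ 2 1) mulrDl mulfV ?(char0 1) // div1r.
rewrite scalerDl scale1r !opprD opprK !addrA.
by rewrite [LHS](ACl (1 * 4 * 3 * 2)).
Qed.

End WeightCoordinates.

Definition spinor_weight (K : fieldType) (g : lieAlgType K) (h : {vspace g}) (l : nat)
    (varpi : nat -> hdual h) (p : bool) (j : nat) : hdual h :=
  if p then varpi j + varpi l.-1 - (3 / 2) *: varpi l else varpi j - 2^-1 *: varpi l.

Section RootData.
Variables (K : fieldType) (l : nat) (V : vectType K) (w : {skew_symmetric V}).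
Variables (h : {vspace sp w}) (P : hdual h -> Prop).
Variables (varpi : nat -> hdual h) (epsilon : 'I_l -> hdual h).
Hypothesis char0 : forall n, n.+1%:R != 0 :> K.
Hypothesis l_gt0 : (0 < l)%N.
Hypothesis w_symplectic : is_psymplectic w.
Hypothesis dimV : \dim {: V} = (2 * l)%N.
Hypothesis h_cartan : cartan_subalgebra h.
Hypothesis P_positive : positive_system P.
Hypothesis varpi_fundamental : fundamental_weights P (fun i : 'I_l => varpi i.+1).
Hypothesis varpiE : forall i : nat, (i <= l)%N ->
  varpi i = \sum_(j < l | (j < i)%N) epsilon j.
Hypothesis weights_V : forall lambda : hdual h, is_weight (natural w) lambda <->
  exists i, lambda = epsilon i \/ lambda = - epsilon i.

Local Notation lam := (spinor_weight l varpi).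

Lemma fock_layers : exists (b : symp_basis l w) (n : 'I_l), n.+1 = l /\
  forall r j, (r <= l)%N -> (j <= r)%N ->
  embeds (sp_act b) (L P (lam (odd (r - j)) j)) (layer b n r j).
Proof.
have [alpha [c [_ alphaP alphaC vc]]] := varpi_fundamental.
have alpha_P i : P (alpha i) by have [] := (alphaP (alpha i)).2 (ex_intro _ i erefl).
have ec := epsilon_coroot varpiE vc; have epsilonH := epsilon_dual ec.
have w_nondeg u : (forall v, w u v = 0) -> u = 0.
  move=> u0; have [/eqP rad0 _ _] := w_symplectic.
  apply/eqP; rewrite -memv0 -rad0; apply/mem_orthovP => v _; exact: u0.
have [_ _ h_normal] := h_cartan.
have wV t : is_weight (natural w) (mode_wt epsilon t).
  apply/weights_V; exists t.2; rewrite /mode_wt.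
  by case: t.1; [left | right].
have [b b_wt] := weight_basis char0 w_nondeg dimV epsilonH wV.
have lt : (l.-1 < l)%N by rewrite prednK.
pose n := Ordinal lt; have n_last : n.+1 = l by rewrite /= prednK.
exists b, n; split=> // r j rl jr.
have := embeds_layer char0 epsilonH b_wt h_normal
  (P_sub char0 epsilonH b_wt P_positive alpha_P alphaC ec n_last)
  (P_addee char0 epsilonH b_wt P_positive alpha_P alphaC ec n_last)
  (P_opp P_positive) (not_P0 P_positive) n_last rl jr.
rewrite /spinor_weight; case: odd.
  by rewrite (hw_true char0 varpiE n_last) // (leq_trans jr).
by rewrite (hw_false varpiE n) // (leq_trans jr).
Qed.

End RootData.

(** * Matching the layers with the summands of the theorem *)

Section LayerSums.
Variables (K : fieldType) (l : nat) (V : vectType K) (w : {skew_symmetric V}).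
Variables (h : {vspace sp w}) (P : hdual h -> Prop) (varpi : nat -> hdual h).
Hypothesis char0 : forall n, n.+1%:R != 0 :> K.

Local Notation E r := (Λ^r (dual_natural w)).
Local Notation lam := (spinor_weight l varpi).

Variables (b : symp_basis l w) (n : 'I_l) (n_last : n.+1 = l).
Hypothesis layerP : forall r j, (r <= l)%N -> (j <= r)%N ->
  embeds (sp_act b) (L P (lam (odd (r - j)) j)) (layer b n r j).
Local Notation SS := (L P (lam false 0)).

Lemma embeds_spinor : embeds (sp_act b) SS (supported (grade 0 false)).
Proof.
apply: embeds_ext (embeds_single (layerP (leq0n l) (leq0n 0))) => m.
by rewrite -(layers_grade char0 b n_last m (leq0n l)).
Qed.

Section FixedDegree.
Variables (r : nat) (r_le : (r <= l)%N).
Local Notation layers_of := (layers b n r).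

Definition fits (s : seq nat) := uniq s /\ {subset s <= iota 0 r.+1}.

Lemma fits_cat s1 s2 : fits (s1 ++ s2) -> fits s1 /\ fits s2.
Proof.
rewrite /fits cat_uniq => -[/and3P[u1 _ u2] sub].
by split; split=> // x xs; apply: sub; rewrite mem_cat xs ?orbT.
Qed.

Lemma embeds_fits_cat N1 N2 s1 s2 : fits (s1 ++ s2) ->
  embeds (sp_act b) N1 (layers_of s1) -> embeds (sp_act b) N2 (layers_of s2) ->
  embeds (sp_act b) (N1 ⊕ N2) (layers_of (s1 ++ s2)).
Proof. by case; exact: embeds_cat. Qed.

Lemma embeds_fits_sum p s (f : nat -> nat) : fits (map f s) ->
  (forall k, k \in s -> odd (r - f k) = p) ->
  embeds (sp_act b) (\big[@lie_dsum _ _ / lie_dsum0]_(k <- s) L P (lam p (f k)))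
    (layers_of (map f s)).
Proof.
move=> [us sub] fp; apply: embeds_bigsum => // k ks; rewrite -(fp k ks).
by apply: layerP => //; have := sub _ (map_f f ks); rewrite mem_iota.
Qed.

Lemma embeds_fits1 p j : (j <= r)%N -> odd (r - j) = p ->
  embeds (sp_act b) (L P (lam p j)) (layers_of [:: j]).
Proof. by move=> jr <-; apply/embeds_single/layerP. Qed.

Lemma fits_perm s : perm_eq (iota 0 r.+1) s -> fits s.
Proof.
move=> sP; split; first by rewrite -(perm_uniq sP) iota_uniq.
by move=> x; rewrite (perm_mem sP).
Qed.

(** All three modules embed with the same image, the even part of exterior degree r: one by
    creation, one by contraction from degree 2 l, and N as the sum of all layers. *)
Lemma spinor_iso N s : perm_eq (iota 0 r.+1) s -> embeds (sp_act b) N (layers_of s) ->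
  [/\ E r ⊗ SS ≃ N, E r ⊗ SS ≃ E (2 * l - r)%N ⊗ SS & E (2 * l - r)%N ⊗ SS ≃ N].
Proof.
move=> sP Ns; have N_grade : embeds (sp_act b) N (supported (grade r false)).
  apply: embeds_ext Ns => m; rewrite -(layers_grade char0 b n_last m r_le).
  by split; apply: layers_perm; rewrite // perm_sym.
have two0 : 2%:R != 0 :> K by exact: char0.
have rl2 : (r <= 2 * l)%N by apply: leq_trans r_le _; rewrite leq_pmull.
split.
- by apply: embeds_iso N_grade; apply: embeds_ext_tensor embeds_spinor _.
- apply: embeds_iso (embeds_ctr_tensor two0 n embeds_spinor rl2) _.
  exact: embeds_ext_tensor embeds_spinor _.
- apply: embeds_iso N_grade.
  by have := embeds_ctr_tensor two0 n embeds_spinor (leq_subr r (2 * l)); rewrite subKn.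
Qed.

End FixedDegree.

(** A list that covers the first m integers and has length at most m repeats nothing, so membership
    and size suffice. *)
Lemma iota_perm m (s : seq nat) : (forall x, (x < m)%N -> x \in s) -> (size s <= m)%N ->
  perm_eq (iota 0 m) s.
Proof.
move=> ms sm; have sub : {subset iota 0 m <= s} by move=> x; rewrite mem_iota; exact: ms.
have sm' : (size s <= size (iota 0 m))%N by rewrite size_iota.
apply: uniq_perm; rewrite ?iota_uniq ?(leq_size_uniq (iota_uniq 0 m) sub) //.
by have [] := uniq_min_size (iota_uniq 0 m) sub sm'.
Qed.

Lemma spinor_odd i : (2 * i + 1 <= l)%N -> let r := (2 * i + 1)%N in
  let N := (\bigoplus_(0 <= k < i.+1) L P (lam false (2 * k + 1)%N))
         ⊕ (\bigoplus_(0 <= k < i.+1) L P (lam true (2 * k)%N)) in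
  E r ⊗ SS ≃ E (2 * l - r)%N ⊗ SS /\ E (2 * l - r)%N ⊗ SS ≃ N.
Proof.
move=> il r N.
pose s := [seq (2 * k + 1)%N | k <- index_iota 0 i.+1]
  ++ [seq (2 * k)%N | k <- index_iota 0 i.+1].
have sP : perm_eq (iota 0 r.+1) s.
  apply: iota_perm => [x xr|]; last by rewrite size_cat !size_map !size_iota /r; lia.
  rewrite mem_cat; case: (boolP (odd x)) => ox; apply/orP; [left|right]; apply/mapP.
    by exists x./2; [rewrite mem_index_iota|]; lia.
  by exists x./2; [rewrite mem_index_iota|]; lia.
have sF := fits_perm sP; have [F1 F2] := fits_cat sF.
suff Ns : embeds (sp_act b) N (layers b n r s) by have [] := spinor_iso il sP Ns.
apply: embeds_fits_cat => //; apply: embeds_fits_sum => // k; rewrite mem_index_iota; lia.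
Qed.

Lemma spinor_even i : (2 * i <= l)%N -> let r := (2 * i)%N in
  let N := (\bigoplus_(0 <= k < i.+1) L P (lam false (2 * k)%N))
         ⊕ (\bigoplus_(1 <= k < i.+1) L P (lam true (2 * k - 1)%N)) in
  E r ⊗ SS ≃ E (2 * l - r)%N ⊗ SS /\ E (2 * l - r)%N ⊗ SS ≃ N.
Proof.
move=> il r N.
pose s := [seq (2 * k)%N | k <- index_iota 0 i.+1]
  ++ [seq (2 * k - 1)%N | k <- index_iota 1 i.+1].
have sP : perm_eq (iota 0 r.+1) s.
  apply: iota_perm => [x xr|]; last by rewrite size_cat !size_map !size_iota /r; lia.
  rewrite mem_cat; case: (boolP (odd x)) => ox; apply/orP; [right|left]; apply/mapP.
    by exists x./2.+1; [rewrite mem_index_iota|]; lia.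
  by exists x./2; [rewrite mem_index_iota|]; lia.
have sF := fits_perm sP; have [F1 F2] := fits_cat sF.
suff Ns : embeds (sp_act b) N (layers b n r s) by have [] := spinor_iso il sP Ns.
apply: embeds_fits_cat => //; apply: embeds_fits_sum => // k; rewrite mem_index_iota; lia.
Qed.

(** In degree l the layers j = l and j = l - 1 stand apart because their weights simplify; the list
    keeps the order in which the summands are written. *)
Lemma spinor_mid (s1 s2 : seq nat) (f1 f2 : nat -> nat) :
  (forall k, k \in s1 -> ~~ odd (l - f1 k)) -> (forall k, k \in s2 -> odd (l - f2 k)) ->
  (forall x, (x <= l)%N -> x \in (map f1 s1 ++ [:: l]) ++ map f2 s2 ++ [:: l.-1]) ->
  (size s1 + size s2 < l)%N ->
  E l ⊗ SS ≃ (\big[@lie_dsum _ _ / lie_dsum0]_(k <- s1) L P (lam false (f1 k)))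
    ⊕ L P (lam false l)
    ⊕ (\big[@lie_dsum _ _ / lie_dsum0]_(k <- s2) L P (lam true (f2 k)))
    ⊕ L P (lam true l.-1).
Proof.
move=> f1P f2P ex sz; pose s := ((map f1 s1 ++ [:: l]) ++ map f2 s2) ++ [:: l.-1].
have sP : perm_eq (iota 0 l.+1) s.
  apply: iota_perm => [x xl|]; first by rewrite /s -catA; exact: ex.
  by rewrite !size_cat !size_map /=; lia.
have sF := fits_perm sP; have [F3 _] := fits_cat sF; have [F2 F4] := fits_cat F3.
have [F1 _] := fits_cat F2.
set N := _ ⊕ _; suff /(spinor_iso (leqnn l) sP)[] : embeds (sp_act b) N (layers b n l s) by [].
apply: (embeds_fits_cat (leqnn l) sF); last by apply: embeds_fits1; lia.
apply: (embeds_fits_cat (leqnn l) F3); last by apply: embeds_fits_sum.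
apply: (embeds_fits_cat (leqnn l) F2); last by apply: embeds_fits1; rewrite ?subnn.
by apply: embeds_fits_sum => // k /f1P/negPf.
Qed.

End LayerSums.

(** For odd l the sums up to (l - 3)/2 are written with the exclusive bound [(l - 1) %/ 2], which
    gives the empty sum at l = 1, where natural subtraction would truncate l - 3. *)
Theorem lemma2 (R : realType) (l : nat) (V : vectType R[i])
    (omega : {skew_symmetric V}) (h : {vspace sp omega})
    (Phi_plus : hdual h -> Prop) (varpi : nat -> hdual h)
    (epsilon : 'I_l -> hdual h)
    (l_gt0 : (1 <= l)%N)
    (omega_symplectic : is_psymplectic omega)
    (dimV : \dim {: V} = (2 * l)%N)
    (h_cartan : cartan_subalgebra h)
    (Phi_plus_positive : positive_system Phi_plus)
    (varpi_fundamental :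
      fundamental_weights Phi_plus (fun i : 'I_l => varpi i.+1))
    (epsilon_basis : basis_of {: hdual h} (codom epsilon))
    (epsilon_orthogonal : forall i j, i != j ->
      killing_orthogonal (epsilon i) (epsilon j))
    (varpiE : forall i : nat, (i <= l)%N ->
      varpi i = \sum_(j < l | (j < i)%N) epsilon j)
    (weights_V : forall lambda : hdual h,
      is_weight (natural omega) lambda <->
      exists i, lambda = epsilon i \/ lambda = - epsilon i) :
  let SS := L Phi_plus (- (1 / 2) *: varpi l) in
  let E r := Λ^r (dual_natural omega) in
  [/\ forall i : nat, (2 * i + 1 <= l - 1)%N ->
        (E (2 * i + 1)%N ⊗ SS ≃ E (2 * l - 2 * i - 1)%N ⊗ SS) /\
        (E (2 * l - 2 * i - 1)%N ⊗ SS ≃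
           (\bigoplus_(0 <= k < i.+1)
              L Phi_plus (varpi (2 * k + 1)%N - (1 / 2) *: varpi l))
         ⊕ (\bigoplus_(0 <= k < i.+1)
              L Phi_plus (varpi (2 * k)%N + varpi (l - 1)%N
                - (3 / 2) *: varpi l))),
      forall i : nat, (2 * i <= l - 1)%N ->
        (E (2 * i)%N ⊗ SS ≃ E (2 * l - 2 * i)%N ⊗ SS) /\
        (E (2 * l - 2 * i)%N ⊗ SS ≃
           (\bigoplus_(0 <= k < i.+1)
              L Phi_plus (varpi (2 * k)%N - (1 / 2) *: varpi l))
         ⊕ (\bigoplus_(1 <= k < i.+1)
              L Phi_plus (varpi (2 * k - 1)%N + varpi (l - 1)%N
                - (3 / 2) *: varpi l))),
      ~~ odd l ->
        E l ⊗ SS ≃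
           (\bigoplus_(0 <= k < ((l - 2) %/ 2).+1)
              L Phi_plus (varpi (2 * k)%N - (1 / 2) *: varpi l))
         ⊕ L Phi_plus ((1 / 2) *: varpi l)
         ⊕ (\bigoplus_(1 <= k < ((l - 2) %/ 2).+1)
              L Phi_plus (varpi (2 * k - 1)%N + varpi (l - 1)%N
                - (3 / 2) *: varpi l))
         ⊕ L Phi_plus (2 *: varpi (l - 1)%N - (3 / 2) *: varpi l)
    & odd l ->
        E l ⊗ SS ≃
           (\bigoplus_(0 <= k < (l - 1) %/ 2)
              L Phi_plus (varpi (2 * k + 1)%N - (1 / 2) *: varpi l))
         ⊕ L Phi_plus ((1 / 2) *: varpi l)
         ⊕ (\bigoplus_(0 <= k < (l - 1) %/ 2)
              L Phi_plus (varpi (2 * k)%N + varpi (l - 1)%N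
                - (3 / 2) *: varpi l))
         ⊕ L Phi_plus (2 *: varpi (l - 1)%N - (3 / 2) *: varpi l)].
Proof.
move=> SS E; rewrite {}/SS {}/E.
have char0 m : m.+1%:R != 0 :> R[i] by rewrite Num.Theory.pnatr_eq0.
have [b [n [n_last layerP]]] := fock_layers char0 l_gt0 omega_symplectic dimV h_cartan
  Phi_plus_positive varpi_fundamental varpiE weights_V.
have -> : - (1 / 2) *: varpi l = spinor_weight l varpi false 0.
  by rewrite /spinor_weight (varpi0 varpiE) sub0r scaleNr div1r.
have half2 : 1 - 2^-1 = 2^-1 :> R[i].
  by apply/eqP; rewrite subr_eq -mulr2n -[_ *+ 2]mulr_natl mulfV ?(char0 1%N).
(* The layer j = l has weight varpi_l - varpi_l / 2. *)
have -> : L Phi_plus ((1 / 2) *: varpi l) = L Phi_plus (spinor_weight l varpi false l).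
  by rewrite /spinor_weight -[X in X - _]scale1r -scalerBl half2 div1r.
have -> : 2 *: varpi (l - 1)%N - (3 / 2) *: varpi l = spinor_weight l varpi true l.-1.
  by rewrite /spinor_weight subn1 scaler_nat mulr2n.
split=> [i il|i il|l_even|l_odd].
- rewrite -subnDA div1r (subn1 l).
  have il' : (2 * i + 1 <= l)%N by lia.
  exact: (spinor_odd char0 n_last layerP il').
- rewrite div1r (subn1 l).
  have il' : (2 * i <= l)%N by lia.
  exact: (spinor_even char0 n_last layerP il').
- rewrite div1r (subn1 l).
  apply: (spinor_mid char0 n_last layerP) => [k|k|x xl|]; rewrite ?mem_index_iota ?size_iota;
    last by lia.
  + by lia.
  + by lia.
  (* Indices below l - 1 are shared by parity between the two sums; l and l - 1 are the isolated
     summands. *)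
  case: (ltnP x l.-1) => xl1.
    rewrite -catA !mem_cat; case: (boolP (odd x)) => ox.
      suff -> : x \in [seq (2 * k - 1)%N | k <- index_iota 1 ((l - 2) %/ 2).+1] by rewrite !orbT.
      by apply/mapP; exists x./2.+1; [rewrite mem_index_iota|]; lia.
    suff -> : x \in [seq (2 * k)%N | k <- index_iota 0 ((l - 2) %/ 2).+1] by [].
    by apply/mapP; exists x./2; [rewrite mem_index_iota|]; lia.
  have /orP[/eqP->|/eqP->] : (x == l) || (x == l.-1) by lia.
    by rewrite !mem_cat !inE eqxx !orbT.
  by rewrite !mem_cat !inE eqxx !orbT.
- rewrite div1r (subn1 l).
  apply: (spinor_mid char0 n_last layerP) => [k|k|x xl|]; rewrite ?mem_index_iota ?size_iota;
    last by lia.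
  + by lia.
  + by lia.
  case: (ltnP x l.-1) => xl1.
    rewrite -catA !mem_cat; case: (boolP (odd x)) => ox.
      suff -> : x \in [seq (2 * k + 1)%N | k <- index_iota 0 (l.-1 %/ 2)] by [].
      by apply/mapP; exists x./2; [rewrite mem_index_iota|]; lia.
    suff -> : x \in [seq (2 * k)%N | k <- index_iota 0 (l.-1 %/ 2)] by rewrite !orbT.
    by apply/mapP; exists x./2; [rewrite mem_index_iota|]; lia.
  have /orP[/eqP->|/eqP->] : (x == l) || (x == l.-1) by lia.
    by rewrite !mem_cat !inE eqxx !orbT.
  by rewrite !mem_cat !inE eqxx !orbT.
Qed.
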